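(* Every tight fan of dimension $d=2$ or $d=3$ has at least one canonical scaling.
   Context: A polyhedral cone in $\mathbb E^d$ is a set $\{p+\alpha_1 v_1+\dots+\alpha_k v_k : \alpha_i\ge 0\}$. A fan in $\mathbb E^d$ is a finite family of polyhedral cones such that every (nonempty) face of a cone of the family belongs to the family and the intersection of any two cones is a nonempty face of each. Its cones are called its faces; those of dimension $d$, $d-1$, $d-2$ are called cells, hyperfaces and coribs, respectively. A fan is complete if its cones cover $\mathbb E^d$, and pointed if its minimal cone is a single point (the vertex). A face $f$ of a complete fan is standard if there is a ball $B$ centered at some relative interior point $p$ of $f$ inside which the fan is centrally symmetric about $p$ (the reflection $x\mapsto 2p-x$ maps the family of intersections of faces of the fan with $B$ to itself). Two cones $c_1,c_2$ with a common face $f$ are locally symmetric in $f$ if there is a ball $B$ centered at some relative interior point $p$ of $f$ such that $c_1\cap B$ and $c_2\cap B$ are centrally symmetric to each other about $p$. A tight fan is a complete pointed $d$-dimensional fan in $\mathbb E^d$ such that the intersection of any two of its $d$-dimensional cones is a standard face of the fan in which these two cones are locally symmetric. A scaling is a positive real function $s$ on the set of hyperfaces. For a corib $R$ let $C_1,\dots,C_k$ be the cells containing $R$ in cyclic order around $R$, let $H_i=C_i\cap C_{i+1}$ (with $C_{k+1}=C_1$) be the hyperfaces containing $R$, and let $\mathbf n_i$ be the unit normal to $H_i$ directed from $C_i$ to $C_{i+1}$. The torsion of $s$ around $R$ is $\Delta_s(R)=\sum_{i=1}^k s(H_i)\mathbf n_i$ (defined up to sign). The scaling is canonical if $\Delta_s(R)=0$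 for every corib $R$. *)

(* Defs.v *)
(* The space E^d is 'rV[R]_d for R : realType. *)
From HB Require Import structures.
From mathcomp Require Import all_boot all_order all_algebra.
From mathcomp Require Import all_classical all_reals all_analysis.

Set Implicit Arguments.
Unset Strict Implicit.
Unset Printing Implicit Defensive.

Import Order.TTheory GRing.Theory Num.Theory.

Local Open Scope classical_set_scope.
Local Open Scope ring_scope.

Definition dot (R : realType) (d : nat) (u v : 'rV[R]_d) : R :=
  \sum_(i < d) u 0 i * v 0 i.

(* The library norm on 'rV[R]_d is the sup norm, so the Euclidean norm and
   balls have to be introduced. *)
Definition enorm (R : realType) (d : nat) (u : 'rV[R]_d) : R :=
  Num.sqrt (dot u u).

Definition eball (R : realType) (d : nat) (p : 'rV[R]_d) (r : R) :
    set 'rV[R]_d :=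
  [set x | enorm (x - p) < r].

Definition affine_hull (R : realType) (d : nat) (A : set 'rV[R]_d) :
    set 'rV[R]_d :=
  [set x | exists (n : nat) (a : 'I_n -> R) (y : 'I_n -> 'rV[R]_d),
     [/\ forall i, A (y i), \sum_(i < n) a i = 1
       & x = \sum_(i < n) a i *: y i]].

Definition has_dim (R : realType) (d : nat) (A : set 'rV[R]_d) (k : nat) :
    Prop :=
  exists (p : 'rV[R]_d) (U : {vspace 'rV[R]_d}),
    affine_hull A = [set x | x - p \in U] /\ \dim U = k.

Definition relint (R : realType) (d : nat) (A : set 'rV[R]_d) :
    set 'rV[R]_d :=
  [set p | A p /\ exists2 r : R, 0 < r & eball p r `&` affine_hull A `<=` A].

Definition polyhedral_cone (R : realType) (d : nat) (c : set 'rV[R]_d) : Prop :=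
  exists (p : 'rV[R]_d) (k : nat) (v : 'I_k -> 'rV[R]_d),
    c = [set x | exists2 a : 'I_k -> R,
           forall i, 0 <= a i & x = p + \sum_(i < k) a i *: v i].

(* u = 0 is allowed: it yields c itself and the empty face. *)
Definition is_face (R : realType) (d : nat) (f c : set 'rV[R]_d) : Prop :=
  exists (u : 'rV[R]_d) (b : R),
    (forall x, c x -> dot u x <= b) /\ f = c `&` [set x | dot u x = b].

Definition is_fan (R : realType) (d : nat) (F : set (set 'rV[R]_d)) : Prop :=
  [/\ finite_set F,
      forall c, F c -> polyhedral_cone c,
      forall c f, F c -> is_face f c -> f !=set0 -> F f
    & forall c1 c2, F c1 -> F c2 ->
        [/\ c1 `&` c2 !=set0, is_face (c1 `&` c2) c1
          & is_face (c1 `&` c2) c2]].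

Definition complete_fan (R : realType) (d : nat) (F : set (set 'rV[R]_d)) :
    Prop :=
  is_fan F /\ \bigcup_(c in F) c = setT.

Definition minimal_cone (R : realType) (d : nat) (F : set (set 'rV[R]_d))
    (m : set 'rV[R]_d) : Prop :=
  F m /\ forall c, F c -> m `<=` c.

Definition pointed (R : realType) (d : nat) (F : set (set 'rV[R]_d)) : Prop :=
  exists v : 'rV[R]_d, minimal_cone F [set v].

(* Codimension j is expressed by k + j = d, avoiding truncated subtraction. *)
Definition face_codim (R : realType) (d : nat) (F : set (set 'rV[R]_d))
    (j : nat) (c : set 'rV[R]_d) : Prop :=
  F c /\ exists2 k : nat, (k + j)%N = d & has_dim c k.

Definition cell (R : realType) (d : nat) (F : set (set 'rV[R]_d)) :
    set 'rV[R]_d -> Prop := face_codim F 0.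

Definition hyperface (R : realType) (d : nat) (F : set (set 'rV[R]_d)) :
    set 'rV[R]_d -> Prop := face_codim F 1.

Definition corib (R : realType) (d : nat) (F : set (set 'rV[R]_d)) :
    set 'rV[R]_d -> Prop := face_codim F 2.

Definition reflection (R : realType) (d : nat) (p x : 'rV[R]_d) : 'rV[R]_d :=
  p *+ 2 - x.

Definition fan_trace (R : realType) (d : nat) (F : set (set 'rV[R]_d))
    (B : set 'rV[R]_d) : set (set 'rV[R]_d) :=
  [set c `&` B | c in F].

Definition standard_face (R : realType) (d : nat) (F : set (set 'rV[R]_d))
    (f : set 'rV[R]_d) : Prop :=
  F f /\ exists (p : 'rV[R]_d) (r : R),
    [/\ relint f p, 0 < r
      & [set reflection p @` X | X in fan_trace F (eball p r)]
        = fan_trace F (eball p r)].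

Definition locally_symmetric (R : realType) (d : nat)
    (c1 c2 f : set 'rV[R]_d) : Prop :=
  exists (p : 'rV[R]_d) (r : R),
    [/\ relint f p, 0 < r
      & reflection p @` (c1 `&` eball p r) = c2 `&` eball p r].

Definition tight_fan (R : realType) (d : nat) (F : set (set 'rV[R]_d)) : Prop :=
  [/\ complete_fan F,
      pointed F,
      exists c, cell F c
    & forall c1 c2, cell F c1 -> cell F c2 -> c1 <> c2 ->
        standard_face F (c1 `&` c2) /\ locally_symmetric c1 c2 (c1 `&` c2)].

(* Only the values of s on hyperfaces matter. *)
Definition scaling (R : realType) (d : nat) (F : set (set 'rV[R]_d))
    (s : set 'rV[R]_d -> R) : Prop :=
  forall H, hyperface F H -> 0 < s H.

(* C enumerates the cells containing Q by increasing polar angle in the plane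
   through p orthogonal to Q, with respect to an orthonormal frame (e1, e2);
   each cell is located by one of its interior points in that plane. All
   starting cells and both senses of rotation arise by changing the frame. *)
Definition cyclic_order (R : realType) (d : nat) (F : set (set 'rV[R]_d))
    (Q : set 'rV[R]_d) (k : nat) (C : 'I_k -> set 'rV[R]_d) : Prop :=
  [/\ injective C,
      range C = [set c | cell F c /\ Q `<=` c]
    & exists (p e1 e2 : 'rV[R]_d) (rho theta : 'I_k -> R),
      [/\ relint Q p,
          [/\ enorm e1 = 1, enorm e2 = 1 & dot e1 e2 = 0],
          forall x y, Q x -> Q y ->
            dot e1 (x - y) = 0 /\ dot e2 (x - y) = 0,
          forall i j : 'I_k, (i < j)%N -> theta i < theta j
        & forall i,
            [/\ 0 <= theta i < pi *+ 2, 0 < rho i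
              & relint (C i)
                  (p + rho i *: (cos (theta i) *: e1 + sin (theta i) *: e2))]]].

Definition unit_normal (R : realType) (d : nat) (c1 c2 : set 'rV[R]_d)
    (n : 'rV[R]_d) : Prop :=
  [/\ enorm n = 1,
      forall x y, (c1 `&` c2) x -> (c1 `&` c2) y -> dot n (x - y) = 0
    & forall h x1 x2, (c1 `&` c2) h -> c1 x1 -> c2 x2 ->
        dot n x1 <= dot n h <= dot n x2].

(* The torsion depends, through its sign, on the sense of rotation, hence the
   set of all values obtained; ordS is the cyclic successor on 'I_k. *)
Definition torsion (R : realType) (d : nat) (F : set (set 'rV[R]_d))
    (s : set 'rV[R]_d -> R) (Q : set 'rV[R]_d) : set 'rV[R]_d :=
  [set t | exists (k : nat) (C : 'I_k -> set 'rV[R]_d)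
                  (n : 'I_k -> 'rV[R]_d),
     [/\ cyclic_order F Q C,
         forall i, unit_normal (C i) (C (ordS i)) (n i)
       & t = \sum_(i < k) s (C i `&` C (ordS i)) *: n i]].

(* Equality with [set 0] also asserts that a torsion value exists. *)
Definition canonical_scaling (R : realType) (d : nat)
    (F : set (set 'rV[R]_d)) (s : set 'rV[R]_d -> R) : Prop :=
  scaling F s /\ forall Q, corib F Q -> torsion F s Q = [set 0].

(* Main.v *)
Require Import Defs.
From HB Require Import structures.
From mathcomp Require Import all_boot all_order all_algebra.
From mathcomp Require Import all_classical all_reals all_analysis.
From mathcomp Require Import ring lra.

(** Let the vertex of the fan be the origin.  A canonical scaling comes from a
convex function that is linear exactly on the cells: if [G C] is its gradient
on the cell [C], then [G C' - G C] is normal to the wall between two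
neighbouring cells [C] and [C'] and points to [C'], its length is the scaling
factor of the wall, and the torsion around a corib is a sum of differences that
telescopes (lemma [potential_canonical_scaling]).  So the theorem says that a
tight fan in dimension 2 or 3 is the normal fan of a polytope; the gradients
are called a potential.

Tightness enters as follows.  Two cells that share only the vertex are opposite
to each other, and then the whole fan is centrally symmetric.  Two cells that
share only a ray are opposite across this ray, and then exactly four cells
contain the ray, one in each quadrant between two planes (lemma [quad_exists]).
Any other two cells share a wall.  Cells are separated by hyperplanes that meet
both of them exactly in their intersection ([cone_of_separation], from Farkas'
lemma), and these separators provide all the linear forms below.

In the plane there are either four cells, in two opposite pairs, or three.  In
space there are four cases, according to which kinds of pairs occur.
- Opposite cells and rays with four cells: the cells are the octants of a
  coordinate system, and the sum of the absolute values of the coordinates is a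
  convex function as required ([potential_cube]).
- Opposite cells, but no ray with four cells: there are three pairs of opposite
  cells, and the gradients are obtained from the separators by solving a linear
  system ([potential_octahedron]).
- No opposite cells, but a ray [q] with four cells: at most two cells do not
  contain [q].  If there is one, the maximum of zero and of the separators from
  this cell, scaled to be 1 at [q], is a convex function as required
  ([potential_apex]); if there are two, one takes the separators from both and
  adds the absolute value of the separator between them ([potential_prism]).
- All cells share walls: then at most one cell avoids a given ray [q], since two
  of them, the ray, and three cells around the ray would give a plane drawing of
  the complete bipartite graph on 3 + 3 vertices ([no_K33]).  Thus
  [potential_apex] applies again.

Outside of the first case, two gradients are compared on a cell [C] containing
[q] by moving a point of [C] in the direction [- q]: one leaves [C] in a point
that also lies in a cell that does not contain [q] ([descent]).  There the
comparison is easy, and it is transported back because the linear forms in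
question have the same value at [q]. *)

Set Implicit Arguments.
Unset Strict Implicit.
Unset Printing Implicit Defensive.

Import Order.TTheory GRing.Theory Num.Theory.

Local Open Scope classical_set_scope.
Local Open Scope ring_scope.

(** * The Euclidean scalar product *)

Section Dot.
Variables (R : realType) (d : nat).
Implicit Types u v w x y n : 'rV[R]_d.

Lemma dotC u v : dot u v = dot v u.
Proof. by rewrite /dot; apply: eq_bigr => i _; rewrite mulrC. Qed.

Lemma dotDr u v w : dot u (v + w) = dot u v + dot u w.
Proof. by rewrite /dot -big_split; apply: eq_bigr => i _; rewrite mxE mulrDr. Qed.

Lemma dotZr u a v : dot u (a *: v) = a * dot u v.
Proof. by rewrite /dot mulr_sumr; apply: eq_bigr => i _; rewrite mxE mulrCA. Qed.

Lemma dotNr u v : dot u (- v) = - dot u v.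
Proof. by rewrite -scaleN1r dotZr mulN1r. Qed.

Lemma dotDl u v w : dot (v + w) u = dot v u + dot w u.
Proof. by rewrite dotC dotDr !(dotC u). Qed.

Lemma dotZl u a v : dot (a *: v) u = a * dot v u.
Proof. by rewrite dotC dotZr (dotC u). Qed.

Lemma dotNl u v : dot (- v) u = - dot v u.
Proof. by rewrite dotC dotNr (dotC u). Qed.

Lemma dot0r u : dot u 0 = 0.
Proof. by rewrite -(scale0r u) dotZr mul0r. Qed.

Lemma dot0l u : dot 0 u = 0.
Proof. by rewrite dotC dot0r. Qed.

Lemma dot_ge0 u : 0 <= dot u u.
Proof. by rewrite /dot; apply: sumr_ge0 => i _; rewrite -expr2 sqr_ge0. Qed.

Lemma dot_eq0 u : dot u u = 0 -> u = 0.
Proof.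
move/eqP; rewrite /dot psumr_eq0; last by move=> i _; rewrite -expr2 sqr_ge0.
move/allP => h; apply/rowP => i; rewrite mxE; apply/eqP.
by have := h i (mem_index_enum i); rewrite /= -expr2 sqrf_eq0.
Qed.

Lemma dot_gt0 u : u != 0 -> 0 < dot u u.
Proof.
move=> u0; rewrite lt_neqAle dot_ge0 andbT eq_sym.
by apply: contra u0 => /eqP/dot_eq0 ->.
Qed.

Lemma dot_ext m n : (forall x, dot m x = dot n x) -> m = n.
Proof.
move=> h; apply/eqP; rewrite -subr_eq0; apply/eqP/dot_eq0.
by rewrite dotDl dotNl h subrr.
Qed.

Lemma enorm_sqr u : enorm u ^+ 2 = dot u u.
Proof. by rewrite /enorm sqr_sqrtr // dot_ge0. Qed.

Lemma enorm_gt0 u : u != 0 -> 0 < enorm u.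
Proof. by move=> u0; rewrite /enorm sqrtr_gt0 dot_gt0. Qed.

Lemma enorm_ltP u r : 0 < r -> (enorm u < r) = (dot u u < r ^+ 2).
Proof.
by move=> r0; rewrite -enorm_sqr ltr_pXn2r // nnegrE; [exact: sqrtr_ge0|exact: ltW].
Qed.

End Dot.

Ltac dotE := rewrite ?(dotDr, dotDl, dotNr, dotNl, dotZr, dotZl, dot0r, dot0l).

(** * Finitely generated cones and the separation of two cones *)

Section Cones.
Variables (R : realType) (d : nat).
Implicit Types (u v w x y n : 'rV[R]_d) (s : seq 'rV[R]_d).

(** Recursion on the list of generators, for the induction in [farkas]. *)
Fixpoint cone_of s : set 'rV[R]_d :=
  if s is w :: s' then [set x | exists2 a : R, 0 <= a & cone_of s' (x - a *: w)]
  else [set 0].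

Lemma cone_of0 s : cone_of s 0.
Proof.
elim: s => //= w s ih; exists 0 => //.
by rewrite scale0r subr0.
Qed.

Lemma cone_ofD s x y : cone_of s x -> cone_of s y -> cone_of s (x + y).
Proof.
elim: s x y => [|w s ih] x y /=; first by move=> -> ->; rewrite addr0.
move=> [a a0 h1] [b b0 h2]; exists (a + b); first exact: addr_ge0.
have -> : x + y - (a + b) *: w = (x - a *: w) + (y - b *: w).
  by rewrite scalerDl opprD addrACA.
exact: ih.
Qed.

Lemma cone_ofZ s t x : 0 <= t -> cone_of s x -> cone_of s (t *: x).
Proof.
move=> t0; elim: s x => [|w s ih] x /=; first by move=> ->; rewrite scaler0.
move=> [a a0 h]; exists (t * a); first exact: mulr_ge0.
by rewrite -scalerA -scalerBr; exact: ih.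
Qed.

Lemma cone_of_cons w s x : cone_of s x -> cone_of (w :: s) x.
Proof. by move=> h; exists 0; rewrite //= scale0r subr0. Qed.

Lemma cone_of_head w s : cone_of (w :: s) w.
Proof. by exists 1 => //; rewrite scale1r subrr; exact: cone_of0. Qed.

Lemma cone_of_mem s w : w \in s -> cone_of s w.
Proof.
elim: s => // v s ih; rewrite inE => /predU1P[->|/ih h].
  exact: cone_of_head.
exact: cone_of_cons.
Qed.

Lemma cone_of_ge0 s n x : (forall w, w \in s -> 0 <= dot n w) ->
  cone_of s x -> 0 <= dot n x.
Proof.
elim: s x => [|w s ih] x h /=; first by move=> ->; rewrite dot0r.
move=> [a a0 /ih]; dotE => {}ih.
have h1 : 0 <= dot n w by apply: h; rewrite mem_head.
have : 0 <= dot n x + - (a * dot n w).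
  by apply: ih => v vs; apply: h; rewrite inE vs orbT.
have := mulr_ge0 a0 h1; lra.
Qed.

Lemma cone_of_cat s1 s2 x : cone_of (s1 ++ s2) x ->
  exists y z, [/\ cone_of s1 y, cone_of s2 z & x = y + z].
Proof.
elim: s1 x => [|w s ih] x /=.
  by move=> h; exists 0, x; rewrite add0r.
move=> [a a0 /ih[y [z [h1 h2 h3]]]]; exists (y + a *: w), z; split => //.
  by exists a => //; rewrite addrK.
by rewrite addrAC -h3 subrK.
Qed.

Lemma cone_of_sub s1 s2 x : {subset s1 <= s2} -> cone_of s1 x -> cone_of s2 x.
Proof.
elim: s1 x => [|w s ih] x h /=; first by move=> ->; exact: cone_of0.
move=> [a a0 h1]; rewrite -(subrK (a *: w) x); apply: cone_ofD.
  by apply: ih h1 => v vs; apply: h; rewrite inE vs orbT.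
by apply: cone_ofZ => //; apply/cone_of_mem/h/mem_head.
Qed.

Lemma cone_of_opp s x : cone_of [seq - w | w <- s] x -> cone_of s (- x).
Proof.
elim: s x => [|w s ih] x /=; first by move=> ->; rewrite oppr0.
move=> [a a0 /ih h]; exists a => //.
by move: h; rewrite opprB scalerN addrC.
Qed.

(** Induction on the number of generators: a functional that works for all
generators but the last one, [w], either works for [w] as well, or allows one
to project everything along [w] onto its kernel. *)
Lemma farkas s z : ~ cone_of s z ->
  exists2 n, (forall w, w \in s -> 0 <= dot n w) & dot n z < 0.
Proof.
have [k] := ubnP (size s); elim: k s z => // k ih [|w s] z /= sk.
  move=> z0; exists (- z) => //; rewrite dotNl oppr_lt0 dot_gt0 //.
  by apply/eqP.
move=> hz.
have [|n0 h0 hz0] := ih s z sk; first by move=> h; apply: hz; exact: cone_of_cons.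
have [hw|hw] := leP 0 (dot n0 w).
  by exists n0 => // v; rewrite inE => /predU1P[->|/h0].
have hw' : dot n0 w != 0 by rewrite lt_eqF.
pose f x := x - (dot n0 x / dot n0 w) *: w.
have fge v : 0 <= dot n0 v -> 0 <= - (dot n0 v / dot n0 w).
  by move=> h; rewrite -mulrN -invrN divr_ge0 // oppr_ge0 ltW.
have key s' x : cone_of [seq f v | v <- s'] x ->
    (forall v, v \in s' -> 0 <= dot n0 v) -> cone_of (w :: s') x.
  elim: s' x => [|v s' ihs] x /=.
    by move=> -> _; exact: (@cone_of0 (w :: [::])).
  move=> [a a0 h1] h2.
  have h3 : 0 <= dot n0 v by apply: h2; rewrite mem_head.
  have {}h1 : cone_of (w :: s') (x - a *: f v).
    by apply: ihs h1 _ => u us; apply: h2; rewrite inE us orbT.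
  rewrite -(subrK (a *: f v) x); apply: (@cone_ofD (w :: v :: s')).
    apply: cone_of_sub h1 => u; rewrite !inE => /orP[->//|->].
    by rewrite !orbT.
  apply: cone_ofZ => //; rewrite /f -scaleNr; apply: cone_ofD.
    by apply: cone_of_mem; rewrite !inE eqxx orbT.
  by apply: cone_ofZ; [exact: fge|exact: cone_of_head].
have [||n1 h1 hz1] := ih [seq f v | v <- s] (f z).
- by rewrite size_map.
- move=> /key h; apply: hz.
  rewrite -[z](subrK ((dot n0 z / dot n0 w) *: w)).
  apply: (@cone_ofD (w :: s)); first exact: h.
  apply: cone_ofZ; last exact: cone_of_head.
  by rewrite -mulrNN -invrN divr_ge0 // oppr_ge0 ltW.
pose n := n1 - (dot n1 w / dot n0 w) *: n0.
have nE x : dot n x = dot n1 (f x).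
  by rewrite /n /f; dotE; field.
exists n => [v|]; last by rewrite nE.
rewrite nE inE => /predU1P[->|vs]; last by apply: h1; exact: map_f.
by rewrite /f divff // scale1r subrr dot0r.
Qed.

(** Summing, over the generators that are not reversible in the cone, the
functionals given by [farkas]. *)
Lemma cone_of_lineality s : exists2 n,
  (forall x, cone_of s x -> 0 <= dot n x)
  & (forall x, cone_of s x -> dot n x = 0 -> cone_of s (- x)).
Proof.
suff [n h1 h2] : exists2 n, (forall w, w \in s -> 0 <= dot n w)
    & (forall w, w \in s -> dot n w = 0 -> cone_of s (- w)).
  exists n => [x|]; first exact: cone_of_ge0.
  suff gen s' : {subset s' <= s} -> forall x, cone_of s' x -> dot n x = 0 ->
      cone_of s (- x) by exact: gen.
  elim: s' => [|w s' ih] hs x /=; first by move=> -> _; rewrite oppr0; exact: cone_of0.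
  move=> [a a0 hx] nx.
  have hs' : {subset s' <= s} by move=> v vs; apply: hs; rewrite inE vs orbT.
  have ws : w \in s by apply: hs; rewrite mem_head.
  have e1 : 0 <= dot n (x - a *: w).
    by apply: cone_of_ge0 hx => v /hs'; exact: h1.
  have e2 := mulr_ge0 a0 (h1 w ws).
  have e3 : a * dot n w = 0 by move: e1 e2; dotE; lra.
  have e4 : dot n (x - a *: w) = 0 by dotE; lra.
  rewrite -(subrK (a *: w) x) opprD; apply: cone_ofD; first exact: ih.
  move/eqP: e3; rewrite mulf_eq0 => /orP[/eqP->|/eqP/(h2 w ws)].
    by rewrite scale0r oppr0; exact: cone_of0.
  by rewrite -scalerN; exact: cone_ofZ.
suff [n h1 h2] : exists2 n, (forall w, w \in s -> 0 <= dot n w)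
    & (forall w, w \in s -> w \in s -> dot n w = 0 -> cone_of s (- w)).
  by exists n => // w ws; exact: h2.
suff gen s' : {subset s' <= s} -> exists2 n, (forall w, w \in s -> 0 <= dot n w)
    & (forall w, w \in s' -> w \in s -> dot n w = 0 -> cone_of s (- w)).
  exact: gen.
elim: s' => [|w s' ih] hs; first by exists 0 => // w _; rewrite dot0l.
have [|n h1 h2] := ih; first by move=> v vs; apply: hs; rewrite inE vs orbT.
have [hw|hw] := pselect (cone_of s (- w)).
  by exists n => // v; rewrite inE => /predU1P[->//|/h2].
have [m hm1 hm2] := farkas hw.
exists (n + m) => [v vs|v].
  by dotE; apply: addr_ge0; [exact: h1|exact: hm1].
rewrite inE => /predU1P[-> ws|vs' vs]; dotE.
  by move: hm2 (h1 _ ws); dotE; lra.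
move=> h; apply: h2 => //.
by have := h1 _ vs; have := hm1 _ vs; lra.
Qed.

(** A functional as in [cone_of_lineality] for the cone spanned by one cone and
the opposite of the other: by the assumptions on faces, its reversible elements
are differences of common elements of the two cones. *)
Lemma cone_of_separation s1 s2 :
  (forall x y, cone_of s1 x -> cone_of s1 y -> cone_of s2 (x + y) -> cone_of s2 x) ->
  (forall x y, cone_of s2 x -> cone_of s2 y -> cone_of s1 (x + y) -> cone_of s1 x) ->
  exists n, [/\ forall x, cone_of s1 x -> 0 <= dot n x,
    forall x, cone_of s2 x -> dot n x <= 0,
    forall x, cone_of s1 x -> dot n x = 0 -> cone_of s2 x
    & forall x, cone_of s2 x -> dot n x = 0 -> cone_of s1 x].
Proof.
move=> f12 f21; set s := s1 ++ [seq - w | w <- s2].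
have [n h1 h2] := cone_of_lineality s.
have i1 x : cone_of s1 x -> cone_of s x.
  by apply: cone_of_sub => w ws; rewrite mem_cat ws.
have i2 x : cone_of s2 x -> cone_of s (- x).
  move=> h; have {}h : cone_of [seq - w | w <- [seq - w | w <- s2]] x.
    by rewrite -map_comp (eq_map (g := id)) ?map_id // => w; exact: opprK.
  apply: cone_of_sub (cone_of_opp h) => w ws; by rewrite mem_cat ws orbT.
have e x : cone_of s x -> exists y z, [/\ cone_of s1 y, cone_of s2 z & x = y - z].
  move=> /cone_of_cat[y [z [hy /cone_of_opp hz ->]]].
  by exists y, (- z); rewrite opprK.
exists n; split => [x /i1/h1//|x /i2/h1|x hx nx|x hx nx].
- by dotE; rewrite oppr_ge0.
- have /e[y [z [hy hz E]]] := h2 _ (i1 _ hx) nx.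
  by apply: (f12 _ y) => //; rewrite -(opprK x) E opprB subrK.
- have /e[y [z [hy hz E]]] : cone_of s x.
    by rewrite -(opprK x); apply: h2; [exact: i2|rewrite dotNr nx oppr0].
  by apply: (f21 _ z) => //; rewrite E subrK.
Qed.

End Cones.

(** * Convex cones in the plane *)

Section Plane.
Variable R : realType.
Implicit Types (T S : R -> R -> Prop).

Definition plane_cone T : Prop :=
  (forall x y x' y', T x y -> T x' y' -> T (x + x') (y + y')) /\
  (forall t x y, 0 <= t -> T x y -> T (t * x) (t * y)).

Definition plane_pointed T : Prop :=
  forall x y, T x y -> T (- x) (- y) -> x = 0 /\ y = 0.

Lemma plane_scale T t x y x' y' : plane_cone T -> 0 <= t -> T x y ->
  x' = t * x -> y' = t * y -> T x' y'.
Proof. by move=> [_ h] t0 hT -> ->; exact: h. Qed.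

Lemma plane_comb T s t x y x' y' u v : plane_cone T -> 0 <= s -> 0 <= t ->
  T x y -> T x' y' -> u = s * x + t * x' -> v = s * y + t * y' -> T u v.
Proof. by move=> [ha hs] s0 t0 h1 h2 -> ->; apply: ha; exact: hs. Qed.

(** A pointed cone that reaches a direction strictly between [a] and [c] and a
vector beyond [c] passes through [c] or turns around to [a]. *)
Lemma plane_between_half S al be s t xa ya xc yc xm ym xb yb :
  plane_cone S -> plane_pointed S -> 0 < al -> 0 < be ->
  S xm ym -> S xb yb -> ~ (xb = 0 /\ yb = 0) -> ~ S xa ya -> ~ S xc yc ->
  xm = al * xa + be * xc -> ym = al * ya + be * yc ->
  xb = s * xa + t * xc -> yb = s * ya + t * yc -> 0 <= s.
Proof.
move=> cS pS al0 be0 Sm Sb b0 Sa Sc Exm Eym Exb Eyb.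
rewrite leNgt; apply/negP => s0.
pose r := al * t - s * be.
have Sr : S (r * xc) (r * yc).
  by apply: (@plane_comb _ (- s) al _ _ _ _ _ _ cS _ _ Sm Sb);
     rewrite ?Exm ?Eym ?Exb ?Eyb /r; first [lra | ring].
have [r0|r0|r0] := ltgtP r 0.
- apply: Sa; apply: (@plane_comb _ al^-1 (be / al / (- r)) _ _ _ _ _ _ cS _ _ Sm Sr).
  + by rewrite invr_ge0 ltW.
  + by rewrite !divr_ge0 ?ltW // oppr_gt0.
  + by rewrite Exm; field; lra.
  + by rewrite Eym; field; lra.
- apply: Sc; apply: (@plane_scale _ r^-1 _ _ _ _ cS _ Sr).
  + by rewrite invr_ge0 ltW.
  + by field; lra.
  + by field; lra.
- apply: b0; apply: pS => //.
  apply: (@plane_scale _ (- s / al) _ _ _ _ cS _ Sm).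
  + by rewrite divr_ge0 ?oppr_ge0 ?ltW.
  + rewrite Exb Exm; have -> : t = s * be / al by move: r0; rewrite /r => r0; apply: (mulfI (lt0r_neq0 al0)); rewrite mulrCA divff ?lt0r_neq0 //; lra.
    by field; lra.
  + rewrite Eyb Eym; have -> : t = s * be / al by move: r0; rewrite /r => r0; apply: (mulfI (lt0r_neq0 al0)); rewrite mulrCA divff ?lt0r_neq0 //; lra.
    by field; lra.
Qed.

Lemma plane_between T S al be xa ya xc yc xm ym xb yb :
  plane_cone T -> plane_cone S -> plane_pointed S -> 0 < al -> 0 < be ->
  xa * yc - xc * ya != 0 ->
  T xa ya -> T xc yc -> ~ S xa ya -> ~ S xc yc ->
  xm = al * xa + be * xc -> ym = al * ya + be * yc ->
  S xm ym -> S xb yb -> T xb yb.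
Proof.
move=> cT cS pS al0 be0 D0 Ta Tc Sa Sc Exm Eym Sm Sb.
have [[-> ->]|b0] := pselect (xb = 0 /\ yb = 0).
  by apply: (@plane_scale _ 0 _ _ _ _ cT _ Ta); rewrite ?mul0r.
pose D := xa * yc - xc * ya.
pose s := (xb * yc - xc * yb) / D; pose t := (xa * yb - xb * ya) / D.
have Exb : xb = s * xa + t * xc by rewrite /s /t /D; field.
have Eyb : yb = s * ya + t * yc by rewrite /s /t /D; field.
apply: (@plane_comb _ s t _ _ _ _ _ _ cT _ _ Ta Tc) => //.
  exact: (plane_between_half cS pS al0 be0 Sm Sb b0 Sa Sc Exm Eym Exb Eyb).
by apply: (plane_between_half (s := t) (t := s) cS pS be0 al0 Sm Sb b0 Sc Sa);
  rewrite ?Exm ?Eym ?Exb ?Eyb addrC.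
Qed.

(** The limit case of [plane_between] in which the two outer directions are
opposite to each other, so that [m] and the line through them span a
half-plane. *)
Lemma plane_opposite T S mu xa ya xc yc xm ym xb yb :
  plane_cone T -> plane_cone S -> plane_pointed S -> 0 < mu ->
  xa * ym - xm * ya != 0 ->
  xc = - mu * xa -> yc = - mu * ya ->
  T xa ya -> T xc yc -> T xm ym -> ~ S xa ya -> ~ S xc yc ->
  S xm ym -> S xb yb -> T xb yb.
Proof.
move=> cT cS pS mu0 D0 Exc Eyc Ta Tc Tm Sa Sc Sm Sb.
pose D := xa * ym - xm * ya.
pose s := (xb * ym - xm * yb) / D; pose t := (xa * yb - xb * ya) / D.
have Exb : xb = s * xa + t * xm by rewrite /s /t /D; field.
have Eyb : yb = s * ya + t * ym by rewrite /s /t /D; field.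
have Tsa : T (s * xa) (s * ya).
  have [s0|s0] := leP 0 s; first exact: (@plane_scale _ s _ _ _ _ cT _ Ta).
  apply: (@plane_scale _ (- s / mu) _ _ _ _ cT _ Tc).
  - by rewrite divr_ge0 ?oppr_ge0 ?ltW.
  - by rewrite Exc; field; lra.
  - by rewrite Eyc; field; lra.
have [t0|t0] := leP 0 t.
  by apply: (@plane_comb _ 1 t _ _ _ _ _ _ cT _ _ Tsa Tm); rewrite ?mul1r.
have Ssa : S (s * xa) (s * ya).
  apply: (@plane_comb _ (- t) 1 _ _ _ _ _ _ cS _ _ Sm Sb); rewrite ?Exb ?Eyb.
  - by rewrite oppr_ge0 ltW.
  - by [].
  - by ring.
  - by ring.
have [s0|s0|s0] := ltgtP s 0.
- case: Sc; apply: (@plane_scale _ (mu / - s) _ _ _ _ cS _ Ssa).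
  + by rewrite divr_ge0 ?oppr_ge0 ?ltW.
  + by rewrite Exc; field; lra.
  + by rewrite Eyc; field; lra.
- case: Sa; apply: (@plane_scale _ s^-1 _ _ _ _ cS _ Ssa).
  + by rewrite invr_ge0 ltW.
  + by field; lra.
  + by field; lra.
- have [] := pS xb yb Sb.
    apply: (@plane_scale _ (- t) _ _ _ _ cS _ Sm).
    + by rewrite oppr_ge0 ltW.
    + by rewrite Exb s0; ring.
    + by rewrite Eyb s0; ring.
  move=> -> ->; apply: (@plane_scale _ 0 _ _ _ _ cT _ Ta); by rewrite ?mul0r.
Qed.

(** Parallel vectors of the same direction would lie in the same cones. *)
Lemma plane_parallel S S' xa ya xc yc : plane_cone S -> plane_cone S' ->
  S xa ya -> S' xc yc -> ~ S' xa ya -> ~ S xc yc ->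
  xa * yc - xc * ya = 0 ->
  exists2 mu, 0 < mu & xc = - mu * xa /\ yc = - mu * ya.
Proof.
move=> cS cS' Sa Sc nSa nSc D0.
have [l [Ex Ey]] : exists l, xc = l * xa /\ yc = l * ya.
  have [x0|x0] := eqVneq xa 0.
    have [y0|y0] := eqVneq ya 0.
      by case: nSa; apply: (@plane_scale _ 0 _ _ _ _ cS' _ Sc);
        rewrite ?x0 ?y0 ?mul0r.
    exists (yc / ya); split; last by field.
    apply: (mulIf y0); move: D0; rewrite x0; lra.
  exists (xc / xa); split; first by field.
  apply: (mulfI x0); rewrite mulrA (mulrC xa (xc / xa)) divfK //; lra.
have [l0|l0] := leP 0 l.
  by case: nSc; apply: (@plane_scale _ l _ _ _ _ cS _ Sa).
by exists (- l); rewrite ?oppr_gt0 // opprK.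
Qed.

(** A sector that meets [T] and is not contained in it crosses the boundary of
[T], which consists of at most two rays.  The proof looks at the cyclic
position of the three directions [(xi, yi)]: either they positively span the
plane, or one of them lies between the two others, and then so does its whole
sector, which contains neither of the two. *)
Lemma plane_three_sectors T S1 S2 S3 x1 y1 x2 y2 x3 y3 u1 v1 u2 v2 u3 v3 :
  plane_cone T -> plane_cone S1 -> plane_cone S2 -> plane_cone S3 ->
  plane_pointed S1 -> plane_pointed S2 -> plane_pointed S3 ->
  T x1 y1 -> T x2 y2 -> T x3 y3 ->
  S1 x1 y1 -> S2 x2 y2 -> S3 x3 y3 ->
  ~ S1 x2 y2 -> ~ S1 x3 y3 -> ~ S2 x1 y1 -> ~ S2 x3 y3 -> ~ S3 x1 y1 -> ~ S3 x2 y2 ->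
  S1 u1 v1 -> S2 u2 v2 -> S3 u3 v3 ->
  [\/ T u1 v1, T u2 v2 | T u3 v3].
Proof.
move=> cT c1 c2 c3 p1 p2 p3 T1 T2 T3 a1 a2 a3 n12 n13 n21 n23 n31 n32 b1 b2 b3.
pose D12 := x1 * y2 - x2 * y1; pose D23 := x2 * y3 - x3 * y2.
pose D31 := x3 * y1 - x1 * y3.
have [E12|N12] := eqVneq D12 0.
  have [mu mu0 [Ex Ey]] := plane_parallel c1 c2 a1 a2 n21 n12 E12.
  have [E31|N31] := eqVneq D31 0.
    have E13 : x1 * y3 - x3 * y1 = 0 by move: E31; rewrite /D31; lra.
    have [nu nu0 [Ex3 Ey3]] := plane_parallel c1 c3 a1 a3 n31 n13 E13.
    case: n23; apply: (@plane_scale _ (nu / mu) _ _ _ _ c2 _ a2).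
    - by rewrite divr_ge0 ?ltW.
    - by rewrite Ex Ex3; field; lra.
    - by rewrite Ey Ey3; field; lra.
  apply: Or33; apply: (plane_opposite cT c3 p3 mu0 _ Ex Ey T1 T2 T3 n31 n32 a3 b3).
  by apply: contra_neq N31; rewrite /D31; lra.
have [E23|N23] := eqVneq D23 0.
  have [mu mu0 [Ex Ey]] := plane_parallel c2 c3 a2 a3 n32 n23 E23.
  apply: Or31; apply: (plane_opposite cT c1 p1 mu0 _ Ex Ey T2 T3 T1 n12 n13 a1 b1).
  by apply: contra_neq N12; rewrite /D12; lra.
have [E31|N31] := eqVneq D31 0.
  have [mu mu0 [Ex Ey]] := plane_parallel c3 c1 a3 a1 n13 n31 E31.
  apply: Or32; apply: (plane_opposite cT c2 p2 mu0 _ Ex Ey T3 T1 T2 n23 n21 a2 b2).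
  by apply: contra_neq N23; rewrite /D23; lra.
have Rx : D23 * x1 + D31 * x2 + D12 * x3 = 0 by rewrite /D12 /D23 /D31; ring.
have Ry : D23 * y1 + D31 * y2 + D12 * y3 = 0 by rewrite /D12 /D23 /D31; ring.
have m3 : 0 < - D23 / D12 -> 0 < - D31 / D12 -> T u3 v3.
  move=> h1 h2; apply: (plane_between cT c3 p3 h1 h2 N12 T1 T2 n31 n32 _ _ a3 b3).
    by apply: (mulfI N12); rewrite mulrDr !mulrA ![D12 * _ / _]mulrAC divff // !mul1r; lra.
  by apply: (mulfI N12); rewrite mulrDr !mulrA ![D12 * _ / _]mulrAC divff // !mul1r; lra.
have m1 : 0 < - D31 / D23 -> 0 < - D12 / D23 -> T u1 v1.
  move=> h1 h2; apply: (plane_between cT c1 p1 h1 h2 N23 T2 T3 n12 n13 _ _ a1 b1).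
    by apply: (mulfI N23); rewrite mulrDr !mulrA ![D23 * _ / _]mulrAC divff // !mul1r; lra.
  by apply: (mulfI N23); rewrite mulrDr !mulrA ![D23 * _ / _]mulrAC divff // !mul1r; lra.
have m2 : 0 < - D23 / D31 -> 0 < - D12 / D31 -> T u2 v2.
  have N13 : x1 * y3 - x3 * y1 != 0 by apply: contra_neq N31; rewrite /D31; lra.
  move=> h1 h2; apply: (plane_between cT c2 p2 h1 h2 N13 T1 T3 n21 n23 _ _ a2 b2).
    by apply: (mulfI N31); rewrite mulrDr !mulrA ![D31 * _ / _]mulrAC divff // !mul1r; lra.
  by apply: (mulfI N31); rewrite mulrDr !mulrA ![D31 * _ / _]mulrAC divff // !mul1r; lra.
have sg a b : (0 < a /\ b < 0) \/ (a < 0 /\ 0 < b) -> 0 < - a / b.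
  case=> [[a0 b0]|[a0 b0]]; last by rewrite divr_gt0 // oppr_gt0.
  by rewrite mulNr -mulrN -invrN divr_gt0 // oppr_gt0.
have span : 0 < D31 / D23 -> 0 < D12 / D23 -> T u1 v1.
  move=> h1 h2.
  have Tm1 : T (- x1) (- y1).
    apply: (@plane_comb _ (D31 / D23) (D12 / D23) _ _ _ _ _ _ cT _ _ T2 T3); rewrite ?ltW //.
      by apply: (mulfI N23); rewrite mulrDr !mulrA ![D23 * _ / _]mulrAC divff // !mul1r; lra.
    by apply: (mulfI N23); rewrite mulrDr !mulrA ![D23 * _ / _]mulrAC divff // !mul1r; lra.
  have E3 : D12 / D31 = (D12 / D23) / (D31 / D23) by field; rewrite N23 N31.
  have E4 : D23 / D31 = (D31 / D23)^-1 by field; rewrite N23 N31.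
  have Tm2 : T (- x2) (- y2).
    apply: (@plane_comb _ (D23 / D31) (D12 / D31) _ _ _ _ _ _ cT _ _ T1 T3).
    - by rewrite E4 invr_ge0 ltW.
    - by rewrite E3 divr_ge0 // ltW.
    - by apply: (mulfI N31); rewrite mulrDr !mulrA ![D31 * _ / _]mulrAC divff // !mul1r; lra.
    - by apply: (mulfI N31); rewrite mulrDr !mulrA ![D31 * _ / _]mulrAC divff // !mul1r; lra.
  pose s := (u1 * y2 - x2 * v1) / D12; pose t := (x1 * v1 - u1 * y1) / D12.
  have Eu : u1 = s * x1 + t * x2 by rewrite /s /t /D12; field.
  have Ev : v1 = s * y1 + t * y2 by rewrite /s /t /D12; field.
  have h a x y : T x y -> T (- x) (- y) -> T (a * x) (a * y).
    move=> h3 h4; have [a0|a0] := leP 0 a; first exact: (plane_scale cT a0 h3).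
    apply: (@plane_scale _ (- a) _ _ _ _ cT _ h4); first by rewrite oppr_ge0 ltW.
      by rewrite mulrNN.
    by rewrite mulrNN.
  by apply: (@plane_comb _ 1 1 _ _ _ _ _ _ cT _ _ (h s _ _ T1 Tm1) (h t _ _ T2 Tm2));
    rewrite ?mul1r.
have dv a b : (0 < a /\ 0 < b) \/ (a < 0 /\ b < 0) -> 0 < a / b.
  case=> [[a0 b0]|[a0 b0]]; first by rewrite divr_gt0.
  by rewrite -mulrNN -invrN divr_gt0 // oppr_gt0.
case: (ltgtP D12 0) N12 => // h12 _; case: (ltgtP D23 0) N23 => // h23 _;
  case: (ltgtP D31 0) N31 => // h31 _.
- apply: Or31; apply: span; apply: dv; by right.
- apply: Or32; apply: m2; apply: sg; by right.
- apply: Or31; apply: m1; apply: sg; by right.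
- apply: Or33; apply: m3; apply: sg; by left.
- apply: Or33; apply: m3; apply: sg; by right.
- apply: Or31; apply: m1; apply: sg; by left.
- apply: Or32; apply: m2; apply: sg; by left.
- apply: Or31; apply: span; apply: dv; by left.
Qed.

(** One of three boundary rays of a convex cone in the plane would lie between
the two others, and then its supporting functional would vanish on them. *)
Lemma plane_boundary (n1 m1 n2 m2 n3 m3 x1 y1 x2 y2 x3 y3 : R) :
  n1 * x1 + m1 * y1 = 0 -> n2 * x2 + m2 * y2 = 0 -> n3 * x3 + m3 * y3 = 0 ->
  0 < n1 * x2 + m1 * y2 -> 0 < n1 * x3 + m1 * y3 ->
  0 < n2 * x1 + m2 * y1 -> 0 < n2 * x3 + m2 * y3 ->
  0 < n3 * x1 + m3 * y1 -> 0 < n3 * x2 + m3 * y2 -> False.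
Proof.
move=> E1 E2 E3 h12 h13 h21 h23 h31 h32.
pose D12 := x1 * y2 - x2 * y1; pose D23 := x2 * y3 - x3 * y2.
pose D31 := x3 * y1 - x1 * y3.
have R1 : D31 * (n1 * x2 + m1 * y2) + D12 * (n1 * x3 + m1 * y3) = 0.
  by transitivity (- D23 * (n1 * x1 + m1 * y1)); [rewrite /D12 /D23 /D31; ring|rewrite E1 mulr0].
have R2 : D23 * (n2 * x1 + m2 * y1) + D12 * (n2 * x3 + m2 * y3) = 0.
  by transitivity (- D31 * (n2 * x2 + m2 * y2)); [rewrite /D12 /D23 /D31; ring|rewrite E2 mulr0].
have R3 : D23 * (n3 * x1 + m3 * y1) + D31 * (n3 * x2 + m3 * y2) = 0.
  by transitivity (- D12 * (n3 * x3 + m3 * y3)); [rewrite /D12 /D23 /D31; ring|rewrite E3 mulr0].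
have sgn (a b s t : R) : 0 < s -> 0 < t -> a * s + b * t = 0 -> 0 < a -> b < 0.
  move=> s0 t0 E a0; rewrite ltNge; apply/negP => b0.
  by have := mulr_gt0 a0 s0; have := mulr_ge0 b0 (ltW t0); lra.
have sgn' (a b s t : R) : 0 < s -> 0 < t -> a * s + b * t = 0 -> a < 0 -> 0 < b.
  move=> s0 t0 E a0; have := sgn (- a) (- b) s t s0 t0.
  by rewrite !mulNr -opprD E oppr0 oppr_gt0 oppr_lt0; apply.
have [D0|D0|D0] := ltgtP D12 0.
- have p31 : 0 < D31 by apply: (sgn' D12 D31 _ _ h13 h12 _ D0); lra.
  have p23 : 0 < D23 by apply: (sgn' D12 D23 _ _ h23 h21 _ D0); lra.
  by have := sgn _ _ _ _ h31 h32 R3 p23; lra.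
- have p31 : D31 < 0 by apply: (sgn D12 D31 _ _ h13 h12 _ D0); lra.
  have p23 : D23 < 0 by apply: (sgn D12 D23 _ _ h23 h21 _ D0); lra.
  by have := sgn' _ _ _ _ h31 h32 R3 p23; lra.
- have Z : n1 * (x1 * y2 - x2 * y1) = - y1 * (n1 * x2 + m1 * y2).
    by transitivity (y2 * (n1 * x1 + m1 * y1) - y1 * (n1 * x2 + m1 * y2)); [ring|rewrite E1; ring].
  have Z' : m1 * (x1 * y2 - x2 * y1) = x1 * (n1 * x2 + m1 * y2).
    by transitivity (- x2 * (n1 * x1 + m1 * y1) + x1 * (n1 * x2 + m1 * y2)); [ring|rewrite E1; ring].
  move: Z Z'; rewrite -/D12 D0 !mulr0 => Z Z'.
  have y0 : y1 = 0.
    by apply/eqP; have /eqP := esym Z; rewrite mulf_eq0 oppr_eq0 (gt_eqF h12) orbF.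
  have x0 : x1 = 0.
    by apply/eqP; have /eqP := esym Z'; rewrite mulf_eq0 (gt_eqF h12) orbF.
  by move: h21; rewrite x0 y0 !mulr0 addr0 ltxx.
Qed.

End Plane.

(** * Families of cones with apex 0 *)

Section Abstract.
Variables (R : realType) (d : nat).
Local Notation V := 'rV[R]_d.
Implicit Types (u v w x y z n m p q e : V) (C K E f : set V)
  (X : set (set V)).

(** For [q] spanning a linear space of codimension 2, [(e1, e2)] is an
orthonormal basis of its orthogonal complement. *)
Record frame q e1 e2 : Prop := Frame {
  frame11 : dot e1 e1 = 1;
  frame22 : dot e2 e2 = 1;
  frame12 : dot e1 e2 = 0;
  frame1q : dot e1 q = 0;
  frame2q : dot e2 q = 0;
  frame_span : forall m, dot m q = 0 -> m = dot m e1 *: e1 + dot m e2 *: e2 }.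

Record convex_cone C : Prop := ConvexCone {
  cone0 : C 0;
  coneD : forall x y, C x -> C y -> C (x + y);
  coneZ : forall t x, 0 <= t -> C x -> C (t *: x) }.

(** The relative interior of a convex cone, in algebraic terms. *)
Definition core f p : Prop :=
  f p /\ forall x, f x -> exists2 c : R, 0 < c & f (p - c *: x).

(** For a convex cone [C] containing [p], these are the directions in which one
can move from [p] inside [C], since one can also scale by [t^-1]. *)
Definition tangent p C y : Prop := exists2 t : R, 0 <= t & C (y + t *: p).

Definition separator C K n : Prop :=
  [/\ forall x, C x -> 0 <= dot n x,
      forall x, K x -> dot n x <= 0,
      forall x, C x -> dot n x = 0 -> K x
    & forall x, K x -> dot n x = 0 -> C x].

(** The cells of a tight fan, seen from its vertex.  Local symmetry and
standardness are expressed by tangent cones, which avoids balls; a separator of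
two cells vanishes on their intersection only. *)
Record tight_cells X : Prop := TightCells {
  tc_finite : finite_set X;
  tc_cone : forall C, X C -> convex_cone C;
  tc_apex : forall C, X C -> exists u, forall x, C x ->
    0 <= dot u x /\ (dot u x = 0 -> x = 0);
  tc_full : forall C, X C -> exists2 o, C o &
    forall n, (forall x, C x -> 0 <= dot n x) -> dot n o = 0 -> n = 0;
  tc_cover : forall x, exists2 C, X C & C x;
  tc_sep : forall C K, X C -> X K -> C <> K -> exists n, separator C K n;
  tc_symmetric : forall C K, X C -> X K -> C <> K ->
    exists2 p, core (C `&` K) p
      & forall y, tangent p C y -> tangent p K (- y);
  tc_standard : forall C K, X C -> X K -> C <> K ->
    exists2 p, core (C `&` K) p
      & forall E, X E -> E p -> exists E',
        [/\ X E', E' p & forall y, tangent p E y <-> tangent p E' (- y)] }.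

(** Gradients of a piecewise linear convex function, linear exactly on the
cones of [X]; a relation, so that it can be given by a list of pairs. *)
Definition is_potential X (g : set V -> V -> Prop) : Prop :=
  [/\ forall C, X C -> exists a, g C a,
      forall C K a b, g C a -> g K b -> forall x, C x -> dot b x <= dot a x
    & forall C K a b, X C -> X K -> g C a -> g K b -> C <> K -> a <> b].

Definition has_potential X : Prop := exists g, is_potential X g.

Lemma tc_pointed X : tight_cells X ->
  forall C x, X C -> C x -> C (- x) -> x = 0.
Proof.
move=> HX C x XC Cx Cnx; have [u hu] := tc_apex HX XC.
have [h1 h2] := hu _ Cx; have [h3 _] := hu _ Cnx.
by apply: h2; rewrite dotNr in h3; lra.
Qed.

(** ** Vectors modulo the line of a vector *)

Lemma frame_mod q e1 e2 x : frame q e1 e2 -> dot e1 x = 0 -> dot e2 x = 0 ->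
  exists c, x = c *: q.
Proof.
move=> [_ _ _ h1 h2 hs]; rewrite dotC => x1; rewrite dotC => x2.
rewrite dotC in h1; rewrite dotC in h2.
have [q0|q0] := eqVneq q 0.
  exists 0; rewrite scale0r (hs x) ?q0 ?dot0r //.
  by rewrite x1 x2 !scale0r addr0.
have qq := lt0r_neq0 (dot_gt0 q0).
exists (dot x q / dot q q); apply/eqP; rewrite -subr_eq0; apply/eqP.
rewrite (hs (x - _)); last by dotE; field.
by dotE; rewrite x1 h1 x2 h2 !mulr0 oppr0 addr0 !scale0r addr0.
Qed.

Lemma frame_dot q e1 e2 n x : frame q e1 e2 -> dot n q = 0 ->
  dot n x = dot n e1 * dot e1 x + dot n e2 * dot e2 x.
Proof. by move=> fr nq; rewrite {1}(frame_span fr nq); dotE. Qed.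

Lemma frame_modP q e1 e2 x : frame q e1 e2 ->
  (exists c, x = c *: q) <-> (dot e1 x = 0 /\ dot e2 x = 0).
Proof.
move=> fr; split=> [[c ->]|[]]; last exact: frame_mod fr.
by dotE; rewrite (frame1q fr) (frame2q fr) !mulr0.
Qed.

Lemma frame_nmod q e1 e2 x : frame q e1 e2 -> ~ (exists c, x = c *: q) ->
  0 < dot e1 x ^+ 2 + dot e2 x ^+ 2.
Proof.
move=> fr nx; rewrite lt_neqAle addr_ge0 ?sqr_ge0 // andbT.
apply/eqP => /esym/eqP; rewrite paddr_eq0 ?sqr_ge0 // !sqrf_eq0.
by move=> /andP[/eqP h1 /eqP h2]; apply: nx; exact: frame_mod fr h1 h2.
Qed.

Lemma frame_line q e1 e2 x n : frame q e1 e2 -> ~ (exists c, x = c *: q) ->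
  dot n q = 0 -> dot n x = 0 ->
  exists c, n = c *: (dot e1 x *: e2 - dot e2 x *: e1).
Proof.
move=> fr nx nq h.
have x0 := frame_nmod fr nx.
rewrite (frame_dot _ fr nq) in h.
have s0 := lt0r_neq0 x0.
rewrite {1}(frame_span fr nq).
move: s0 h; move: (dot e1 x) (dot e2 x) (dot n e1) (dot n e2) => a b k l s0 h.
exists ((l * a - k * b) / (a ^+ 2 + b ^+ 2)).
rewrite scalerBr !scalerA addrC -scaleNr.
congr (_ *: _ + _ *: _).
  have E : l * (a ^+ 2 + b ^+ 2) = (l * a - k * b) * a + b * (k * a + l * b) by ring.
  by rewrite mulrAC; apply: (mulIf s0); rewrite divfK // E h mulr0 addr0.
have E : k * (a ^+ 2 + b ^+ 2) = - (l * a - k * b) * b + a * (k * a + l * b) by ring.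
by apply: (mulIf s0); rewrite E h mulr0 addr0 !mulNr mulrAC divfK.
Qed.

(** ** Finiteness arguments *)

Lemma finite_eventually X (P : set V -> R -> Prop) : finite_set X ->
  (forall K, X K -> exists t0, forall t, t0 <= t -> P K t) ->
  exists2 t0, 0 < t0 & forall t K, t0 <= t -> X K -> P K t.
Proof.
move=> /finite_seqP[s ->] h.
have {}h K : K \in s -> exists t0, forall t, t0 <= t -> P K t by exact: h.
elim: s h => [|K s ih] h; first by exists 1.
have [|t1 t10 h1] := ih; first by move=> K' hK'; apply: h; rewrite inE hK' orbT.
have [|t2 h2] := h K; first exact: mem_head.
exists (Num.max t1 t2); first by rewrite lt_max t10.
move=> t K' /=; rewrite ge_max => /andP[l1 l2]; rewrite inE => /predU1P[->|hs].
  exact: h2.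
exact: h1.
Qed.

Lemma finite_argmin X (Q : set V -> Prop) (F : set V -> R) : finite_set X ->
  (exists2 K, X K & Q K) ->
  exists K0, [/\ X K0, Q K0 & forall K, X K -> Q K -> F K0 <= F K].
Proof.
move=> /finite_seqP[s ->] [K1 hK1 Q1].
have {}hK1 : K1 \in s := hK1.
suff [K0 [h1 h2 h3]] : exists K0, [/\ K0 \in s, Q K0 & forall K, K \in s -> Q K -> F K0 <= F K].
  by exists K0; split.
elim: s K1 hK1 Q1 => // K s ih K1 hK1 Q1.
have [[K2 h2 Q2]|no] := pselect (exists2 K, K \in s & Q K).
  have [K0 [h3 h4 h5]] := ih K2 h2 Q2.
  have [QK|nQK] := pselect (Q K); last first.
    exists K0; split=> //; first by rewrite inE h3 orbT.
    by move=> K'; rewrite inE => /predU1P[->//|]; exact: h5.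
  have [le|gt] := leP (F K0) (F K).
    exists K0; split=> //; first by rewrite inE h3 orbT.
    by move=> K'; rewrite inE => /predU1P[->//|]; exact: h5.
  exists K; split=> //; first exact: mem_head.
  move=> K'; rewrite inE => /predU1P[->//|a b].
  exact: le_trans (ltW gt) (h5 _ a b).
have sub K' : K' \in K :: s -> Q K' -> K' = K.
  by rewrite inE => /predU1P[->//|a b]; case: no; exists K'.
exists K1; split=> // K' a b.
by rewrite (sub _ a b) (sub _ hK1 Q1).
Qed.

(** ** Cells and their faces *)

Section Cells.
Variable X : set (set V).
Hypothesis HX : tight_cells X.

Lemma separatorC C K n : separator C K n -> separator K C (- n).
Proof.
case=> h1 h2 h3 h4; split=> x.
- by move=> /h2; rewrite dotNl oppr_ge0.
- by move=> /h1; rewrite dotNl oppr_le0.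
- by move=> hx; rewrite dotNl => /eqP; rewrite oppr_eq0 => /eqP; exact: h4.
- by move=> hx; rewrite dotNl => /eqP; rewrite oppr_eq0 => /eqP; exact: h3.
Qed.

Lemma separator0 C K n x : separator C K n -> C x -> K x -> dot n x = 0.
Proof.
by case=> h1 h2 _ _ /h1 a /h2 b; apply/eqP; rewrite eq_le b a.
Qed.

Lemma face C K x y : X C -> X K -> C x -> C y -> K (x + y) -> K x.
Proof.
move=> XC XK Cx Cy Kxy.
have [->//|/eqP CK] := eqVneq K C.
have [n sn] := tc_sep HX XC XK (nesym CK).
have := separator0 sn (coneD (tc_cone HX XC) Cx Cy) Kxy.
case: sn => h1 _ h3 _; dotE => E; apply: h3 => //.
by have := h1 _ Cx; have := h1 _ Cy; lra.
Qed.

Lemma faceZ C x t : X C -> 0 < t -> C (t *: x) -> C x.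
Proof.
move=> XC t0 h; have := coneZ (tc_cone HX XC) (t := t^-1) _ h.
by rewrite scalerA mulVf ?gt_eqF // scale1r; apply; rewrite invr_ge0 ltW.
Qed.

Lemma coneDZ C x y t : X C -> 0 <= t -> C x -> C y -> C (x + t *: y).
Proof.
by move=> XC t0 Cx Cy; have cC := tc_cone HX XC; apply: (coneD cC Cx); exact: (coneZ cC).
Qed.

Lemma separator_neq0 C K n : X C -> X K -> C <> K -> separator C K n -> n <> 0.
Proof.
move=> XC XK CK [h1 h2 h3 h4] n0; apply: CK; rewrite eqEsubset; split=> x hx.
  by apply: h3; rewrite // n0 dot0l.
by apply: h4; rewrite // n0 dot0l.
Qed.

Lemma cell_inner C : X C -> exists o, [/\ C o,
  forall n, (forall x, C x -> 0 <= dot n x) -> n <> 0 -> 0 < dot n o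
  & forall K, X K -> K o -> K = C].
Proof.
move=> XC; have [ o Co ho] := tc_full HX XC.
have hpos n : (forall x, C x -> 0 <= dot n x) -> n <> 0 -> 0 < dot n o.
  move=> h n0; rewrite lt_neqAle h // andbT; apply/eqP => /esym E.
  by apply: n0; exact: ho.
exists o; split=> // K XK Ko; apply: contrapT => KC.
have [n sn] := tc_sep HX XC XK (nesym KC).
have n0 := separator_neq0 XC XK (nesym KC) sn.
have := separator0 sn Co Ko; case: sn => h1 _ _ _.
by have := hpos n h1 n0; lra.
Qed.

Lemma cell_sub C K : X C -> X K -> (forall x, C x -> K x) -> C = K.
Proof.
move=> XC XK h; have [ o [Co _ ho]] := cell_inner XC.
by rewrite (ho K XK) //; exact: h.
Qed.

Lemma cell_not_in_line C m : X C -> m <> 0 -> ~ (forall x, C x -> dot m x = 0).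
Proof.
move=> XC m0 h; have [ o [Co ho _]] := cell_inner XC.
suff: 0 < dot m o by rewrite h // ltxx.
by apply: ho => // x /h ->.
Qed.

Lemma frame_neq0 q e1 e2 : frame q e1 e2 -> e1 <> 0.
Proof.
by move=> fr E; have := frame11 fr; rewrite E dot0l => /esym/eqP; rewrite oner_eq0.
Qed.

Lemma cell_not_in_ray C q e1 e2 : frame q e1 e2 -> X C ->
  ~ (forall x, C x -> exists c, x = c *: q).
Proof.
move=> fr XC h; apply: (cell_not_in_line XC (frame_neq0 fr)) => x /h [c ->].
by dotE; rewrite (frame1q fr) mulr0.
Qed.

(** A hyperplane has only two sides, and the separators of the three cells all
have the same kernel. *)
Lemma no_triple q e1 e2 C1 C2 C3 x : frame q e1 e2 -> X C1 -> X C2 -> X C3 ->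
  C1 <> C2 -> C1 <> C3 -> C2 <> C3 ->
  C1 q -> C2 q -> C3 q -> C1 x -> C2 x -> C3 x -> exists c, x = c *: q.
Proof.
move=> fr X1 X2 X3 n12 n13 n23 q1 q2 q3 x1 x2 x3; apply: contrapT => nx.
have [m12 s12] := tc_sep HX X1 X2 n12.
have [m13 s13] := tc_sep HX X1 X3 n13.
have [m23 s23] := tc_sep HX X2 X3 n23.
have [c12 e12] := frame_line fr nx (separator0 s12 q1 q2) (separator0 s12 x1 x2).
have [c13 e13] := frame_line fr nx (separator0 s13 q1 q3) (separator0 s13 x1 x3).
have [c23 e23] := frame_line fr nx (separator0 s23 q2 q3) (separator0 s23 x2 x3).
have [ o1 [ o1C p1 _]] := cell_inner X1.
have [ o2 [ o2C p2 _]] := cell_inner X2.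
have [ o3 [ o3C p3 _]] := cell_inner X3.
move: e12 e13 e23; move: (_ - _) => w e12 e13 e23.
have sp C K m c oC oK : X C -> X K -> C <> K -> separator C K m -> m = c *: w ->
   (forall n, (forall x, C x -> 0 <= dot n x) -> n <> 0 -> 0 < dot n oC) ->
   (forall n, (forall x, K x -> 0 <= dot n x) -> n <> 0 -> 0 < dot n oK) ->
   dot w oC * dot w oK < 0.
  move=> XC XK CK s E hC hK.
  have h1 := hC m (let: And4 a _ _ _ := s in a) (separator_neq0 XC XK CK s).
  have s' := separatorC s.
  have h2 := hK (- m) (let: And4 a _ _ _ := s' in a) (separator_neq0 XK XC (nesym CK) s').
  move: h1 h2; rewrite E; dotE; move: (dot w oC) (dot w oK) => a b h1 h2.
  have : 0 < (c * a) * - (c * b) by exact: mulr_gt0.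
  have -> : (c * a) * - (c * b) = - (a * b) * c ^+ 2 by ring.
  have c2 : 0 < c ^+ 2.
    by rewrite exprn_even_gt0 //=; apply/eqP => c0; move: h1; rewrite c0 mul0r ltxx.
  by rewrite (pmulr_lgt0 _ c2) oppr_gt0.
have t12 := sp _ _ _ _ _ _ X1 X2 n12 s12 e12 p1 p2.
have t13 := sp _ _ _ _ _ _ X1 X3 n13 s13 e13 p1 p3.
have t23 := sp _ _ _ _ _ _ X2 X3 n23 s23 e23 p2 p3.
move: (dot w o1) (dot w o2) (dot w o3) t12 t13 t23 => a b c t12 t13 t23.
have : 0 < (a * b) * (a * c) by rewrite nmulr_rgt0.
have -> : (a * b) * (a * c) = a ^+ 2 * (b * c) by ring.
have h2 : 0 <= - (b * c) by rewrite oppr_ge0 ltW.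
by have := mulr_ge0 (sqr_ge0 a) h2; lra.
Qed.

(** ** Lines in the direction of a common vector *)

(** A cell that does not contain [q] has a separator negative at [q], which
excludes points far in the direction [q]. *)
Lemma far_cells q y : exists2 t, 0 < t & forall K, X K -> K (y + t *: q) -> K q.
Proof.
have [|t0 t00 h] := @finite_eventually X (fun K t => K (y + t *: q) -> K q) (tc_finite HX).
  move=> K XK; have [Kq|nKq] := pselect (K q); first by exists 0.
  have [K' XK' K'q] := tc_cover HX q.
  have KK' : K <> K' by move=> E; apply: nKq; rewrite E.
  have [n sn] := tc_sep HX XK XK' KK'; case: (sn) => h1 h2 h3 h4.
  have nq : dot n q < 0.
    rewrite lt_neqAle h2 // andbT; apply/eqP => /(h4 _ K'q); exact: nKq.
  exists ((dot n y + 1) / - dot n q) => t ht /h1; dotE => h.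
  have : dot n y + 1 <= t * - dot n q by rewrite -ler_pdivrMr // oppr_gt0.
  by lra.
by exists t0 => // K XK; exact: h.
Qed.

(** Going down from [x] in the direction [-q], the cell [C] is left through a
hyperplane that separates it from a cell that does not contain [q]. *)
Lemma descent C q x : X C -> C q -> q <> 0 -> C x ->
  exists t K, [/\ 0 <= t, X K, ~ K q, C (x - t *: q) & K (x - t *: q)].
Proof.
move=> XC Cq q0 Cx.
have /choice[n hn] K : exists n, X K -> C <> K -> separator C K n.
  have [XK|nXK] := pselect (X K); last by exists 0.
  have [->|/eqP CK] := eqVneq K C; first by exists 0.
  by have [n sn] := tc_sep HX XC XK (nesym CK); exists n.
have nq K : X K -> ~ K q -> 0 < dot (n K) q.
  move=> XK nKq; have CK : C <> K by move=> E; apply: nKq; rewrite -E.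
  have [h1 _ h3 _] := hn K XK CK.
  rewrite lt_neqAle h1 // andbT; apply/eqP => /esym/(h3 _ Cq); exact: nKq.
have [|K0 [XK0 K0q hmin]] := @finite_argmin X (fun K => ~ K q)
    (fun K => dot (n K) x / dot (n K) q) (tc_finite HX).
  have [K XK Kq] := tc_cover HX (- q); exists K => // Kq'.
  by apply: q0; exact: (tc_pointed HX XK Kq' Kq).
have CK0 : C <> K0 by move=> E; apply: K0q; rewrite -E.
have [h1 h2 h3 h4] := hn _ XK0 CK0.
set t := dot (n K0) x / dot (n K0) q in hmin.
have t0 : 0 <= t by rewrite divr_ge0 // ?h1 // ltW // nq.
have nz : dot (n K0) (x - t *: q) = 0.
  by dotE; rewrite /t divfK ?subrr // gt_eqF // nq.
have Cy : C (x - t *: q).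
  have [K XK Ky] := tc_cover HX (x - t *: q).
  have [<-//|/eqP KC] := eqVneq K C.
  have [g1 g2 g3 g4] := hn _ XK (nesym KC).
  apply: g4 => //; apply/eqP; rewrite eq_le g2 //=; dotE.
  have [Kq|nKq] := pselect (K q).
    rewrite (separator0 (hn _ XK (nesym KC)) Cq Kq) mulr0 subr0; exact: g1.
  by rewrite subr_ge0 -ler_pdivlMr ?nq //; exact: hmin.
by exists t, K0; split=> //; exact: h3.
Qed.

(** ** Tangent cones *)

Lemma tangent_scale C s q y : 0 < s -> tangent (s *: q) C y <-> tangent q C y.
Proof.
move=> s0; split=> -[t t0 h].
  by exists (t * s); [rewrite mulr_ge0 // ltW|rewrite -scalerA].
by exists (t / s); [rewrite divr_ge0 // ltW|rewrite scalerA divfK // gt_eqF].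
Qed.

Lemma tangent_mem C q y : C y -> tangent q C y.
Proof. by exists 0; rewrite // scale0r addr0. Qed.

Lemma tangent_ge0 C q m y : dot m q = 0 -> (forall x, C x -> 0 <= dot m x) ->
  tangent q C y -> 0 <= dot m y.
Proof.
by move=> mq h [t t0 /h]; dotE; rewrite mq mulr0 addr0.
Qed.

Lemma tangent_mem_face C K q y : X C -> X K -> C q -> C y -> tangent q K y -> K y.
Proof.
move=> XC XK Cq Cy [t t0 h]; apply: (face XC XK Cy _ h).
exact: (coneZ (tc_cone HX XC)).
Qed.

Lemma tangent_inj C K q : X C -> X K -> C q ->
  (forall y, tangent q C y -> tangent q K y) -> C = K.
Proof.
move=> XC XK Cq h; apply: cell_sub => // x Cx.
by apply: (tangent_mem_face XC XK Cq Cx); apply: h; exact: tangent_mem.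
Qed.

Lemma core_ray C K q p : X C -> X K -> C q -> K q ->
  (forall x, C x -> K x -> exists c, x = c *: q) ->
  core (C `&` K) p -> exists2 s, 0 < s & p = s *: q.
Proof.
move=> XC XK Cq Kq h [[Cp Kp] hc].
have [c ec] := h _ Cp Kp.
have [q0|/eqP q0] := eqVneq q 0.
  by exists 1 => //; rewrite ec q0 !scaler0.
exists c => //; rewrite ltNge; apply/negP => c0.
have [e e0 [Ce _]] := hc q (conj Cq Kq).
apply: q0; apply: (tc_pointed HX XC Cq).
apply: (@faceZ _ _ (e - c) XC); first lra.
by move: Ce; rewrite ec -scalerBl scalerN -scaleNr opprB.
Qed.

(** Local symmetry holds at some relative interior point of the common ray, but
the tangent cones at all of them are the same. *)
Lemma opposite_ray C K q : X C -> X K -> C <> K -> C q -> K q ->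
  (forall x, C x -> K x -> exists c, x = c *: q) ->
  forall y, tangent q C y <-> tangent q K (- y).
Proof.
move=> XC XK CK Cq Kq h.
have half C' K' : X C' -> X K' -> C' <> K' -> C' q -> K' q ->
  (forall x, C' x -> K' x -> exists c, x = c *: q) ->
  forall y, tangent q C' y -> tangent q K' (- y).
  move=> XC' XK' CK' Cq' Kq' h' y.
  have [p cp hp] := tc_symmetric HX XC' XK' CK'.
  have [s s0 E] := core_ray XC' XK' Cq' Kq' h' cp.
  by move/(tangent_scale C' q y s0); rewrite -E => /hp; rewrite E => /(tangent_scale K' q _ s0).
move=> y; split; first exact: half.
by rewrite -{2}(opprK y); apply: half => //; [exact: nesym|move=> x a b; exact: h].
Qed.

Lemma standard_ray C K q : X C -> X K -> C <> K -> C q -> K q ->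
  (forall x, C x -> K x -> exists c, x = c *: q) ->
  forall E, X E -> E q -> exists E',
    [/\ X E', E' q & forall y, tangent q E y <-> tangent q E' (- y)].
Proof.
move=> XC XK CK Cq Kq h E XE Eq.
have [p cp hp] := tc_standard HX XC XK CK.
have [s s0 ep] := core_ray XC XK Cq Kq h cp.
have [|E' [XE' E'p hE]] := hp E XE.
  by rewrite ep; exact: (coneZ (tc_cone HX XE) (ltW s0) Eq).
exists E'; split=> //; first by move: E'p; rewrite ep; exact: faceZ.
move=> y; split.
  by move/(tangent_scale E q y s0); rewrite -ep => /hE; rewrite ep => /(tangent_scale E' q _ s0).
by move/(tangent_scale E' q (- y) s0); rewrite -ep => /hE; rewrite ep => /(tangent_scale E q _ s0).
Qed.

End Cells.
End Abstract.

Section Stars.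
Variables (R : realType) (d : nat).
Local Notation V := 'rV[R]_d.
Implicit Types (u v w x y z n m p q e : V) (C K E f : set V).
Variable X : set (set V).
Hypothesis HX : tight_cells X.

(** * The star of a face of codimension 2 *)

Definition exposes C q u : Prop :=
  [/\ dot u q = 0, forall x, C x -> 0 <= dot u x
    & forall x, C x -> dot u x = 0 -> exists c, x = c *: q].

(** Four cells around [q], one in each quadrant of the plane with coordinates
[dot A] and [dot B]; [quad14] and the like say that cells in neighbouring
quadrants meet along a whole wall. *)
Record quad q A B C1 C2 C3 C4 : Prop := Quad {
  quadn12 : C1 <> C2; quadn23 : C2 <> C3; quadn34 : C3 <> C4; quadn14 : C1 <> C4;
  quadX1 : X C1; quadX2 : X C2; quadX3 : X C3; quadX4 : X C4;
  quadq1 : C1 q; quadq2 : C2 q; quadq3 : C3 q; quadq4 : C4 q;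
  quadA : dot A q = 0; quadB : dot B q = 0;
  quads1 : forall x, C1 x -> 0 <= dot A x /\ 0 <= dot B x;
  quads2 : forall x, C2 x -> dot A x <= 0 /\ 0 <= dot B x;
  quads3 : forall x, C3 x -> dot A x <= 0 /\ dot B x <= 0;
  quads4 : forall x, C4 x -> 0 <= dot A x /\ dot B x <= 0;
  quad12 : forall x, dot A x = 0 -> (C1 x <-> C2 x);
  quad34 : forall x, dot A x = 0 -> (C3 x <-> C4 x);
  quad23 : forall x, dot B x = 0 -> (C2 x <-> C3 x);
  quad14 : forall x, dot B x = 0 -> (C1 x <-> C4 x);
  quad_span : forall m, dot m q = 0 -> exists a b, m = a *: A + b *: B;
  quad_mod : forall x, dot A x = 0 -> dot B x = 0 -> exists c, x = c *: q;
  quad_all : forall K, X K -> K q -> [\/ K = C1, K = C2, K = C3 | K = C4] }.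

Lemma quad_rot q A B C1 C2 C3 C4 :
  quad q A B C1 C2 C3 C4 -> quad q B (- A) C2 C3 C4 C1.
Proof.
case=> n12 n23 n34 n14 X1 X2 X3 X4 q1 q2 q3 q4 Aq Bq s1 s2 s3 s4 h12 h34 h23 h14 hs hm ha.
split=> //.
- exact: nesym.
- exact: nesym.
- by rewrite dotNl Aq oppr0.
- by move=> x /s2 []; rewrite dotNl oppr_ge0.
- by move=> x /s3 []; rewrite dotNl oppr_ge0.
- by move=> x /s4 []; rewrite dotNl oppr_le0.
- by move=> x /s1 []; rewrite dotNl oppr_le0.
- by move=> x h; split=> /(h14 _ h).
- by move=> x; rewrite dotNl => /eqP; rewrite oppr_eq0 => /eqP; exact: h34.
- by move=> x; rewrite dotNl => /eqP; rewrite oppr_eq0 => /eqP h; split=> /(h12 _ h).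
- by move=> m /hs [a [b ->]]; exists b, (- a); rewrite scaleNr scalerN opprK addrC.
- by move=> x hB; rewrite dotNl => /eqP; rewrite oppr_eq0 => /eqP hA; exact: hm.
- by move=> K XK /(ha _ XK) [] ->; [apply: Or44|apply: Or41|apply: Or42|apply: Or43].
Qed.

Lemma tangent_wall C E q m y : dot m q = 0 ->
  (forall x, dot m x = 0 -> C x -> E x) -> dot m y = 0 ->
  tangent q C y -> tangent q E y.
Proof.
by move=> mq h my [t t0 Ct]; exists t => //; apply: h => //; dotE; rewrite my mq mulr0 addr0.
Qed.

Lemma tangent_comb C q u v a b c : X C -> C q -> tangent q C u -> tangent q C v ->
  0 <= a -> 0 <= b -> tangent q C (a *: u + b *: v + c *: q).
Proof.
move=> XC Cq [s s0 hu] [t t0 hv] a0 b0; have cC := tc_cone HX XC.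
exists (a * s + b * t + `|c| + `|c|); first by rewrite !addr_ge0 // mulr_ge0.
have -> : a *: u + b *: v + c *: q + (a * s + b * t + `|c| + `|c|) *: q
    = a *: (u + s *: q) + b *: (v + t *: q) + (c + `|c| + `|c|) *: q.
  by rewrite !scalerDr !scalerA !scalerDl; apply/rowP => i; rewrite !mxE; ring.
apply: (coneD cC); first by apply: (coneD cC); exact: (coneZ cC).
apply: (coneZ cC) => //.
by have := normr_ge0 c; have := ler_norm (- c); rewrite normrN; lra.
Qed.

(** By local symmetry, [C] and [K] are opposite in the plane transverse to [q].
A further cell [E] cannot be opposite to one of them without having the same
tangent cone as the other, so it shares a wall with each; the two separators
are [A] and [B].  The fourth cell is the reflection of [E], which is a cell as
the common ray is a standard face. *)
Lemma quad_exists q e1 e2 C E K : frame q e1 e2 -> X C -> X E -> X K ->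
  C <> K -> E <> C -> E <> K -> C q -> E q -> K q ->
  (forall x, C x -> K x -> exists c, x = c *: q) ->
  exists A B E', quad q A B C E K E'.
Proof.
move=> fr XC XE XK CK EC EK Cq Eq Kq hray.
have opp := opposite_ray HX XC XK CK Cq Kq hray.
have oppN y : tangent q K y <-> tangent q C (- y).
  by have := opp (- y); rewrite opprK => h; split=> /h.
have [x1 [Ex1 Cx1 nx1]] : exists x, [/\ E x, C x & ~ exists c, x = c *: q].
  apply: contrapT => no; apply: EK; apply: (tangent_inj HX XE XK Eq) => y.
  move/(opposite_ray HX XE XC EC Eq Cq _ y) => h; apply/oppN; apply: h => x Ex Cx.
  by apply: contrapT => nx; apply: no; exists x.
have [x2 [Ex2 Kx2 nx2]] : exists x, [/\ E x, K x & ~ exists c, x = c *: q].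
  apply: contrapT => no; apply: EC; apply: (tangent_inj HX XE XC Eq) => y.
  move/(opposite_ray HX XE XK EK Eq Kq _ y) => h; apply/opp; apply: h => x Ex Cx.
  by apply: contrapT => nx; apply: no; exists x.
have [A sA] := tc_sep HX XC XE (nesym EC).
have [B sB] := tc_sep HX XE XK EK.
have [E' [XE' E'q hE]] := standard_ray HX XC XK CK Cq Kq hray XE Eq.
have hEN y : tangent q E' y <-> tangent q E (- y).
  by have := hE (- y); rewrite opprK => h; split=> /h.
have Aq := separator0 sA Cq Eq.
have Bq := separator0 sB Eq Kq.
have Ax1 := separator0 sA Cx1 Ex1.
have Bx2 := separator0 sB Ex2 Kx2.
case: (sA) => A1 A2 A3 A4; case: (sB) => B1 B2 B3 B4.
have NA x : E x -> 0 <= dot (- A) x by move=> /A2; rewrite dotNl oppr_ge0.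
have NB x : K x -> 0 <= dot (- B) x by move=> /B2; rewrite dotNl oppr_ge0.
have NAq : dot (- A) q = 0 by rewrite dotNl Aq oppr0.
have NBq : dot (- B) q = 0 by rewrite dotNl Bq oppr0.
have AK x : K x -> dot A x <= 0.
  move=> /(tangent_mem q)/oppN h; have := tangent_ge0 Aq A1 h.
  by rewrite dotNr oppr_ge0.
have BC x : C x -> 0 <= dot B x.
  move=> /(tangent_mem q)/opp h; have := tangent_ge0 NBq NB h.
  by rewrite dotNr dotNl opprK.
have AE' x : E' x -> 0 <= dot A x.
  move=> /(tangent_mem q)/hEN h; have := tangent_ge0 NAq NA h.
  by rewrite dotNr dotNl opprK.
have BE' x : E' x -> dot B x <= 0.
  move=> /(tangent_mem q)/hEN h; have := tangent_ge0 Bq B1 h.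
  by rewrite dotNr oppr_ge0.
have qmod x : dot A x = 0 -> dot B x = 0 -> exists c, x = c *: q.
  move=> Ax Bx; apply: contrapT => nx.
  have [a eA] := frame_line fr nx Aq Ax; have [b eB] := frame_line fr nx Bq Bx.
  move: eA eB; move: (_ - _) => w eA eB.
  have A0 := separator_neq0 XC XE (nesym EC) sA.
  have B0 := separator_neq0 XE XK EK sB.
  have NA0 : - A <> 0 by move/eqP; rewrite oppr_eq0 => /eqP.
  have [oC [_ hC _]] := cell_inner HX XC.
  have [oE [_ hE' _]] := cell_inner HX XE.
  have := hC _ A1 A0; have := hC _ BC B0; have := hE' _ NA NA0; have := hE' _ B1 B0.
  rewrite eA eB !dotNl !dotZl; move: (dot w oC) (dot w oE) => s t h1 h2 h3 h4.
  have h5 := mulr_gt0 h1 h3; have h6 := mulr_gt0 h2 h4.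
  have : 0 < (b * t * (b * s)) * (- (a * t) * (a * s)) by exact: mulr_gt0.
  have -> : (b * t * (b * s)) * (- (a * t) * (a * s)) = - (a * b * s * t) ^+ 2 by ring.
  by rewrite oppr_gt0 ltNge sqr_ge0.
have Bx1 : 0 < dot B x1.
  rewrite lt_neqAle BC // andbT; apply/eqP => /esym E0; apply: nx1; exact: qmod.
have Ax2 : dot A x2 < 0.
  rewrite lt_neqAle A2 // andbT; apply/eqP => E0; apply: nx2; exact: qmod.
have dec z : exists c, z = (dot B z / dot B x1) *: x1 + (dot A z / dot A x2) *: x2 + c *: q.
  have [||c ec] := qmod (z - ((dot B z / dot B x1) *: x1 + (dot A z / dot A x2) *: x2)).
  - by dotE; rewrite Ax1 mulr0 add0r divfK ?subrr // lt_eqF.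
  - by dotE; rewrite Bx2 mulr0 addr0 divfK ?subrr // gt_eqF.
  by exists c; rewrite -ec addrC subrK.
exists A, B, E'; split=> //.
- exact: nesym.
- move=> KE; apply: (cell_not_in_line HX XK (separator_neq0 XC XE (nesym EC) sA)) => x Kx.
  by apply/eqP; rewrite eq_le AK //= AE' // -KE.
- move=> CE; apply: (cell_not_in_line HX XC (separator_neq0 XE XK EK sB)) => x Cx.
  by apply/eqP; rewrite eq_le BC //= andbT BE' // -CE.
- by move=> x Cx; split; [exact: A1|exact: BC].
- by move=> x Ex; split; [exact: A2|exact: B1].
- by move=> x Kx; split; [exact: AK|exact: B2].
- by move=> x Ex; split; [exact: AE'|exact: BE'].
- by move=> x Ax; split=> h; [exact: A3|exact: A4].
- move=> x Ax; have NAx : dot A (- x) = 0 by rewrite dotNr Ax oppr0.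
  split=> h.
    apply: (tangent_mem_face HX XK XE' Kq h); apply/hEN.
    apply: (tangent_wall (C := C) Aq _ NAx) => [y Ay Cy|]; first exact: A3.
    by apply/oppN; exact: tangent_mem.
  apply: (tangent_mem_face HX XE' XK E'q h); apply/oppN.
  apply: (tangent_wall (C := E) Aq _ NAx) => [y Ay Ey|]; first exact: A4.
  by apply/hEN; exact: tangent_mem.
- by move=> x Bx; split=> h; [exact: B3|exact: B4].
- move=> x Bx; have NBx : dot B (- x) = 0 by rewrite dotNr Bx oppr0.
  split=> h.
    apply: (tangent_mem_face HX XC XE' Cq h); apply/hEN.
    apply: (tangent_wall (C := K) Bq _ NBx) => [y By Ky|]; first exact: B4.
    by apply/opp; exact: tangent_mem.
  apply: (tangent_mem_face HX XE' XC E'q h); apply/opp.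
  apply: (tangent_wall (C := E) Bq _ NBx) => [y By Ey|]; first exact: B3.
  by apply/hEN; exact: tangent_mem.
- move=> m mq.
  exists (dot m x2 / dot A x2), (dot m x1 / dot B x1).
  apply: dot_ext => z; have [c ez] := dec z.
  rewrite {1}ez; dotE; rewrite mq mulr0 addr0.
  by field; rewrite (gt_eqF Bx1) (lt_eqF Ax2).
- move=> K0 XK0 K0q.
  have [z [K0z _ hz]] := cell_inner HX XK0.
  have fin D : X D -> tangent q D z -> D = K0.
    by move=> XD /(tangent_mem_face HX XK0 XD K0q K0z); exact: hz.
  have [c ez] := dec z.
  have NN a v : a *: v = (- a) *: (- v) by rewrite scalerN scaleNr opprK.
  have tx1 : tangent q K (- x1) by apply/opp; exact: tangent_mem.
  have tx2 : tangent q C (- x2) by apply/oppN; exact: tangent_mem.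
  have tx1' : tangent q E' (- x1) by apply/hE; exact: tangent_mem.
  have tx2' : tangent q E' (- x2) by apply/hE; exact: tangent_mem.
  have [b0|b0] := leP 0 (dot B z / dot B x1); have [a0|a0] := leP 0 (dot A z / dot A x2).
  + by apply: Or42; rewrite (fin E) // ez; apply: tangent_comb => //; exact: tangent_mem.
  + apply: Or41; rewrite (fin C) // ez [X in _ + X + _]NN.
    apply: tangent_comb => //; first exact: tangent_mem.
    by rewrite oppr_ge0 ltW.
  + apply: Or43; rewrite (fin K) // ez [X in X + _ + _]NN.
    apply: tangent_comb => //; first exact: tangent_mem.
    by rewrite oppr_ge0 ltW.
  + apply: Or44; rewrite (fin E') // ez [X in X + _ + _]NN [X in _ + X + _]NN.
    by apply: tangent_comb => //; rewrite oppr_ge0 ltW.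
Qed.

(** Two functionals that are positive outside of the line of [q] cannot cover
the plane transverse to [q] by their two half-planes. *)
Lemma third_cell q e1 e2 C K u u' : frame q e1 e2 -> X C -> X K ->
  exposes C q u -> exposes K q u' -> exists E, [/\ X E, E q, E <> C & E <> K].
Proof.
move=> fr XC XK [uq u1 u2] [uq' u1' u2'].
suff [y [uy uy' ny]] : exists y, [/\ dot u y <= 0, dot u' y <= 0 & ~ exists c, y = c *: q].
  have [t t0 ht] := far_cells HX q y.
  have [E XE Ey] := tc_cover HX (y + t *: q).
  have ny' : ~ exists c, y + t *: q = c *: q.
    by move=> [c ec]; apply: ny; exists (c - t); rewrite scalerBl -ec addrK.
  exists E; split=> //; first exact: ht Ey.
    move=> EC; rewrite EC in Ey; apply: ny'; apply: u2 => //.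
    by apply/eqP; rewrite eq_le u1 // andbT; dotE; rewrite uq mulr0 addr0.
  move=> EK; rewrite EK in Ey; apply: ny'; apply: u2' => //.
  by apply/eqP; rewrite eq_le u1' // andbT; dotE; rewrite uq' mulr0 addr0.
pose w := dot u e1 *: e2 - dot u e2 *: e1.
have uw : dot u w = 0 by rewrite /w; dotE; ring.
have nw : ~ exists c, w = c *: q.
  move/(frame_modP w fr); rewrite /w; dotE.
  rewrite (frame11 fr) (frame22 fr) (frame12 fr) (dotC e2) (frame12 fr).
  move=> [h1 h2]; apply: (cell_not_in_ray HX fr XC) => x Cx; apply: u2 => //.
  rewrite (frame_dot x fr uq).
  have -> : dot u e1 = 0 by lra.
  have -> : dot u e2 = 0 by lra.
  by rewrite !mul0r addr0.
have [h|h] := leP (dot u' w) 0; first by exists w; rewrite uw lexx.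
exists (- w); rewrite !dotNr uw oppr0 lexx oppr_le0 ltW //; split=> //.
by move=> [c ec]; apply: nw; exists (- c); rewrite scaleNr -ec opprK.
Qed.

(** ** Cells with a common wall *)

Definition abut C K : Prop := exists q e1 e2 x,
  [/\ frame q e1 e2, C q /\ K q, C x /\ K x & ~ exists c, x = c *: q].


(** The sum of two independent common vectors. *)
Lemma abut_generic C K : X C -> X K -> C <> K -> abut C K ->
  exists x, [/\ C x, K x & forall E, X E -> E x -> E = C \/ E = K].
Proof.
move=> XC XK CK [q [e1 [e2 [x [fr [h2 h3] [h4 h5] h6]]]]].
have cC := tc_cone HX XC; have cK := tc_cone HX XK.
exists (q + x); split; [exact: (coneD cC)|exact: (coneD cK)|].
move=> E XE Ex; have Eq := face HX XC XE h2 h4 Ex.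
have {}Ex : E x by move: Ex; rewrite addrC; exact: (face HX XC XE h4 h2).
apply: contrapT => /not_orP[EC EK]; apply: h6.
by apply: (no_triple HX fr XC XK XE CK (nesym EC) (nesym EK)).
Qed.

(** The other cells touch [C0] in boundary rays of its projection along [q]. *)
Lemma at_most_three q e1 e2 C0 C1 C2 C3 : frame q e1 e2 ->
  X C0 -> X C1 -> X C2 -> X C3 -> C0 q -> C1 q -> C2 q -> C3 q ->
  C0 <> C1 -> C0 <> C2 -> C0 <> C3 -> C1 <> C2 -> C1 <> C3 -> C2 <> C3 ->
  abut C0 C1 -> abut C0 C2 -> abut C0 C3 -> False.
Proof.
move=> fr X0 X1 X2 X3 q0 q1 q2 q3 n01 n02 n03 n12 n13 n23 a1 a2 a3.
have [x1 [x10 x11 h1]] := abut_generic X0 X1 n01 a1.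
have [x2 [x20 x22 h2]] := abut_generic X0 X2 n02 a2.
have [x3 [x30 x33 h3]] := abut_generic X0 X3 n03 a3.
have [m1 s1] := tc_sep HX X0 X1 n01.
have [m2 s2] := tc_sep HX X0 X2 n02.
have [m3 s3] := tc_sep HX X0 X3 n03.
have E1 := separator0 s1 x10 x11; have E2 := separator0 s2 x20 x22.
have E3 := separator0 s3 x30 x33.
have gt K m x : separator C0 K m -> C0 x -> ~ K x -> 0 < dot m x.
  move=> [g1 g2 g3 g4] Cx nK; rewrite lt_neqAle g1 // andbT.
  by apply/eqP => /esym /(g3 _ Cx).
have G12 : 0 < dot m1 x2 by apply: gt s1 x20 _ => /(h2 _ X1)[/nesym|].
have G13 : 0 < dot m1 x3 by apply: gt s1 x30 _ => /(h3 _ X1)[/nesym|].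
have G21 : 0 < dot m2 x1 by apply: gt s2 x10 _ => /(h1 _ X2)[/nesym|/nesym].
have G23 : 0 < dot m2 x3 by apply: gt s2 x30 _ => /(h3 _ X2)[/nesym|].
have G31 : 0 < dot m3 x1 by apply: gt s3 x10 _ => /(h1 _ X3)[/nesym|/nesym].
have G32 : 0 < dot m3 x2 by apply: gt s3 x20 _ => /(h2 _ X3)[/nesym|/nesym].
have fd1 := fun x => frame_dot x fr (separator0 s1 q0 q1).
have fd2 := fun x => frame_dot x fr (separator0 s2 q0 q2).
have fd3 := fun x => frame_dot x fr (separator0 s3 q0 q3).
rewrite (fd1 x1) in E1; rewrite (fd1 x2) in G12; rewrite (fd1 x3) in G13.
rewrite (fd2 x2) in E2; rewrite (fd2 x1) in G21; rewrite (fd2 x3) in G23.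
rewrite (fd3 x3) in E3; rewrite (fd3 x1) in G31; rewrite (fd3 x2) in G32.
exact: (plane_boundary E1 E2 E3 G12 G13 G21 G23 G31 G32).
Qed.

(** ** Nonplanarity of the complete bipartite graph on 3 + 3 vertices *)

Lemma image_plane_cone e1 e2 C : convex_cone C ->
  plane_cone (fun a b => exists z, [/\ C z, dot e1 z = a & dot e2 z = b]).
Proof.
move=> cC; split=> [a b a' b' [z [h1 <- <-]] [z' [h1' <- <-]]|t a b t0 [z [h1 <- <-]]].
  by exists (z + z'); rewrite !dotDr; split=> //; exact: (coneD cC).
by exists (t *: z); rewrite !dotZr; split=> //; exact: (coneZ cC).
Qed.

Lemma same_image q e1 e2 x z : frame q e1 e2 -> dot e1 z = dot e1 x ->
  dot e2 z = dot e2 x -> exists c, z = x + c *: q.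
Proof.
move=> fr h1 h2; have [||c ec] := frame_mod (x := z - x) fr.
- by rewrite dotDr dotNr h1 subrr.
- by rewrite dotDr dotNr h2 subrr.
by exists c; rewrite -ec addrC subrK.
Qed.

(** Projected along [q], the cells [C1], [C2], [C3] become sectors, each of
which meets the projection of [K] and that of [K'].  By [plane_three_sectors], there
is a common point of some [Ci] and the lower cell, [K'] say, such that the line
through it in the direction [q] meets [K].  Above this point, the line is
inside [Ci]; at the point and below, it is on the side of [K']. *)
Lemma no_K33 q e1 e2 C1 C2 C3 K K' : frame q e1 e2 ->
  X C1 -> X C2 -> X C3 -> X K -> X K' ->
  C1 q -> C2 q -> C3 q -> ~ K q -> ~ K' q ->
  C1 <> C2 -> C1 <> C3 -> C2 <> C3 -> K <> K' ->
  (forall C, X C -> C q -> exists u, exposes C q u) ->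
  abut C1 K -> abut C2 K -> abut C3 K ->
  abut C1 K' -> abut C2 K' -> abut C3 K' -> False.
Proof.
move=> fr; wlog : K K' / exists2 l, separator K K' l & 0 <= dot l q.
  move=> wl X1 X2 X3 XK XK' q1 q2 q3 nK nK' n12 n13 n23 KK' ext a1 a2 a3 b1 b2 b3.
  have [l sl] := tc_sep HX XK XK' KK'.
  have [lq|lq] := leP 0 (dot l q); first by apply: (wl K K') => //; exists l.
  apply: (wl K' K) => //; [|exact: nesym].
  by exists (- l); [exact: separatorC|rewrite dotNl oppr_ge0 ltW].
move=> [l sl lq] X1 X2 X3 XK XK' q1 q2 q3 nK nK' n12 n13 n23 KK' ext a1 a2 a3 b1 b2 b3.
pose img C a b := exists z, [/\ C z, dot e1 z = a & dot e2 z = b].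
have ne C D : C q -> ~ D q -> C <> D by move=> Cq Dq E; apply: Dq; rewrite -E.
have ptd C : X C -> C q -> plane_pointed (img C).
  move=> XC Cq a b [z [Cz <- <-]] [z' [Cz' h1 h2]].
  have [u [uq u1 u2]] := ext C XC Cq.
  apply/(frame_modP z fr); apply: u2 => //.
  have [||c ec] := frame_mod (x := z + z') fr.
  - by rewrite dotDr h1 subrr.
  - by rewrite dotDr h2 subrr.
  have : dot u (z + z') = 0 by rewrite ec dotZr uq mulr0.
  by rewrite dotDr; have := u1 _ Cz; have := u1 _ Cz'; lra.
have nimg C D x : X C -> X D -> C q -> D q -> C x -> ~ D x -> ~ img D (dot e1 x) (dot e2 x).
  move=> XC XD Cq Dq Cx nDx [z [Dz h1 h2]]; apply: nDx.
  have [c ec] := same_image fr h1 h2.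
  have [c0|c0] := leP c 0.
    have -> : x = z + (- c) *: q by rewrite ec scaleNr addrK.
    by apply: (coneDZ HX) => //; rewrite oppr_ge0.
  apply: (face HX XC XD Cx (y := c *: q)); last by rewrite -ec.
  exact: (coneZ (tc_cone HX XC) (ltW c0)).
have out C b : X C -> C q -> C b -> K' b ->
    (forall E, X E -> E b -> E = C \/ E = K') -> ~ img K (dot e1 b) (dot e2 b).
  move=> XC Cq Cb K'b hb [z [Kz h1 h2]].
  have [c ec] := same_image fr h1 h2; rewrite ec in Kz.
  have [c0|c0] := leP c 0.
    have [l1 l2 l3 l4] := sl.
    have lb : dot l b < 0.
      rewrite lt_neqAle l2 // andbT; apply/eqP => /(l4 _ K'b) Kb.
      by case: (hb _ XK Kb) => // E; apply: nK; rewrite E.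
    have := l1 _ Kz; rewrite dotDr dotZr.
    have c0' : 0 <= - c by rewrite oppr_ge0.
    by have := mulr_ge0 c0' lq; lra.
  apply: nK; apply: (faceZ HX XK c0).
  apply: (face HX XC XK (y := b)) => //; last by rewrite addrC.
  exact: (coneZ (tc_cone HX XC) (ltW c0)).
have [x1 [x1C x1K h1]] := abut_generic X1 XK (ne _ _ q1 nK) a1.
have [x2 [x2C x2K h2]] := abut_generic X2 XK (ne _ _ q2 nK) a2.
have [x3 [x3C x3K h3]] := abut_generic X3 XK (ne _ _ q3 nK) a3.
have [y1 [y1C y1K g1]] := abut_generic X1 XK' (ne _ _ q1 nK') b1.
have [y2 [y2C y2K g2]] := abut_generic X2 XK' (ne _ _ q2 nK') b2.
have [y3 [y3C y3K g3]] := abut_generic X3 XK' (ne _ _ q3 nK') b3.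
have nin C D x : (forall E, X E -> E x -> E = C \/ E = K) -> X D -> D q -> C <> D -> ~ D x.
  move=> hx XD Dq CD /(hx _ XD)[/nesym//|E]; exact: ne _ _ Dq nK E.
have im C z : C z -> img C (dot e1 z) (dot e2 z) by move=> Cz; exists z.
have cimg C : X C -> plane_cone (img C) by move=> XC; exact: image_plane_cone (tc_cone HX XC).
have := @plane_three_sectors R (img K) (img C1) (img C2) (img C3) _ _ _ _ _ _ _ _ _ _ _ _
  (cimg _ XK) (cimg _ X1) (cimg _ X2) (cimg _ X3) (ptd _ X1 q1) (ptd _ X2 q2) (ptd _ X3 q3)
  (im _ _ x1K) (im _ _ x2K) (im _ _ x3K) (im _ _ x1C) (im _ _ x2C) (im _ _ x3C)
  (nimg _ _ _ X2 X1 q2 q1 x2C (nin _ _ _ h2 X1 q1 (nesym n12)))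
  (nimg _ _ _ X3 X1 q3 q1 x3C (nin _ _ _ h3 X1 q1 (nesym n13)))
  (nimg _ _ _ X1 X2 q1 q2 x1C (nin _ _ _ h1 X2 q2 n12))
  (nimg _ _ _ X3 X2 q3 q2 x3C (nin _ _ _ h3 X2 q2 (nesym n23)))
  (nimg _ _ _ X1 X3 q1 q3 x1C (nin _ _ _ h1 X3 q3 n13))
  (nimg _ _ _ X2 X3 q2 q3 x2C (nin _ _ _ h2 X3 q3 n23))
  (im _ _ y1C) (im _ _ y2C) (im _ _ y3C).
by case; [exact: out g1|exact: out g2|exact: out g3].
Qed.

(** * Potentials *)

(** The convex function vanishes on [D]; on any other cell [C] it is the linear
form with value 1 at [q] that vanishes on the common face of [C] and [D]. *)
Lemma potential_apex q D : q <> 0 -> X D -> ~ D q ->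
  (forall C, X C -> C <> D -> C q) -> has_potential X.
Proof.
move=> q0 XD nDq hq.
have /choice[n hn] C : exists n, X C -> C <> D -> separator C D n /\ dot n q = 1.
  have [XC|nXC] := pselect (X C); last by exists 0.
  have [->|/eqP CD] := eqVneq C D; first by exists 0.
  have [n sn] := tc_sep HX XC XD CD; have Cq := hq _ XC CD.
  case: (sn) => h1 h2 h3 h4.
  have nq : 0 < dot n q.
    rewrite lt_neqAle h1 // andbT; apply/eqP => /esym/(h3 _ Cq); exact: nDq.
  have i0 : 0 < (dot n q)^-1 by rewrite invr_gt0.
  have z x : (dot n q)^-1 * dot n x = 0 -> dot n x = 0.
    by move/eqP; rewrite mulf_eq0 gt_eqF //= => /eqP.
  exists ((dot n q)^-1 *: n) => _ _; split; last by rewrite dotZl mulVf // gt_eqF.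
  split=> x hx; rewrite dotZl.
  - by rewrite pmulr_rge0 // h1.
  - by rewrite pmulr_rle0 // h2.
  - by move/z; exact: h3.
  - by move/z; exact: h4.
have down C x : X C -> C <> D -> C x -> exists2 t, 0 <= t & C (x - t *: q) /\ D (x - t *: q).
  move=> XC CD Cx.
  have [t [K [t0 XK nKq Cy Ky]]] := descent HX XC (hq _ XC CD) q0 Cx.
  exists t => //; split=> //.
  by have [<-//|/eqP KD] := eqVneq K D; case: nKq; exact: hq.
exists (fun C a => (C = D /\ a = 0) \/ [/\ X C, C <> D & a = n C]); split.
- move=> C XC; have [->|/eqP CD] := eqVneq C D; first by exists 0; left.
  by exists (n C); right.
- move=> C K a b [[-> ->]|[XC CD ->]] [[_ ->]|[XK KD ->]] x Cx.
  + by [].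
  + by rewrite dot0l; have [[_ h _ _] _] := hn _ XK KD; exact: h.
  + by rewrite dot0l; have [[h _ _ _] _] := hn _ XC CD; exact: h.
  + have [sC Cq] := hn _ XC CD; have [[_ h _ _] Kq] := hn _ XK KD.
    have [t t0 [Cy Dy]] := down _ _ XC CD Cx.
    have := separator0 sC Cy Dy; have := h _ Dy; dotE; rewrite Cq Kq; lra.
- move=> C K a b XC XK [[-> ->]|[_ CD ->]] [[-> ->]|[_ KD ->]] CK E.
  + exact: CK.
  + by have [_] := hn _ XK KD; rewrite -E dot0l => /esym/eqP; rewrite oner_eq0.
  + by have [_] := hn _ XC CD; rewrite E dot0l => /esym/eqP; rewrite oner_eq0.
  + apply: CK; apply: (cell_sub HX XC XK) => x Cx.
    have [t t0 [Cy Dy]] := down _ _ XC CD Cx.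
    have [sC _] := hn _ XC CD; have [[_ _ _ h4] _] := hn _ XK KD.
    have := separator0 sC Cy Dy; rewrite E => /(h4 _ Dy) Ky.
    rewrite -(subrK (t *: q) x); apply: (coneDZ HX) => //; exact: hq.
Qed.

End Stars.

Section Cases.
Variables (R : realType) (d : nat).
Local Notation V := 'rV[R]_d.
Implicit Types (u v w x y z n m p q e a b : V) (C K E D f : set V).
Variable X : set (set V).
Hypothesis HX : tight_cells X.

Lemma dot_fun u v : u = v -> forall x, dot u x = dot v x.
Proof. by move=> ->. Qed.

Lemma potential_seq (cs : seq (set V)) (gs : seq V) : size cs = size gs ->
  uniq gs -> (forall K, X K -> K \in cs) ->
  (forall C v w x, (C, v) \in zip cs gs -> w \in gs -> C x -> dot w x <= dot v x) ->
  has_potential X.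
Proof.
move=> sz u cov le; exists (fun C v => (C, v) \in zip cs gs).
have mem C v : (C, v) \in zip cs gs ->
    exists2 i, (i < size gs)%N & C = nth set0 cs i /\ v = nth 0 gs i.
  move/(nthP (set0, 0)) => [i]; rewrite size_zip sz minnn => ilt.
  by rewrite nth_zip // => -[<- <-]; exists i.
split.
- move=> K /cov /(nthP set0)[i]; rewrite sz => ilt <-; exists (nth 0 gs i).
  by rewrite -nth_zip // mem_nth // size_zip sz minnn.
- move=> C K v w Cv /mem[i ilt [_ ->]] x; apply: le Cv _; exact: mem_nth.
- move=> C K v w _ _ /mem[i ilt [-> ->]] /mem[j jlt [-> ->]] CK E; apply: CK.
  by move/eqP: E; rewrite nth_uniq // => /eqP ->.
Qed.

(** ** Finitely many gradients *)

(** The sum of the absolute values of [A] and [B]. *)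
Lemma potential_quad q A B C1 C2 C3 C4 : quad X q A B C1 C2 C3 C4 ->
  (forall K, X K -> K q) -> has_potential X.
Proof.
move=> Q hq; case: (Q) => n12 n23 n34 n14 X1 X2 X3 X4 q1 q2 q3 q4 Aq Bq s1 s2 s3 s4
  h12 h34 h23 h14 hs hm ha.
have A0 : A <> 0.
  move=> A0; apply: n12; apply: (cell_sub HX) => // x.
  by apply: (proj1 (h12 x _)); rewrite A0 dot0l.
have B0 : B <> 0.
  move=> B0; apply: n23; apply: (cell_sub HX) => // x.
  by apply: (proj1 (h23 x _)); rewrite B0 dot0l.
have AB : A + B <> 0.
  move=> /dot_fun AB; apply: (cell_not_in_line HX X1 A0) => x /s1.
  by have := AB x; dotE; lra.
have AB' : A - B <> 0.
  move=> /dot_fun AB'; apply: (cell_not_in_line HX X2 A0) => x /s2.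
  by have := AB' x; dotE; lra.
apply: (@potential_seq [:: C1; C2; C3; C4] [:: A + B; B - A; - A - B; A - B]) => //.
- rewrite /= !inE !negb_or !andbT; do ![apply/andP; split].
  + by apply/eqP => /dot_fun h; apply: A0; apply: dot_ext => x; have := h x; dotE; lra.
  + by apply/eqP => /dot_fun h; apply: AB; apply: dot_ext => x; have := h x; dotE; lra.
  + by apply/eqP => /dot_fun h; apply: B0; apply: dot_ext => x; have := h x; dotE; lra.
  + by apply/eqP => /dot_fun h; apply: B0; apply: dot_ext => x; have := h x; dotE; lra.
  + by apply/eqP => /dot_fun h; apply: AB'; apply: dot_ext => x; have := h x; dotE; lra.
  + by apply/eqP => /dot_fun h; apply: A0; apply: dot_ext => x; have := h x; dotE; lra.
- by move=> K XK; rewrite !inE; case: (ha _ XK (hq _ XK)) => ->; rewrite eqxx ?orbT.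
- move=> C v w x; rewrite /= !inE => hC hw Cx.
  suff [k1 k2 k3 k4] : [/\ dot A x + dot B x <= dot v x, dot B x - dot A x <= dot v x,
      - dot A x - dot B x <= dot v x & dot A x - dot B x <= dot v x].
    by case/or4P: hw => /eqP ->; dotE.
  by case/or4P: hC Cx => /eqP [-> ->]; [move/s1|move/s2|move/s3|move/s4]; dotE;
    move: (dot A x) (dot B x) => k l [? ?]; split; lra.
Qed.

Lemma separator_exposes C K q n : C q -> K q ->
  (forall x, C x -> K x -> exists c, x = c *: q) ->
  separator C K n -> exposes C q n.
Proof.
move=> Cq Kq h sn; have E := separator0 sn Cq Kq.
by case: sn => h1 _ h3 _; split=> // x Cx /(h3 _ Cx); exact: h.
Qed.

Lemma ray_quad q e1 e2 C K : frame q e1 e2 -> X C -> X K -> C <> K ->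
  C q -> K q -> (forall x, C x -> K x -> exists c, x = c *: q) ->
  exists A B E E', quad X q A B C E K E'.
Proof.
move=> fr XC XK CK Cq Kq h; have [n sn] := tc_sep HX XC XK CK.
have h' x : K x -> C x -> exists c, x = c *: q by move=> Kx Cx; exact: h.
have [E [XE Eq EC EK]] := third_cell HX fr XC XK
  (separator_exposes Cq Kq h sn) (separator_exposes Kq Cq h' (separatorC sn)).
have [A [B [E' Q]]] := quad_exists HX fr XC XE XK CK EC EK Cq Eq Kq h.
by exists A, B, E, E'.
Qed.

Lemma three_cells q e1 e2 : frame q e1 e2 ->
  (forall C, X C -> C q -> exists u, exposes C q u) ->
  exists C1 C2 C3, [/\ [/\ X C1, X C2 & X C3], [/\ C1 q, C2 q & C3 q]
    & [/\ C1 <> C2, C1 <> C3 & C2 <> C3]].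
Proof.
move=> fr ext; have [C1 X1 q1] := tc_cover HX q.
have [u1 h1] := ext _ X1 q1.
have [C2 [X2 q2 n12 _]] := third_cell HX fr X1 X1 h1 h1.
have [u2 h2] := ext _ X2 q2.
have [C3 [X3 q3 n13 n23]] := third_cell HX fr X1 X2 h1 h2.
by exists C1, C2, C3; split; split=> //; exact: nesym.
Qed.

(** ** Fans in the plane *)

(** Either two cells meet in the vertex only, and [quad] describes all of them,
or any two share a wall, and there are three cells by [at_most_three]; then the
common ray of two of them plays the role of [q] in [potential_apex]. *)
Lemma potential2 e1 e2 : frame 0 e1 e2 -> has_potential X.
Proof.
move=> fr; have all0 K : X K -> K 0 by move=> XK; exact: cone0 (tc_cone HX XK).
have ext C : X C -> C 0 -> exists u, exposes C 0 u.
  move=> XC C0; have [u hu] := tc_apex HX XC; exists u; split; first by rewrite dot0r.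
    by move=> x /hu[].
  by move=> x /hu[_ h] /h ->; exists 0; rewrite scaler0.
have [[C [K [XC XK CK h]]]|no] :=
  pselect (exists C K, [/\ X C, X K, C <> K & forall x, C x -> K x -> exists c, x = c *: (0 : V)]).
  have [A [B [E [E' Q]]]] := ray_quad fr XC XK CK (all0 _ XC) (all0 _ XK) h.
  exact: potential_quad Q all0.
have adj C K : X C -> X K -> C <> K -> abut C K.
  move=> XC XK CK; apply: contrapT => nadj; apply: no; exists C, K; split=> // x Cx Kx.
  apply: contrapT => nx; apply: nadj; exists 0, e1, e2, x; split=> //.
  by split; exact: all0.
have [C1 [C2 [C3 [[X1 X2 X3] [q1 q2 q3] [n12 n13 n23]]]]] := three_cells fr ext.
have all3 K : X K -> K <> C3 -> K = C1 \/ K = C2.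
  move=> XK K3; apply: contrapT => /not_orP[K1 K2].
  apply: (at_most_three HX fr X1 X2 X3 XK) => //; [exact: all0|exact: nesym| | | | |].
  - exact: nesym.
  - exact: nesym.
  - exact: adj.
  - exact: adj.
  - by apply: adj => //; exact: nesym.
have [x [x1 x2 hx]] := abut_generic HX X1 X2 n12 (adj _ _ X1 X2 n12).
have n3 : ~ C3 x by move=> /(hx _ X3)[/nesym|/nesym].
apply: (potential_apex HX (q := x) (D := C3)) => //.
  by move=> x0; apply: n3; rewrite x0.
by move=> C XC /(all3 _ XC)[->|->].
Qed.

End Cases.

(** ** Scalar inequalities between the linear forms of a potential *)

Section MaxInequalities.
Variables (R : realType) (k l m v : R).

(** The comparison in [potential_octahedron], for the values [k], [l], [m] of the
three separators at a point: the assumptions hold where the descent by [t] ends,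
in the opposite of one or the other neighbour. *)
Lemma octahedron_side (t : R) : 0 <= k -> 0 <= l -> 0 <= k - t * 2 -> 0 <= l - t * 2 ->
  0 <= - (k - t * 2) /\ 0 <= - (m - t * 2) \/ 0 <= - (l - t * 2) /\ 0 <= - (m - t * 2) ->
  [/\ 0 <= k, 0 <= l, m <= k & m <= l].
Proof. by move=> h1 h2 h3 h4 [] [h5 h6]; split; lra. Qed.

Lemma octahedron_max :
  [\/ [/\ 0 <= k, 0 <= l, m <= k & m <= l] /\ v = 2^-1 * (k + l - m),
      [/\ 0 <= k, 0 <= m, l <= k & l <= m] /\ v = 2^-1 * (k + m - l)
    | [/\ 0 <= l, 0 <= m, k <= l & k <= m] /\ v = 2^-1 * (l + m - k)] \/
  [\/ [/\ 0 <= - k, 0 <= - l, - m <= - k & - m <= - l] /\ v = - (2^-1 * (k + l - m)),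
      [/\ 0 <= - k, 0 <= - m, - l <= - k & - l <= - m] /\ v = - (2^-1 * (k + m - l))
    | [/\ 0 <= - l, 0 <= - m, - k <= - l & - k <= - m] /\ v = - (2^-1 * (l + m - k))] ->
  [/\ 2^-1 * (k + l - m) <= v, 2^-1 * (k + m - l) <= v & 2^-1 * (l + m - k) <= v] /\
  [/\ - (2^-1 * (k + l - m)) <= v, - (2^-1 * (k + m - l)) <= v
    & - (2^-1 * (l + m - k)) <= v].
Proof. by case=> -[] [[h1 h2 h3 h4] ->]; split; split; lra. Qed.

Lemma prism_max :
  [\/ [/\ 0 <= m, 0 <= k & l <= k] /\ v = k + m,
      [/\ 0 <= m, 0 <= l & k <= l] /\ v = l + m
    | [/\ 0 <= m, k <= 0 & l <= 0] /\ v = m] \/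
  [\/ [/\ m <= 0, 0 <= l & k <= l] /\ v = l - m,
      [/\ m <= 0, 0 <= k & l <= k] /\ v = k - m
    | [/\ m <= 0, k <= 0 & l <= 0] /\ v = - m] ->
  [/\ k + m <= v, l + m <= v & m <= v] /\ [/\ k - m <= v, l - m <= v & - m <= v].
Proof. by case=> -[] [[h1 h2 h3] ->]; split; split; lra. Qed.

End MaxInequalities.

Section Space.
Variables (R : realType) (d : nat).
Local Notation V := 'rV[R]_d.
Implicit Types (u v w x y z n m p q e a b : V) (C K E D f : set V).
Variable X : set (set V).
Hypothesis HX : tight_cells X.
Hypothesis frames : forall q, q <> 0 -> exists e1 e2, frame q e1 e2.

(** * Fans in space *)

Lemma abut_intro C K q x : q <> 0 -> C q -> K q -> C x -> K x ->
  ~ (exists c, x = c *: q) -> abut C K.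
Proof.
move=> q0 Cq Kq Cx Kx nx; have [e1 [e2 fr]] := frames q0.
by exists q, e1, e2, x.
Qed.


Lemma ray_ge0 C q c : X C -> C q -> q <> 0 -> C (c *: q) -> 0 <= c.
Proof.
move=> XC Cq q0 Ccq; rewrite leNgt; apply/negP => c0; apply: q0.
apply: (tc_pointed HX XC Cq); apply: (faceZ HX (t := - c) XC); first by rewrite oppr_gt0.
by rewrite scalerN scaleNr opprK.
Qed.

Lemma quad_space q C E K : q <> 0 -> X C -> X E -> X K ->
  C <> K -> E <> C -> E <> K -> C q -> E q -> K q ->
  (forall x, C x -> K x -> E x) -> exists A B E', quad X q A B C E K E'.
Proof.
move=> q0 XC XE XK CK EC EK Cq Eq Kq h; have [e1 [e2 fr]] := frames q0.
apply: (quad_exists HX fr) => // x Cx Kx.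
exact: (no_triple HX fr XC XE XK (nesym EC) CK EK Cq Eq Kq Cx (h _ Cx Kx) Kx).
Qed.

(** ** Centrally symmetric fans *)

Definition opp C : set V := [set x | C (- x)].

Lemma opp_inj C K : opp C = opp K -> C = K.
Proof.
move=> E; rewrite predeqE => x; have : opp C (- x) <-> opp K (- x) by rewrite E.
by rewrite /opp /= opprK.
Qed.

Lemma oppK C : opp (opp C) = C.
Proof. by rewrite predeqE => x; rewrite /opp /= opprK. Qed.

Lemma tangent0 C y : tangent 0 C y <-> C y.
Proof.
split; last exact: tangent_mem.
by move=> [t _]; rewrite scaler0 addr0.
Qed.

Lemma core0 C K p : X C -> X K -> (forall x, C x -> K x -> x = 0) ->
  core (C `&` K) p -> p = 0.
Proof. by move=> XC XK h [[Cp Kp] _]; exact: h. Qed.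

Lemma antipodal C K : X C -> X K -> C <> K -> (forall x, C x -> K x -> x = 0) ->
  K = opp C.
Proof.
move=> XC XK CK h; have [p cp hp] := tc_symmetric HX XC XK CK.
have XKC : forall x, K x -> C x -> x = 0 by move=> x Kx Cx; exact: h.
have [p' cp' hp'] := tc_symmetric HX XK XC (nesym CK).
rewrite (core0 XC XK h cp) in hp; rewrite (core0 XK XC XKC cp') in hp'.
rewrite predeqE => x; split.
  by move=> Kx; apply/(tangent0 C (- x))/hp'/tangent0.
move=> Cx; rewrite -(opprK x); apply/tangent0/hp/tangent0; exact: Cx.
Qed.

Lemma antipodal_symmetric C K : X C -> X K -> C <> K ->
  (forall x, C x -> K x -> x = 0) -> forall E, X E -> X (opp E).
Proof.
move=> XC XK CK h E XE; have [p cp hp] := tc_standard HX XC XK CK.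
rewrite (core0 XC XK h cp) in hp.
have [E' [XE' _ hE]] := hp E XE (cone0 (tc_cone HX XE)).
suff -> : opp E = E' by [].
rewrite predeqE => x; split.
  by move=> Ex; rewrite -(opprK x); apply/tangent0/hE/tangent0; exact: Ex.
by move=> E'x; apply/(tangent0 E (- x))/hE/tangent0; rewrite opprK.
Qed.

Section Symmetric.
Hypothesis opX : forall E, X E -> X (opp E).

(** Otherwise [C] would be opposite to [opp K], that is, equal to [K]. *)
Lemma opp_meet C K q : X C -> X K -> q <> 0 -> C q -> K q -> C <> K ->
  exists x, [/\ x <> 0, C x & K (- x)].
Proof.
move=> XC XK q0 Cq Kq CK; apply: contrapT => no.
have CoK : C <> opp K.
  by move=> E; rewrite E in Cq; apply: q0; exact: (tc_pointed HX XK Kq Cq).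
apply: CK; apply: opp_inj; rewrite -(antipodal XC (opX XK) CoK) // => x Cx Kx.
by apply: contrapT => x0; apply: no; exists x.
Qed.

(** *** Eight octants *)

(** A common vector of [C1] and [opp C2] lies on the line where [B] vanishes, and
there [C1] agrees with [C4], and [C2] with [C3]. *)
Lemma quad_axis q A B C1 C2 C3 C4 : q <> 0 -> quad X q A B C1 C2 C3 C4 ->
  exists a, [/\ 0 < dot A a, dot B a = 0, C1 a /\ C4 a & C2 (- a) /\ C3 (- a)].
Proof.
move=> q0 [n12 n23 n34 n14 X1 X2 X3 X4 q1 q2 q3 q4 Aq Bq s1 s2 s3 s4
  h12 h34 h23 h14 hs hm ha].
have [a [a0 a1 a2]] := opp_meet X1 X2 q0 q1 q2 n12.
have [A1 B1] := s1 _ a1; have [_] := s2 _ a2; rewrite dotNr => B2.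
have Ba : dot B a = 0 by lra.
exists a; split=> //; last first.
- by split=> //; apply/h23; rewrite // dotNr Ba oppr0.
- by split=> //; apply/h14.
rewrite lt_neqAle A1 andbT; apply/eqP => /esym Aa; apply: a0.
have [c ec] := hm a Aa Ba; rewrite ec in a1 a2 *.
have c1 := ray_ge0 X1 q1 q0 a1; rewrite -scaleNr in a2.
have := ray_ge0 X2 q2 q0 a2; rewrite oppr_ge0 => c2.
by have -> : c = 0 by [lra]; rewrite scale0r.
Qed.

Definition is_sign (s : R) := s = 1 \/ s = - 1.

Lemma sign_max (s t y : R) : is_sign s -> is_sign t -> 0 <= s * y -> t * y <= s * y.
Proof. by case=> -> [] ->; lra. Qed.

Lemma exists_sign (y : R) : exists2 s, is_sign s & 0 <= s * y.
Proof.
have [h|h] := leP 0 y; first by exists 1; [left|rewrite mul1r].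
by exists (- 1); [right|rewrite mulN1r oppr_ge0 ltW].
Qed.

Lemma signK (s : R) : is_sign s -> s * s = 1.
Proof. by case=> ->; lra. Qed.

(** The functionals [A], [B], [Z] and the vectors [a], [b], [q] are dual bases
up to positive factors; the cells are the octants, and the sum of the absolute
values of the three functionals is the required convex function. *)
Lemma potential_cube q A B C1 C2 C3 C4 : q <> 0 -> quad X q A B C1 C2 C3 C4 ->
  has_potential X.
Proof.
move=> q0 Q; have [a [Aa Ba [a1 a4] [a2 a3]]] := quad_axis q0 Q.
have [b [Bb Ab' [b2 b1] [b3 b4]]] := quad_axis q0 (quad_rot Q).
have Ab : dot A b = 0 by move: Ab'; rewrite dotNl; lra.
case: Q => n12 n23 n34 n14 X1 X2 X3 X4 q1 q2 q3 q4 Aq Bq s1 s2 s3 s4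
  h12 h34 h23 h14 hs hm ha.
have a0 : a <> 0 by move=> E; move: Aa; rewrite E dot0r ltxx.
have nopp C K : X K -> C q -> K q -> C <> opp K.
  by move=> XK Cq Kq E; rewrite E in Cq; apply: q0; exact: (tc_pointed HX XK Kq Cq).
have [A' [Z [E' Q']]] : exists A' Z E', quad X a A' Z C1 C4 (opp C2) E'.
  apply: quad_space => //; [exact: opX|exact: nopp|exact: nesym|exact: nopp|].
  move=> x x1 x2; apply/h14 => //.
  by have [_] := s1 _ x1; have [_] := s2 _ x2; rewrite dotNr; lra.
have E3 : E' = opp C3.
  case: (quad_all Q' (opX X3) a3) => // E.
  - by case: (nopp C1 C3 X3).
  - by case: (nopp C4 C3 X3).
  - by case: n23; exact: opp_inj.
rewrite E3 in Q'.
have Za := quadB Q'.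
have Z1 x : C1 x -> 0 <= dot Z x by move/(quads1 Q') => [].
have Z4 x : C4 x -> 0 <= dot Z x by move/(quads2 Q') => [].
have Z2 x : C2 x -> 0 <= dot Z x.
  move=> h; have [_] : dot A' (- x) <= 0 /\ dot Z (- x) <= 0.
    by apply: (quads3 Q'); rewrite /opp /= opprK.
  by rewrite dotNr oppr_le0.
have Z3 x : C3 x -> 0 <= dot Z x.
  move=> h; have [_] : 0 <= dot A' (- x) /\ dot Z (- x) <= 0.
    by apply: (quads4 Q'); rewrite /opp /= opprK.
  by rewrite dotNr oppr_le0.
have Zq : 0 < dot Z q.
  rewrite lt_neqAle Z1 // andbT; apply/eqP => /esym/(quad23 Q')[/(_ q4) h _].
  by apply: q0; exact: (tc_pointed HX X2 q2 h).
have Zb : dot Z b = 0.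
  by have := Z1 _ b1; have := Z4 _ b4; rewrite dotNr; lra.
pose oct C s1 s2 s3 := [/\ X C, C (s1 *: a) /\ C (s2 *: b), C (s3 *: q)
  & forall x, C x -> [/\ 0 <= s1 * dot A x, 0 <= s2 * dot B x & 0 <= s3 * dot Z x]].
have octN C t1 t2 t3 : oct C t1 t2 t3 -> oct (opp C) (- t1) (- t2) (- t3).
  case=> XC [oa ob] oq h; split; [exact: opX| |by rewrite /opp /= scaleNr opprK|].
    by rewrite /opp /= !scaleNr !opprK.
  by move=> x /h; rewrite !dotNr !mulrN !mulNr.
have octE t1 t2 t3 : is_sign t1 -> is_sign t2 -> is_sign t3 -> exists C, oct C t1 t2 t3.
  have up k1 k2 : is_sign k1 -> is_sign k2 -> exists C, oct C k1 k2 1.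
    case=> -> [] ->.
    - exists C1; split; rewrite ?scale1r // => x x1; have [] := s1 _ x1.
      by have := Z1 _ x1; rewrite ?mul1r ?mulN1r ?oppr_ge0.
    - exists C4; split; rewrite ?scaleN1r ?scale1r // => x x4; have [] := s4 _ x4.
      by have := Z4 _ x4; rewrite ?mul1r ?mulN1r ?oppr_ge0.
    - exists C2; split; rewrite ?scaleN1r ?scale1r // => x x2; have [] := s2 _ x2.
      by have := Z2 _ x2; rewrite ?mul1r ?mulN1r ?oppr_ge0.
    - exists C3; split; rewrite ?scaleN1r ?scale1r // => x x3; have [] := s3 _ x3.
      by have := Z3 _ x3; rewrite ?mul1r ?mulN1r ?oppr_ge0.
  have isN s : is_sign s -> is_sign (- s) by case=> ->; [right|left; rewrite opprK].
  move=> h1 h2 [->|->]; first exact: up.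
  have [C /octN] := up _ _ (isN _ h1) (isN _ h2).
  by rewrite !opprK => h; exists (opp C).
have fill C t1 t2 t3 x : oct C t1 t2 t3 -> is_sign t1 -> is_sign t2 -> is_sign t3 ->
    0 <= t1 * dot A x -> 0 <= t2 * dot B x -> 0 <= t3 * dot Z x -> C x.
  move=> [XC [Ca Cb] Cq _] i1 i2 i3 g1 g2 g3; have cC := tc_cone HX XC.
  have [||c ec] := hm (x - ((dot A x / dot A a) *: a + (dot B x / dot B b) *: b)).
  - by dotE; rewrite Ab mulr0 addr0 divfK ?subrr // gt_eqF.
  - by dotE; rewrite Ba mulr0 add0r divfK ?subrr // gt_eqF.
  have Zc : c * dot Z q = dot Z x by rewrite -dotZr -ec; dotE; rewrite Za Zb; lra.
  have -> : x = (t1 * dot A x / dot A a) *: (t1 *: a)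
      + (t2 * dot B x / dot B b) *: (t2 *: b) + (t3 * c) *: (t3 *: q).
    rewrite !scalerA.
    have -> : t1 * dot A x / dot A a * t1 = (t1 * t1) * (dot A x / dot A a) by ring.
    have -> : t2 * dot B x / dot B b * t2 = (t2 * t2) * (dot B x / dot B b) by ring.
    have -> : t3 * c * t3 = (t3 * t3) * c by ring.
    by rewrite !signK // !mul1r -ec addrC subrK.
  apply: (coneD cC); first apply: (coneD cC); apply: (coneZ cC) => //.
  - by rewrite divr_ge0 // ltW.
  - by rewrite divr_ge0 // ltW.
  - by rewrite -(pmulr_lge0 _ Zq) -mulrA Zc.
exists (fun C v => exists t1 t2 t3, [/\ is_sign t1, is_sign t2, is_sign t3,
  oct C t1 t2 t3 & v = t1 *: A + t2 *: B + t3 *: Z]); split.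
- move=> K XK; have [x [Kx _ hx]] := cell_inner HX XK.
  have [t1 i1 g1] := exists_sign (dot A x).
  have [t2 i2 g2] := exists_sign (dot B x).
  have [t3 i3 g3] := exists_sign (dot Z x).
  have [C oC] := octE _ _ _ i1 i2 i3.
  have Cx := fill _ _ _ _ _ oC i1 i2 i3 g1 g2 g3.
  have XC : X C by case: oC.
  rewrite -(hx _ XC Cx).
  by exists (t1 *: A + t2 *: B + t3 *: Z), t1, t2, t3.
- move=> C K v w [t1 [t2 [t3 [i1 i2 i3 [_ _ _ oC] ->]]]].
  move=> [u1 [u2 [u3 [j1 j2 j3 _ ->]]]] x /oC[g1 g2 g3]; dotE.
  by apply: lerD; [apply: lerD|]; apply: sign_max.
- move=> C K v w XC XK [t1 [t2 [t3 [i1 i2 i3 oC ->]]]].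
  move=> [u1 [u2 [u3 [j1 j2 j3 oK ->]]]] CK /dot_fun h; apply: CK.
  have [x [Cx _ hx]] := cell_inner HX XC.
  symmetry; apply: hx => //.
  have E1 : t1 = u1.
    apply: (mulIf (lt0r_neq0 Aa)); have := h a; dotE; rewrite Ba Za; lra.
  have E2 : t2 = u2.
    apply: (mulIf (lt0r_neq0 Bb)); have := h b; dotE; rewrite Ab Zb; lra.
  have E3' : t3 = u3.
    apply: (mulIf (lt0r_neq0 Zq)); have := h q; dotE; rewrite Aq Bq; lra.
  have [_ _ _ /(_ _ Cx) [g1 g2 g3]] := oC.
  by apply: (fill _ _ _ _ _ oK) => //; rewrite -?E1 -?E2 -?E3'.
Qed.

(** *** Three pairs of opposite cells *)

(** A wall between [C] and the opposite of [K] is at the same time, reversed,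
one between [K] and the opposite of [C]. *)
Lemma opp_separator C K q : X C -> X K -> q <> 0 -> C q -> K q -> exists N,
  [/\ dot N q = 2, forall x, C x -> 0 <= dot N x, forall x, K x -> 0 <= dot N x
    & forall x, dot N x = 0 -> C x <-> K (- x)].
Proof.
move=> XC XK q0 Cq Kq.
have nK : ~ K (- q) by move=> h; apply: q0; exact: (tc_pointed HX XK Kq h).
have CoK : C <> opp K by move=> E; rewrite E in Cq.
have [n [h1 h2 h3 h4]] := tc_sep HX XC (opX XK) CoK.
have nq : 0 < dot n q.
  by rewrite lt_neqAle h1 // andbT; apply/eqP => /esym/(h3 _ Cq).
have i0 : 0 < 2 / dot n q by rewrite divr_gt0.
exists ((2 / dot n q) *: n); split=> [|x|x|x]; rewrite dotZl.
- by rewrite divfK // gt_eqF.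
- by move=> /h1; rewrite pmulr_rge0.
- move=> Kx; rewrite pmulr_rge0 //.
  by have := h2 (- x); rewrite /opp /= opprK dotNr oppr_le0; exact.
- move/eqP; rewrite mulf_eq0 gt_eqF //= => /eqP E.
  by split=> [/h3|/h4]; exact.
Qed.

(** By [no_K33], applied to a cell and its opposite, every cell contains [q] or
[- q]; by [at_most_three], the cells are [C1], [C2], [C3] and their opposites.
If the gradients are [gi] on [Ci] and [- gi] on [opp Ci], then [gi + gj] is a
multiple of the separator [Nij] of [Ci] and [opp Cj].  With [Nij] normalized to
be 2 at [q], these three equations define the [gi], and [gi - gj], which is a
difference of two separators, has the right sign by [descent]. *)
Lemma potential_octahedron q : q <> 0 ->
  (forall C, X C -> C q -> exists u, exposes C q u) ->
  (forall C K, X C -> X K -> C <> K -> abut C K \/ forall x, C x -> K x -> x = 0) ->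
  has_potential X.
Proof.
move=> q0 ext adj; have [e1 [e2 fr]] := frames q0.
have [C1 [C2 [C3 [[X1 X2 X3] [q1 q2 q3] [n12 n13 n23]]]]] := three_cells HX fr ext.
have adjq C K x : X C -> X K -> x <> 0 -> C x -> K x -> C <> K -> abut C K.
  by move=> XC XK x0 Cx Kx CK; have [//|h] := adj C K XC XK CK; case: x0; exact: h.
have three K : X K -> K q -> [\/ K = C1, K = C2 | K = C3].
  move=> XK Kq; apply: contrapT => no.
  have k1 : C1 <> K by move=> E; apply: no; apply: Or31.
  have k2 : C2 <> K by move=> E; apply: no; apply: Or32.
  have k3 : C3 <> K by move=> E; apply: no; apply: Or33.
  by apply: (at_most_three HX fr X1 X2 X3 XK) => //; apply: (adjq _ _ q).
have q_or K : X K -> K q \/ K (- q).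
  move=> XK; apply: contrapT => /not_orP[nK nK'].
  have XK' := opX XK.
  have noc C : X C -> C q -> C <> K by move=> _ Cq E; apply: nK; rewrite -E.
  have noc' C : X C -> C q -> C <> opp K by move=> _ Cq E; apply: nK'; rewrite E in Cq.
  have KK' : K <> opp K.
    move=> E; apply: (cell_not_in_ray HX fr XK) => x Kx; exists 0; rewrite scale0r.
    by apply: (tc_pointed HX XK Kx); rewrite E /opp /= opprK.
  have a1 C : X C -> C q -> abut C K.
    move=> XC Cq; have [//|h] := adj C K XC XK (noc _ XC Cq).
    by case: (noc' _ XC Cq); rewrite (antipodal XC XK (noc _ XC Cq) h) oppK.
  have a2 C : X C -> C q -> abut C (opp K).
    move=> XC Cq; have [//|h] := adj C (opp K) XC XK' (noc' _ XC Cq).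
    case: (noc _ XC Cq); apply: opp_inj.
    by rewrite -(antipodal XC XK' (noc' _ XC Cq) h).
  by apply: (no_K33 HX fr X1 X2 X3 XK XK') => //; [exact: a1..|exact: a2|exact: a2|exact: a2].
have [N12 [m12 p12 p21 z12]] := opp_separator X1 X2 q0 q1 q2.
have [N13 [m13 p13 p31 z13]] := opp_separator X1 X3 q0 q1 q3.
have [N23 [m23 p23 p32 z23]] := opp_separator X2 X3 q0 q2 q3.
have down C C' C'' x : X C -> C q -> (forall K, X K -> K q -> [\/ K = C, K = C' | K = C'']) ->
    X C' -> C x -> exists t, [/\ 0 <= t, C (x - t *: q) & C' (- (x - t *: q)) \/ C'' (- (x - t *: q))].
  move=> XC Cq h XC' Cx; have [t [K [t0 XK nK Cy Ky]]] := descent HX XC Cq q0 Cx.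
  exists t; split=> //.
  have [//|Kq] := q_or K XK.
  case: (h (opp K) (opX XK) Kq) => E; last 2 first.
  - by left; rewrite -E /opp /= opprK.
  - by right; rewrite -E /opp /= opprK.
  left; have -> : x - t *: q = 0 by apply: (tc_pointed HX XC Cy); rewrite -E /opp /= opprK.
  by rewrite oppr0; exact: cone0 (tc_cone HX XC').
have three2 K : X K -> K q -> [\/ K = C2, K = C1 | K = C3].
  by move=> XK /(three _ XK)[->|->|->]; [apply: Or32|apply: Or31|apply: Or33].
have three3 K : X K -> K q -> [\/ K = C3, K = C1 | K = C2].
  by move=> XK /(three _ XK)[->|->|->]; [apply: Or32|apply: Or33|apply: Or31].
(* On a cell, the separator from the opposite of a neighbour exceeds the one
   that does not involve the cell. *)
have F1 x : C1 x -> [/\ 0 <= dot N12 x, 0 <= dot N13 x, dot N23 x <= dot N12 x & dot N23 x <= dot N13 x].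
  move=> x1; have [t [t0 y1 h]] := down _ _ _ _ X1 q1 three X2 x1.
  apply: (@octahedron_side _ (dot N12 x) (dot N13 x) (dot N23 x) t).
  - exact: p12.
  - exact: p13.
  - by have := p12 _ y1; dotE; rewrite m12.
  - by have := p13 _ y1; dotE; rewrite m13.
  - case: h => y; [left|right]; split; [have := p21 _ y|have := p23 _ y|have := p31 _ y|have := p32 _ y];
      by dotE; rewrite ?m12 ?m13 ?m23.
have F2 x : C2 x -> [/\ 0 <= dot N12 x, 0 <= dot N23 x, dot N13 x <= dot N12 x & dot N13 x <= dot N23 x].
  move=> x2; have [t [t0 y2 h]] := down _ _ _ _ X2 q2 three2 X1 x2.
  apply: (@octahedron_side _ (dot N12 x) (dot N23 x) (dot N13 x) t).
  - exact: p21.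
  - exact: p23.
  - by have := p21 _ y2; dotE; rewrite m12.
  - by have := p23 _ y2; dotE; rewrite m23.
  - case: h => y; [left|right]; split; [have := p12 _ y|have := p13 _ y|have := p32 _ y|have := p31 _ y];
      by dotE; rewrite ?m12 ?m13 ?m23.
have F3 x : C3 x -> [/\ 0 <= dot N13 x, 0 <= dot N23 x, dot N12 x <= dot N13 x & dot N12 x <= dot N23 x].
  move=> x3; have [t [t0 y3 h]] := down _ _ _ _ X3 q3 three3 X1 x3.
  apply: (@octahedron_side _ (dot N13 x) (dot N23 x) (dot N12 x) t).
  - exact: p31.
  - exact: p32.
  - by have := p31 _ y3; dotE; rewrite m13.
  - by have := p32 _ y3; dotE; rewrite m23.
  - case: h => y; [left|right]; split; [have := p13 _ y|have := p12 _ y|have := p23 _ y|have := p21 _ y];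
      by dotE; rewrite ?m12 ?m13 ?m23.
have up C y t : X C -> C q -> 0 <= t -> C (y - t *: q) -> C y.
  by move=> XC Cq t0 h; rewrite -(subrK (t *: q) y); exact: (coneDZ HX).
have D12 : N13 <> N23.
  move=> E; apply: n12; apply: (cell_sub HX X1 X2) => x x1.
  have [t [t0 y1 h]] := down _ _ _ _ X1 q1 three X2 x1.
  apply: (up _ _ t X2 q2 t0).
  have [/F2[_ g _ _]|y3] := h.
    have g1 := p13 _ y1; rewrite dotNr -E in g.
    have g2 : dot N13 (x - t *: q) = 0 by lra.
    by apply/(z23 _ _); [rewrite -E|apply/z13].
  have g2 : dot N13 (x - t *: q) = 0.
    by have := p13 _ y1; have := p31 _ y3; rewrite dotNr; lra.
  by apply/(z23 _ _); [rewrite -E|].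
have D13 : N12 <> N23.
  move=> E; apply: n13; apply: (cell_sub HX X1 X3) => x x1.
  have [t [t0 y1 h]] := down _ _ _ _ X1 q1 three X2 x1.
  apply: (up _ _ t X3 q3 t0).
  have y2 : C2 (- (x - t *: q)).
    case: h => // /F3[_ g _ _]; rewrite dotNr -E in g.
    have g2 : dot N12 (x - t *: q) = 0 by have := p12 _ y1; lra.
    exact/z12.
  have g2 : dot N12 (x - t *: q) = 0.
    by have := p12 _ y1; have := p21 _ y2; rewrite dotNr; lra.
  rewrite -(opprK (x - _)); apply/(z23 _ _) => //; by rewrite dotNr -E g2 oppr0.
have D23 : N12 <> N13.
  move=> E; apply: n23; apply: (cell_sub HX X2 X3) => x x2.
  have [t [t0 y2 h]] := down _ _ _ _ X2 q2 three2 X1 x2.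
  apply: (up _ _ t X3 q3 t0).
  have y1 : C1 (- (x - t *: q)).
    case: h => // /F3[g _ _ _]; rewrite dotNr -E in g.
    have g2 : dot N12 (x - t *: q) = 0 by have := p21 _ y2; lra.
    by apply/z12; [rewrite dotNr g2 oppr0|rewrite opprK].
  have g2 : dot N12 (x - t *: q) = 0.
    by have := p21 _ y2; have := p12 _ y1; rewrite dotNr; lra.
  rewrite -(opprK (x - _)); apply/(z13 _ _) => //; by rewrite dotNr -E g2 oppr0.
pose g1 := 2^-1 *: (N12 + N13 - N23).
pose g2 := 2^-1 *: (N12 + N23 - N13).
pose g3 := 2^-1 *: (N13 + N23 - N12).
apply: (@potential_seq _ _ X [:: C1; C2; C3; opp C1; opp C2; opp C3]
  [:: g1; g2; g3; - g1; - g2; - g3]) => //.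
- rewrite /= !inE !negb_or !andbT; do ![apply/andP; split].
  + by apply/eqP => /dot_fun h; apply: D12; apply: dot_ext => x; have := h x; rewrite /g1 /g2 /g3; dotE;
      move: (dot N12 x) (dot N13 x) (dot N23 x) => k l m; lra.
  + by apply/eqP => /dot_fun h; apply: D13; apply: dot_ext => x; have := h x; rewrite /g1 /g2 /g3; dotE;
      move: (dot N12 x) (dot N13 x) (dot N23 x) => k l m; lra.
  + by apply/eqP => /dot_fun h; have := h q; rewrite /g1 /g2 /g3; dotE; rewrite m12 m13 m23; lra.
  + by apply/eqP => /dot_fun h; have := h q; rewrite /g1 /g2 /g3; dotE; rewrite m12 m13 m23; lra.
  + by apply/eqP => /dot_fun h; have := h q; rewrite /g1 /g2 /g3; dotE; rewrite m12 m13 m23; lra.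
  + by apply/eqP => /dot_fun h; apply: D23; apply: dot_ext => x; have := h x; rewrite /g1 /g2 /g3; dotE;
      move: (dot N12 x) (dot N13 x) (dot N23 x) => k l m; lra.
  + by apply/eqP => /dot_fun h; have := h q; rewrite /g1 /g2 /g3; dotE; rewrite m12 m13 m23; lra.
  + by apply/eqP => /dot_fun h; have := h q; rewrite /g1 /g2 /g3; dotE; rewrite m12 m13 m23; lra.
  + by apply/eqP => /dot_fun h; have := h q; rewrite /g1 /g2 /g3; dotE; rewrite m12 m13 m23; lra.
  + by apply/eqP => /dot_fun h; have := h q; rewrite /g1 /g2 /g3; dotE; rewrite m12 m13 m23; lra.
  + by apply/eqP => /dot_fun h; have := h q; rewrite /g1 /g2 /g3; dotE; rewrite m12 m13 m23; lra.
  + by apply/eqP => /dot_fun h; have := h q; rewrite /g1 /g2 /g3; dotE; rewrite m12 m13 m23; lra.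
  + by apply/eqP => /dot_fun h; apply: D12; apply: dot_ext => x; have := h x; rewrite /g1 /g2 /g3; dotE;
      move: (dot N12 x) (dot N13 x) (dot N23 x) => k l m; lra.
  + by apply/eqP => /dot_fun h; apply: D13; apply: dot_ext => x; have := h x; rewrite /g1 /g2 /g3; dotE;
      move: (dot N12 x) (dot N13 x) (dot N23 x) => k l m; lra.
  + by apply/eqP => /dot_fun h; apply: D23; apply: dot_ext => x; have := h x; rewrite /g1 /g2 /g3; dotE;
      move: (dot N12 x) (dot N13 x) (dot N23 x) => k l m; lra.
- move=> K XK; rewrite !inE; have [Kq|Kq] := q_or K XK.
    by have [] := three K XK Kq => ->; rewrite eqxx ?orbT.
  by have [] := three (opp K) (opX XK) Kq => <-; rewrite oppK eqxx ?orbT.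
- move=> C v w x; rewrite /= !inE => hC hw Cx.
  suff [[k1 k2 k3] [k4 k5 k6]] :
      [/\ dot g1 x <= dot v x, dot g2 x <= dot v x & dot g3 x <= dot v x] /\
      [/\ - dot g1 x <= dot v x, - dot g2 x <= dot v x & - dot g3 x <= dot v x].
    by move: hw => /or4P[|||/or3P[]] /eqP ->; rewrite ?dotNl.
  rewrite /g1 /g2 /g3; dotE; apply: octahedron_max.
  by move: hC Cx => /or4P[|||/or3P[]] /eqP [-> ->];
    [move/F1|move/F2|move/F3|move/F1|move/F2|move/F3]; rewrite /g1 /g2 /g3; dotE => h;
    [left; apply: Or31|left; apply: Or32|left; apply: Or33
    |right; apply: Or31|right; apply: Or32|right; apply: Or33].
Qed.

End Symmetric.
End Space.

Section Prism.
Variables (R : realType) (d : nat).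
Local Notation V := 'rV[R]_d.
Implicit Types (u v w x y z n m p q e a b : V) (C K E D f : set V).
Variable X : set (set V).
Hypothesis HX : tight_cells X.
Hypothesis frames : forall q, q <> 0 -> exists e1 e2, frame q e1 e2.
Hypothesis meet : forall C K, X C -> X K -> C <> K ->
  exists x, [/\ x <> 0, C x & K x].

(** ** No opposite cells: the star of a ray with four cells *)

Lemma nonzero_comb K v w (s t : R) : X K -> K v -> K w -> v <> 0 -> w <> 0 ->
  0 <= s -> 0 <= t -> s != 0 \/ t != 0 -> K (s *: v + t *: w) /\ s *: v + t *: w <> 0.
Proof.
move=> XK Kv Kw v0 w0 s0 t0 st; have cK := tc_cone HX XK.
split; first by apply: (coneD cK); exact: (coneZ cK).
have [u hu] := tc_apex HX XK; have [h1 h1'] := hu _ Kv; have [h2 h2'] := hu _ Kw.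
have p1 : 0 < dot u v by rewrite lt_neqAle h1 andbT; apply/eqP => /esym/h1'.
have p2 : 0 < dot u w by rewrite lt_neqAle h2 andbT; apply/eqP => /esym/h2'.
move=> /(congr1 (dot u)); rewrite dot0r; dotE => E.
have e1 := mulr_ge0 s0 h1; have e2 := mulr_ge0 t0 h2.
have /eqP : s * dot u v = 0 by lra.
have /eqP : t * dot u w = 0 by lra.
rewrite !mulf_eq0 (gt_eqF p1) (gt_eqF p2) !orbF => /eqP t1 /eqP s1.
by case: st; rewrite ?s1 ?t1 eqxx.
Qed.

(** A segment from one side of a line to the other meets the line. *)
Lemma cross_kernel K m v w : X K -> K v -> K w -> v <> 0 -> w <> 0 ->
  0 <= dot m v -> dot m w <= 0 -> exists s t,
  [/\ 0 <= s, 0 <= t, K (s *: v + t *: w), s *: v + t *: w <> 0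
    & dot m (s *: v + t *: w) = 0].
Proof.
move=> XK Kv Kw v0 w0 hv hw.
have [E|E] := eqVneq (dot m v) 0.
  have [|||h1 h2] := @nonzero_comb K v w 1 0 XK Kv Kw v0 w0.
  - exact: ler01.
  - exact: lexx.
  - by left; exact: oner_neq0.
  by exists 1, 0; split=> //; dotE; rewrite E; lra.
have [|||h1 h2] := @nonzero_comb K v w (- dot m w) (dot m v) XK Kv Kw v0 w0.
- by rewrite oppr_ge0.
- exact: hv.
- by right.
by exists (- dot m w), (dot m v); split=> //; [rewrite oppr_ge0|dotE; ring].
Qed.

Section Star.
Variables (q A B : V) (C1 C2 C3 C4 : set V).
Hypothesis q0 : q <> 0.
Hypothesis Q : quad X q A B C1 C2 C3 C4.

Lemma apart C D : C q -> ~ D q -> C <> D.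
Proof. by move=> Cq Dq E; apply: Dq; rewrite -E. Qed.

Lemma quad_meet D : X D -> ~ D q -> exists w1 w2 w3 w4,
  [/\ [/\ D w1, D w2, D w3 & D w4], [/\ C1 w1, C2 w2, C3 w3 & C4 w4],
      [/\ w1 <> 0, w2 <> 0, w3 <> 0 & w4 <> 0]
    & forall w, w = w1 \/ w = w2 \/ w = w3 \/ w = w4 -> ~ (dot A w = 0 /\ dot B w = 0)].
Proof.
move=> XD nD.
have gen C : X C -> C q -> exists w,
    [/\ D w, C w, w <> 0 & ~ (dot A w = 0 /\ dot B w = 0)].
  move=> XC Cq; have [w [w0 Cw Dw]] := meet XC XD (apart Cq nD).
  exists w; split=> // -[Aw Bw]; apply: w0.
  have [c ec] := quad_mod Q Aw Bw; rewrite ec in Cw Dw *.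
  have c0 := ray_ge0 HX XC Cq q0 Cw.
  have [->|c1] := eqVneq c 0; first by rewrite scale0r.
  by case: nD; apply: (faceZ HX (t := c) XD) => //; rewrite lt_neqAle eq_sym c1.
have [w1 [? ? ? ?]] := gen _ (quadX1 Q) (quadq1 Q).
have [w2 [? ? ? ?]] := gen _ (quadX2 Q) (quadq2 Q).
have [w3 [? ? ? ?]] := gen _ (quadX3 Q) (quadq3 Q).
have [w4 [? ? ? ?]] := gen _ (quadX4 Q) (quadq4 Q).
exists w1, w2, w3, w4; split=> // w.
by move=> [->|[->|[->|->]]].
Qed.

(** Four vectors, one in each quadrant, are positively dependent. *)
Lemma contains_opp D : X D -> ~ D q -> D (- q).
Proof.
move=> XD nD; have [w1 [w2 [w3 [w4 [[d1 d2 d3 d4] [c1 c2 c3 c4] [n1 n2 n3 n4] _]]]]] := quad_meet XD nD.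
have [A1 B1] := quads1 Q c1; have [A2 B2] := quads2 Q c2.
have [A3 B3] := quads3 Q c3; have [A4 B4] := quads4 Q c4.
have [s [t [s0 t0 Dv v0 Av]]] := cross_kernel XD d1 d2 n1 n2 A1 A2.
have [s' [t' [s0' t0' Dw w0 Aw]]] := cross_kernel XD d4 d3 n4 n3 A4 A3.
have Bv : 0 <= dot B (s *: w1 + t *: w2).
  by dotE; apply: addr_ge0; exact: mulr_ge0.
have Bw : dot B (s' *: w4 + t' *: w3) <= 0.
  by dotE; have := mulr_ge0_le0 s0' B4; have := mulr_ge0_le0 t0' B3; lra.
have [k [l [k0 l0 Dz z0 Bz]]] := cross_kernel XD Dv Dw v0 w0 Bv Bw.
move: Dz z0 Bz; set z := (_ + _) => Dz z0 Bz.
have Az : dot A z = 0 by rewrite /z dotDr !dotZr Av Aw !mulr0 addr0.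
have [c ec] := quad_mod Q Az Bz.
have [c0|c0|c0] := ltgtP c 0.
- by apply: (faceZ HX (t := - c) XD); rewrite ?oppr_gt0 // scalerN scaleNr opprK -ec.
- by case: nD; apply: (faceZ HX (t := c) XD) => //; rewrite -ec.
- by case: z0; rewrite ec c0 scale0r.
Qed.

(** A line in general position in the plane with coordinates [dot A] and [dot B]
has one whole quadrant on its negative side, and there [D] could not meet the cell. *)
Lemma wall_below D D' l : X D -> X D' -> ~ D q -> ~ D' q -> separator D D' l ->
  exists c, l = c *: A \/ l = c *: B.
Proof.
move=> XD XD' nD nD' [l1 l2 _ _].
have lq : dot l q = 0.
  have := l1 _ (contains_opp XD nD); have := l2 _ (contains_opp XD' nD').
  by rewrite dotNr; lra.
have [a [b el]] := quad_span Q lq.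
have [w1 [w2 [w3 [w4 [[d1 d2 d3 d4] [c1 c2 c3 c4] _ nz]]]]] := quad_meet XD nD.
have [A1 B1] := quads1 Q c1; have [A2 B2] := quads2 Q c2.
have [A3 B3] := quads3 Q c3; have [A4 B4] := quads4 Q c4.
have key w : w = w1 \/ w = w2 \/ w = w3 \/ w = w4 -> D w -> a != 0 -> b != 0 ->
   a * dot A w <= 0 -> b * dot B w <= 0 -> False.
  move=> hw Dw a0 b0 h1 h2; apply: (nz w hw).
  have := l1 _ Dw; rewrite el; dotE => h3.
  have /eqP : a * dot A w = 0 by lra.
  have /eqP : b * dot B w = 0 by lra.
  by rewrite !mulf_eq0 (negbTE a0) (negbTE b0) /= => /eqP -> /eqP ->.
have [a0|a0] := eqVneq a 0; first by exists b; right; rewrite el a0 scale0r add0r.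
have [b0|b0] := eqVneq b 0; first by exists a; left; rewrite el b0 scale0r addr0.
exfalso; have [ha|ha] := leP 0 a; have [hb|hb] := leP 0 b.
- by apply: (key w3) => //; [right; right; left|rewrite mulr_ge0_le0..].
- by apply: (key w2) => //; [right; left|rewrite mulr_ge0_le0|rewrite mulr_le0_ge0 // ltW].
- by apply: (key w4) => //; [right; right; right|rewrite mulr_le0_ge0 // ltW|rewrite mulr_ge0_le0].
- by apply: (key w1) => //; [left|rewrite mulr_le0_ge0 // ltW..].
Qed.

End Star.

Lemma separatorZ C K n (c : R) : 0 < c -> separator C K (c *: n) -> separator C K n.
Proof.
move=> c0 [h1 h2 h3 h4]; split=> x hx.
- by have := h1 _ hx; rewrite dotZl pmulr_rge0.
- by have := h2 _ hx; rewrite dotZl pmulr_rle0.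
- by move=> E; apply: h3; rewrite // dotZl E mulr0.
- by move=> E; apply: h4; rewrite // dotZl E mulr0.
Qed.

(** A ray [a] in the common wall of [D] and [D'] has four cells around it: the
wall between [C] and [D] continues between [C'] and [D']. *)
Lemma through_wall q C C' D D' : q <> 0 -> X C -> X C' -> X D -> X D' ->
  C q -> C' q -> ~ D q -> ~ D' q -> C <> C' -> D <> D' ->
  (forall x, C x -> D' x -> C' x /\ D x) ->
  exists n, [/\ dot n q = 1,
    forall x, C x -> 0 <= dot n x, forall x, C' x -> 0 <= dot n x,
    (forall x, D x -> dot n x <= 0) /\ (forall x, D' x -> dot n x <= 0)
    & forall x, dot n x = 0 -> D x -> C x].
Proof.
move=> q0 XC XC' XD XD' Cq C'q nD nD' CC' DD' h.
have [a [a0 Ca D'a]] := meet XC XD' (apart Cq nD').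
have [C'a Da] := h _ Ca D'a.
have [|A [B [E' Q]]] := @quad_space _ _ X HX frames a C C' D' a0 XC XC' XD'
    (apart Cq nD') (nesym CC') (apart C'q nD') Ca C'a D'a.
  by move=> x Cx /(h _ Cx)[].
have E'D : E' = D.
  case: (quad_all Q XD Da) => // E.
  - by case: nD; rewrite E.
  - by case: nD; rewrite E.
rewrite E'D in Q.
have Bq : 0 < dot B q.
  rewrite lt_neqAle; have [_ ->] := quads1 Q Cq; rewrite andbT.
  by apply/eqP => /esym/(quad14 Q)[/(_ Cq)].
have i0 : 0 < (dot B q)^-1 by rewrite invr_gt0.
exists ((dot B q)^-1 *: B); split.
- by rewrite dotZl mulVf // gt_eqF.
- by move=> x /(quads1 Q)[_]; rewrite dotZl pmulr_rge0.
- by move=> x /(quads2 Q)[_]; rewrite dotZl pmulr_rge0.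
- by split=> x; [move=> /(quads4 Q)[_]|move=> /(quads3 Q)[_]]; rewrite dotZl pmulr_rle0.
- move=> x; rewrite dotZl => /eqP; rewrite mulf_eq0 gt_eqF //= => /eqP.
  by move/(quad14 Q) => [].
Qed.

(** The wall between [C1] and [D1] continues in that between [C4] and [D2], with
the linear form [na], and the wall between [C2] and [D1] in that between [C3]
and [D2], with the linear form [nb].  The convex function is the maximum of 0,
[na] and [nb], plus the absolute value of [B]. *)
Lemma potential_prism q A B C1 C2 C3 C4 D1 D2 : q <> 0 ->
  quad X q A B C1 C2 C3 C4 -> X D1 -> X D2 -> D1 <> D2 -> ~ D1 q -> ~ D2 q ->
  separator D1 D2 B -> has_potential X.
Proof.
move=> q0 Q XD1 XD2 D12 nD1 nD2 sB.
have [B1 B2 B3 B4] := sB.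
have B0 := separator_neq0 XD1 XD2 D12 sB.
(* A third cell without [q] would be on both sides of [B]: its separators from
   [D1] and [D2] follow [A] or [B], and one along [A] would put [D1] or [D2]
   into a single quadrant. *)
have only K : X K -> ~ K q -> K = D1 \/ K = D2.
  move=> XK nK; apply: contrapT => /not_orP[K1 K2].
  apply: (cell_not_in_line HX XK B0) => x Kx; apply/eqP; rewrite eq_le.
  have le D D' (s : R) : X D -> X D' -> ~ D q -> ~ D' q -> D <> D' -> s != 0 ->
      (forall x, D x -> 0 <= s * dot B x) -> forall x, D' x -> s * dot B x <= 0.
    move=> XD XD' nD nD' DD' s0 hD.
    have [l sl] := tc_sep HX XD XD' DD'; have l0 := separator_neq0 XD XD' DD' sl.
    have [c hl] := wall_below q0 Q XD XD' nD nD' sl.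
    have [l1 l2 _ _] := sl.
    have c0 : c != 0 by apply/eqP => c0; apply: l0; case: hl => ->; rewrite c0 scale0r.
    case: hl => el.
      have [w1 [w2 [w3 [w4 [[d1 d2 d3 d4] [c1 c2 c3 c4] _ nz]]]]] := quad_meet q0 Q XD nD.
      have [A1 b1] := quads1 Q c1; have [A2 b2] := quads2 Q c2.
      have [A3 b3] := quads3 Q c3; have [A4 b4] := quads4 Q c4.
      have key w : w = w1 \/ w = w2 \/ w = w3 \/ w = w4 -> D w ->
         c * dot A w <= 0 -> s * dot B w <= 0 -> False.
        move=> hw Dw h1 h2; apply: (nz w hw).
        have := l1 _ Dw; rewrite el dotZl => h3; have h4 := hD _ Dw.
        have /eqP : c * dot A w = 0 by lra.
        have /eqP : s * dot B w = 0 by lra.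
        by rewrite !mulf_eq0 (negbTE c0) (negbTE s0) /= => /eqP -> /eqP ->.
      exfalso; have [hc|hc] := leP 0 c; have [hs|hs] := leP 0 s.
      - by apply: (key w3) => //; [right; right; left|rewrite mulr_ge0_le0..].
      - by apply: (key w2) => //; [right; left|rewrite mulr_ge0_le0|rewrite mulr_le0_ge0 // ltW].
      - by apply: (key w4) => //; [right; right; right|rewrite mulr_le0_ge0 // ltW|rewrite mulr_ge0_le0].
      - by apply: (key w1) => //; [left|rewrite mulr_le0_ge0 // ltW..].
    have [z [Dz hz _]] := cell_inner HX XD.
    have p1 : 0 < dot (s *: B) z.
      apply: hz; first by move=> y Dy; rewrite dotZl; exact: hD.
      by move/eqP; rewrite scaler_eq0 (negbTE s0) /= => /eqP.
    have p2 : 0 < dot l z by exact: hz.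
    move=> y /l2; rewrite el dotZl; move: p2 p1; rewrite el !dotZl => p2 p1 h.
    have cs : 0 < c * s.
      have : 0 < (c * dot B z) * (s * dot B z) by exact: mulr_gt0.
      have -> : (c * dot B z) * (s * dot B z) = c * s * dot B z ^+ 2 by ring.
      rewrite pmulr_lgt0 // exprn_even_gt0 //=; apply/eqP => z0.
      by move: p1; rewrite z0 mulr0 ltxx.
    rewrite leNgt; apply/negP => h'.
    have [cB|cB] := eqVneq (dot B y) 0; first by move: h'; rewrite cB mulr0 ltxx.
    have : 0 < c * s * dot B y ^+ 2 by rewrite mulr_gt0 // exprn_even_gt0.
    have -> : c * s * dot B y ^+ 2 = (c * dot B y) * (s * dot B y) by ring.
    by rewrite pmulr_lgt0 // ltNge h.
  apply/andP; split.
    rewrite -[dot B x]mul1r; apply: (le D1) Kx => //; first exact: nesym.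
    by move=> y /B1; rewrite mul1r.
  rewrite -oppr_le0 -mulN1r; apply: (le D2) Kx => //; first exact: nesym.
  by move=> y /B2; rewrite mulN1r oppr_ge0.
case: (Q) => n12 n23 n34 n14 X1 X2 X3 X4 q1 q2 q3 q4 Aq Bq s1 s2 s3 s4
  h12 h34 h23 h14 hs hm ha.
have [|na [naq na1 na4 [na5 na6] naz]] := @through_wall q C1 C4 D1 D2 q0 X1 X4 XD1 XD2 q1 q4 nD1 nD2 n14 D12.
  move=> x x1 x6; have [_ g1] := s1 _ x1; have g2 := B2 _ x6.
  have Bx : dot B x = 0 by lra.
  by split; [apply/h14|exact: B4].
have [|nb [nbq nb2 nb3 [nb5 nb6] nbz]] := @through_wall q C2 C3 D1 D2 q0 X2 X3 XD1 XD2 q2 q3 nD1 nD2 n23 D12.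
  move=> x x2 x6; have [_ g1] := s2 _ x2; have g2 := B2 _ x6.
  have Bx : dot B x = 0 by lra.
  by split; [apply/h23|exact: B4].
have down C x : X C -> C q -> C x -> exists t, [/\ 0 <= t, C (x - t *: q) & D1 (x - t *: q) \/ D2 (x - t *: q)].
  move=> XC Cq Cx; have [t [K [t0 XK nK Cy Ky]]] := descent HX XC Cq q0 Cx.
  by exists t; split=> //; have [<-|<-] := only K XK nK; [left|right].
have ab C x : X C -> C q -> (forall y, C y -> 0 <= dot na y) -> C x -> dot nb x <= dot na x.
  move=> XC Cq hC Cx; have [t [t0 Cy h]] := down _ _ XC Cq Cx.
  have g1 := hC _ Cy.
  case: h => y; [have := nb5 _ y|have := nb6 _ y]; move: g1; dotE; rewrite naq nbq; lra.
have ba C x : X C -> C q -> (forall y, C y -> 0 <= dot nb y) -> C x -> dot na x <= dot nb x.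
  move=> XC Cq hC Cx; have [t [t0 Cy h]] := down _ _ XC Cq Cx.
  have g1 := hC _ Cy.
  case: h => y; [have := na5 _ y|have := na6 _ y]; move: g1; dotE; rewrite naq nbq; lra.
have F1 x : C1 x -> [/\ 0 <= dot B x, 0 <= dot na x & dot nb x <= dot na x].
  by move=> h; split; [case: (s1 _ h)|exact: na1|exact: (ab _ _ X1 q1 na1 h)].
have F2 x : C2 x -> [/\ 0 <= dot B x, 0 <= dot nb x & dot na x <= dot nb x].
  by move=> h; split; [case: (s2 _ h)|exact: nb2|exact: (ba _ _ X2 q2 nb2 h)].
have F3 x : C3 x -> [/\ dot B x <= 0, 0 <= dot nb x & dot na x <= dot nb x].
  by move=> h; split; [case: (s3 _ h)|exact: nb3|exact: (ba _ _ X3 q3 nb3 h)].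
have F4 x : C4 x -> [/\ dot B x <= 0, 0 <= dot na x & dot nb x <= dot na x].
  by move=> h; split; [case: (s4 _ h)|exact: na4|exact: (ab _ _ X4 q4 na4 h)].
have F5 x : D1 x -> [/\ 0 <= dot B x, dot na x <= 0 & dot nb x <= 0].
  by move=> h; split; [exact: B1|exact: na5|exact: nb5].
have F6 x : D2 x -> [/\ dot B x <= 0, dot na x <= 0 & dot nb x <= 0].
  by move=> h; split; [exact: B2|exact: na6|exact: nb6].
have nab : na <> nb.
  move=> E; apply: n12; apply: (cell_sub HX X1 X2) => x x1.
  have [t [t0 y1 h]] := down _ _ X1 q1 x1.
  rewrite -(subrK (t *: q) x); apply: (coneDZ HX) => //.
  have y5 : D1 (x - t *: q).
    case: h => // y6; apply: B4 => //.
    by have [g _ _] := F1 _ y1; have := B2 _ y6; lra.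
  apply: nbz => //; rewrite -E.
  by have := na1 _ y1; have := na5 _ y5; lra.
have nab1 : na + B <> nb - B.
  move=> /dot_fun E; apply: (cell_not_in_line HX X1 B0) => x /F1[]; have := E x.
  by dotE; lra.
have nab2 : nb + B <> na - B.
  move=> /dot_fun E; apply: (cell_not_in_line HX X2 B0) => x /F2[]; have := E x.
  by dotE; lra.
apply: (@potential_seq _ _ X [:: C1; C2; D1; C3; C4; D2]
  [:: na + B; nb + B; B; nb - B; na - B; - B]) => //.
- rewrite /= !inE !negb_or !andbT; do ![apply/andP; split].
  + by apply/eqP => /dot_fun h; apply: nab; apply: dot_ext => x; have := h x; dotE;
      move: (dot na x) (dot nb x) (dot B x) => k l m; lra.
  + by apply/eqP => /dot_fun h; have := h q; dotE; rewrite ?naq ?nbq ?Bq; lra.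
  + by apply/eqP => /dot_fun h; apply: nab1; apply: dot_ext => x; have := h x; dotE;
      move: (dot na x) (dot nb x) (dot B x) => k l m; lra.
  + by apply/eqP => /dot_fun h; apply: B0; apply: dot_ext => x; have := h x; dotE;
      move: (dot na x) (dot nb x) (dot B x) => k l m; lra.
  + by apply/eqP => /dot_fun h; have := h q; dotE; rewrite ?naq ?nbq ?Bq; lra.
  + by apply/eqP => /dot_fun h; have := h q; dotE; rewrite ?naq ?nbq ?Bq; lra.
  + by apply/eqP => /dot_fun h; apply: B0; apply: dot_ext => x; have := h x; dotE;
      move: (dot na x) (dot nb x) (dot B x) => k l m; lra.
  + by apply/eqP => /dot_fun h; apply: nab2; apply: dot_ext => x; have := h x; dotE;
      move: (dot na x) (dot nb x) (dot B x) => k l m; lra.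
  + by apply/eqP => /dot_fun h; have := h q; dotE; rewrite ?naq ?nbq ?Bq; lra.
  + by apply/eqP => /dot_fun h; have := h q; dotE; rewrite ?naq ?nbq ?Bq; lra.
  + by apply/eqP => /dot_fun h; have := h q; dotE; rewrite ?naq ?nbq ?Bq; lra.
  + by apply/eqP => /dot_fun h; apply: B0; apply: dot_ext => x; have := h x; dotE;
      move: (dot na x) (dot nb x) (dot B x) => k l m; lra.
  + by apply/eqP => /dot_fun h; apply: nab; apply: dot_ext => x; have := h x; dotE;
      move: (dot na x) (dot nb x) (dot B x) => k l m; lra.
  + by apply/eqP => /dot_fun h; have := h q; dotE; rewrite ?naq ?nbq ?Bq; lra.
  + by apply/eqP => /dot_fun h; have := h q; dotE; rewrite ?naq ?nbq ?Bq; lra.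
- move=> K XK; rewrite !inE; have [/(ha _ XK)|/(only _ XK)] := pselect (K q).
    by case=> ->; rewrite eqxx ?orbT.
  by case=> ->; rewrite eqxx ?orbT.
- move=> C v w x; rewrite /= !inE => hC hw Cx.
  suff [[k1 k2 k3] [k4 k5 k6]] :
      [/\ dot na x + dot B x <= dot v x, dot nb x + dot B x <= dot v x & dot B x <= dot v x] /\
      [/\ dot na x - dot B x <= dot v x, dot nb x - dot B x <= dot v x & - dot B x <= dot v x].
    by move: hw => /or4P[|||/or3P[]] /eqP ->; dotE.
  apply: prism_max.
  by move: hC Cx => /or4P[|||/or3P[]] /eqP [-> ->];
    [move/F1|move/F2|move/F5|move/F3|move/F4|move/F6]; dotE => h;
    [left; apply: Or31|left; apply: Or32|left; apply: Or33
    |right; apply: Or31|right; apply: Or32|right; apply: Or33].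
Qed.

End Prism.

Section Three.
Variables (R : realType) (d : nat).
Local Notation V := 'rV[R]_d.
Implicit Types (u v w x y z n m p q e a b : V) (C K E D f : set V).
Variable X : set (set V).
Hypothesis HX : tight_cells X.
Hypothesis frames : forall q, q <> 0 -> exists e1 e2, frame q e1 e2.

(** ** The classification *)

Definition meet_in_ray C K : Prop := exists q,
  [/\ q <> 0, C q, K q & forall x, C x -> K x -> exists c, x = c *: q].

Lemma trichotomy C K : [\/ forall x, C x -> K x -> x = 0, meet_in_ray C K | abut C K].
Proof.
have [[q [q0 Cq Kq]]|no] := pselect (exists q, [/\ q <> 0, C q & K q]); last first.
  by apply: Or31 => x Cx Kx; apply: contrapT => x0; apply: no; exists x.
have [h|no] := pselect (forall x, C x -> K x -> exists c, x = c *: q).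
  by apply: Or32; exists q.
apply: Or33; apply: contrapT => nab; apply: no => x Cx Kx; apply: contrapT => nx.
by apply: nab; exact: (abut_intro frames q0 Cq Kq Cx Kx nx).
Qed.

Lemma potential_quad_prism q A B C1 C2 C3 C4 : q <> 0 ->
  (forall C K, X C -> X K -> C <> K -> exists x, [/\ x <> 0, C x & K x]) ->
  quad X q A B C1 C2 C3 C4 -> has_potential X.
Proof.
move=> q0 meet Q.
have [D1 XD1 qD1] := tc_cover HX (- q).
have nD1 : ~ D1 q by move=> h; apply: q0; exact: (tc_pointed HX XD1 h qD1).
have [[D2 [XD2 nD2 D12]]|no] := pselect (exists D2, [/\ X D2, ~ D2 q & D1 <> D2]); last first.
  apply: (potential_apex HX q0 XD1 nD1) => C XC CD; apply: contrapT => nC.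
  by apply: no; exists C; split=> //; exact: nesym.
have [l sl] := tc_sep HX XD1 XD2 D12.
have l0 := separator_neq0 XD1 XD2 D12 sl.
(* A wall along the zero set of the first functional becomes one along that
   of the second after a quarter turn; a negative factor exchanges the sides. *)
have main A' B' E1 E2 E3 E4 c : quad X q A' B' E1 E2 E3 E4 -> l = c *: B' -> has_potential X.
  move=> Q' el; have [c0|c0|c0] := ltgtP c 0.
  - apply: (potential_prism HX frames meet q0 Q' XD2 XD1 (nesym D12) nD2 nD1).
    apply: (@separatorZ _ _ _ _ _ (- c)); rewrite ?oppr_gt0 // scaleNr -el.
    exact: separatorC.
  - apply: (potential_prism HX frames meet q0 Q' XD1 XD2 D12 nD1 nD2).
    by apply: (@separatorZ _ _ _ _ _ c); rewrite // -el.
  - by case: l0; rewrite el c0 scale0r.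
have [c [el|el]] := wall_below HX meet q0 Q XD1 XD2 nD1 nD2 sl; last exact: main Q el.
apply: (main _ _ _ _ _ _ (- c) (quad_rot Q)).
by rewrite scaleNr scalerN opprK.
Qed.

Theorem potential3 : (exists2 q, q <> 0 & forall C, X C -> C q -> exists u, exposes C q u) ->
  has_potential X.
Proof.
move=> [q q0 ext].
have ray_q C K : X C -> X K -> C <> K -> meet_in_ray C K -> exists p A B E E',
    p <> 0 /\ quad X p A B C E K E'.
  move=> XC XK CK [p [p0 Cp Kp h]]; have [e1 [e2 fr]] := frames p0.
  have [A [B [E [E' Q]]]] := ray_quad HX fr XC XK CK Cp Kp h.
  by exists p, A, B, E, E'.
have [[C [K [XC XK CK h]]]|no0] :=
    pselect (exists C K, [/\ X C, X K, C <> K & forall x, C x -> K x -> x = 0]).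
  have opX := antipodal_symmetric HX XC XK CK h.
  have [[C' [K' [XC' XK' CK' h']]]|no1] :=
      pselect (exists C K, [/\ X C, X K, C <> K & meet_in_ray C K]).
    have [p [A [B [E [E' [p0 Q]]]]]] := ray_q _ _ XC' XK' CK' h'.
    exact: (potential_cube HX frames opX p0 Q).
  apply: (potential_octahedron HX frames opX q0 ext) => C' K' XC' XK' CK'.
  case: (trichotomy C' K') => h'; [by right| |by left].
  by case: no1; exists C', K'.
have meet C K : X C -> X K -> C <> K -> exists x, [/\ x <> 0, C x & K x].
  move=> XC XK CK; apply: contrapT => no; apply: no0; exists C, K; split=> // x Cx Kx.
  by apply: contrapT => x0; apply: no; exists x.
have [[C [K [XC XK CK h]]]|no1] :=
    pselect (exists C K, [/\ X C, X K, C <> K & meet_in_ray C K]).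
  have [p [A [B [E [E' [p0 Q]]]]]] := ray_q _ _ XC XK CK h.
  exact: (potential_quad_prism p0 meet Q).
have adj C K : X C -> X K -> C <> K -> abut C K.
  move=> XC XK CK; case: (trichotomy C K) => // h.
    by case: no0; exists C, K.
  by case: no1; exists C, K.
have [e1 [e2 fr]] := frames q0.
have [C1 [C2 [C3 [[X1 X2 X3] [q1 q2 q3] [n12 n13 n23]]]]] := three_cells HX fr ext.
have [D XD qD] := tc_cover HX (- q).
have nD : ~ D q by move=> h; apply: q0; exact: (tc_pointed HX XD h qD).
apply: (potential_apex HX q0 XD nD) => C XC CD; apply: contrapT => nC.
have ne K L : K q -> ~ L q -> K <> L by move=> Kq Lq E; apply: Lq; rewrite -E.
by apply: (no_K33 HX fr X1 X2 X3 XC XD) => //; apply: adj => //; exact: ne.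
Qed.

End Three.

(** * Orthonormal frames *)

Section Frames.
Variable R : realType.

Lemma orthonormal_span d (r : 'I_d -> 'rV[R]_d) :
  (forall i j, dot (r i) (r j) = (i == j)%:R) ->
  forall m, m = \sum_i dot m (r i) *: r i.
Proof.
move=> h m; pose M := \matrix_i r i.
have MM : M *m M^T = 1%:M.
  apply/matrixP => i j; rewrite !mxE -h /dot; apply: eq_bigr => k _.
  by rewrite !mxE.
have {1}-> : m = (m *m M^T) *m M by rewrite -mulmxA (mulmx1C MM) mulmx1.
rewrite mulmx_sum_row; apply: eq_bigr => i _.
by rewrite !mxE rowK; congr (_ *: _); apply: eq_bigr => k _; rewrite !mxE.
Qed.

Lemma frame_plane : exists e1 e2 : 'rV[R]_2, frame 0 e1 e2.
Proof.
pose r (i : 'I_2) : 'rV[R]_2 := delta_mx 0 i.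
have h i j : dot (r i) (r j) = (i == j)%:R.
  rewrite /dot /r (bigD1 i) //= !mxE !eqxx mul1r big1 ?addr0.
    by rewrite eq_sym.
  by move=> k ki; rewrite !mxE (negbTE ki) andbF mul0r.
exists (r ord0), (r ord_max); split; rewrite ?dot0r ?h //.
by move=> m _; rewrite {1}(orthonormal_span h m) !big_ord_recl big_ord0 addr0;
  congr (_ + dot m (r _) *: r _); apply: val_inj.
Qed.

Lemma dot3E (u w : 'rV[R]_3) : dot u w =
  u 0 0 * w 0 0 + u 0 1 * w 0 1 + u 0 (inord 2) * w 0 (inord 2).
Proof.
rewrite /dot !big_ord_recl big_ord0 addr0 addrA.
by congr (_ + u 0 _ * w 0 _ + u 0 _ * w 0 _); apply: val_inj; rewrite /= ?inordK.
Qed.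

Definition vec3 (a b c : R) : 'rV[R]_3 := \row_j nth 0 [:: a; b; c] j.

Lemma dot_vec3 (u : 'rV[R]_3) a b c :
  dot u (vec3 a b c) = u 0 0 * a + u 0 1 * b + u 0 (inord 2) * c.
Proof. by rewrite dot3E !mxE /= inordK. Qed.

Lemma vec3_coord a b c :
  [/\ vec3 a b c 0 0 = a, vec3 a b c 0 1 = b & vec3 a b c 0 (inord 2) = c].
Proof. by split; rewrite !mxE //= inordK. Qed.

Lemma normalize d (w : 'rV[R]_d) : w <> 0 -> exists2 c : R, 0 < c & dot (c *: w) (c *: w) = 1.
Proof.
move=> /eqP w0; exists (enorm w)^-1; first by rewrite invr_gt0 enorm_gt0.
dotE; rewrite -enorm_sqr; have := enorm_gt0 w0; move: (enorm w) => n n0.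
by field; lra.
Qed.

Lemma frame_space (q : 'rV[R]_3) : q <> 0 -> exists e1 e2, frame q e1 e2.
Proof.
move=> q0.
have [w [w0 wq]] : exists w : 'rV[R]_3, w <> 0 /\ dot w q = 0.
  have [|no] := pselect (exists w : 'rV[R]_3, w <> 0 /\ dot w q = 0) => //.
  have h a b c : dot q (vec3 a b c) = 0 -> [/\ a = 0, b = 0 & c = 0].
    move=> E; have [ha hb hc] := vec3_coord a b c.
    have E0 : vec3 a b c = 0.
      by apply: contrapT => n0; apply: no; exists (vec3 a b c); rewrite dotC.
    by move: ha hb hc; rewrite E0 !mxE => <- <- <-.
  have [] := h (- q 0 1) (q 0 0) 0; first by rewrite dot_vec3; ring.
  move=> /eqP; rewrite oppr_eq0 => /eqP q1 q00 _.
  have [] := h 1 0 0; first by rewrite dot_vec3 q00; ring.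
  by move/eqP; rewrite oner_eq0.
have [k k0 kq] := normalize q0; have [l l0 lw] := normalize w0.
move: kq lw; set p := k *: q; set e1 := l *: w => pp ee.
have pe : dot p e1 = 0 by rewrite /p /e1; dotE; rewrite dotC wq !mulr0.
pose e2 := vec3 (p 0 1 * e1 0 (inord 2) - p 0 (inord 2) * e1 0 1)
  (p 0 (inord 2) * e1 0 0 - p 0 0 * e1 0 (inord 2))
  (p 0 0 * e1 0 1 - p 0 1 * e1 0 0).
have pe2 : dot p e2 = 0 by rewrite /e2 dot_vec3; ring.
have e12 : dot e1 e2 = 0 by rewrite /e2 dot_vec3; ring.
have e22 : dot e2 e2 = 1.
  have [h0 h1 h2] := vec3_coord (p 0 1 * e1 0 (inord 2) - p 0 (inord 2) * e1 0 1)
    (p 0 (inord 2) * e1 0 0 - p 0 0 * e1 0 (inord 2)) (p 0 0 * e1 0 1 - p 0 1 * e1 0 0).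
  rewrite -/e2 in h0 h1 h2.
  have -> : dot e2 e2 = dot p p * dot e1 e1 - dot p e1 ^+ 2.
    rewrite {1}dot3E h0 h1 h2 !dot3E; ring.
  by rewrite pp ee pe; ring.
pose r (i : 'I_3) := nth 0 [:: p; e1; e2] i.
have on i j : dot (r i) (r j) = (i == j)%:R.
  rewrite /r; case: i => -[|[|[|//]]] i3; case: j => -[|[|[|//]]] j3;
    rewrite /= ?pp ?ee ?e22 // -?(dotC p) ?pe ?pe2 ?e12 //.
  by rewrite dotC e12.
have kn : k <> 0 by lra.
have pq n : dot n p = 0 <-> dot n q = 0.
  rewrite /p dotZr; split=> [/eqP|->]; last by rewrite mulr0.
  by rewrite mulf_eq0 (gt_eqF k0) => /eqP.
exists e1, e2; split=> //.
- by apply/pq; rewrite dotC.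
- by apply/pq; rewrite dotC.
- move=> m /pq mp; rewrite {1}(orthonormal_span on m) !big_ord_recl big_ord0.
  by rewrite /r /= mp scale0r add0r addr0.
Qed.

End Frames.

(** * From a tight fan to its cells seen from the vertex *)

Section Bridge.
Variables (R : realType) (d : nat).
Local Notation V := 'rV[R]_d.
Implicit Types (u v w x y z n m p q : V) (C K E D f c : set V).

Lemma enormZ (t : R) u : enorm (t *: u) = `|t| * enorm u.
Proof.
by rewrite /enorm; dotE; rewrite mulrA -expr2 sqrtrM ?sqr_ge0 // sqrtr_sqr.
Qed.

Lemma enorm0 : enorm (0 : V) = 0.
Proof. by rewrite /enorm dot0r sqrtr0. Qed.

Lemma small_scale w (r : R) : 0 < r -> exists2 e0 : R, 0 < e0 &
  forall e, 0 <= e <= e0 -> enorm (e *: w) < r.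
Proof.
move=> r0; have n0 : 0 <= enorm w by exact: sqrtr_ge0.
exists (r / (enorm w + 1)); first by rewrite divr_gt0 //; lra.
move=> e /andP[e0 he]; rewrite enormZ ger0_norm //.
have n1 : 0 < enorm w + 1 by lra.
move: he; rewrite ler_pdivlMr // => he; nra.
Qed.

Lemma cone_of_combination k (w : 'I_k -> V) :
  cone_of [seq w i | i <- enum 'I_k] =
  [set x | exists2 a : 'I_k -> R, forall i, 0 <= a i & x = \sum_(i < k) a i *: w i].
Proof.
rewrite predeqE => x; split; last first.
  move=> [a a0 ->]; elim/big_ind: _ => [||i _]; first exact: cone_of0.
    by move=> y z; exact: cone_ofD.
  apply: cone_ofZ => //; apply: cone_of_mem; apply: map_f; exact: mem_enum.
elim: (enum 'I_k) x => [|j r ih] x /=.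
  move=> ->; exists (fun=> 0) => //.
  by rewrite big1 // => i _; rewrite scale0r.
move=> [t t0 /ih [a a0 E]]; exists (fun i => a i + (if i == j then t else 0)).
  by move=> i; apply: addr_ge0 => //; case: ifP.
rewrite -(subrK (t *: w j) x) E.
under [in RHS]eq_bigr => i _ do rewrite scalerDl.
rewrite big_split /=; congr (_ + _).
by rewrite (bigD1 j) //= eqxx big1 ?addr0 // => i /negbTE ->; rewrite scale0r.
Qed.

(** The witness is the sum of the generators. *)
Lemma cone_of_inner (s : seq V) : exists2 o, cone_of s o &
  forall n, (forall x, cone_of s x -> 0 <= dot n x) -> dot n o = 0 ->
  forall x, cone_of s x -> dot n x = 0.
Proof.
suff [ o so h] : exists2 o, cone_of s o & forall n,
    (forall w, w \in s -> 0 <= dot n w) -> dot n o = 0 -> forall x, cone_of s x -> dot n x = 0.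
  by exists o => // n hn; apply: h => w ws; apply: hn; exact: cone_of_mem.
elim: s => [|w s [ o so ih]] /=; first by exists 0 => // n _ _ x ->; rewrite dot0r.
exists (o + w); first by exists 1 => //; rewrite scale1r addrK.
move=> n hn; dotE => E x [a a0 hx].
have hw : 0 <= dot n w by apply: hn; rewrite mem_head.
have hs v : v \in s -> 0 <= dot n v by move=> vs; apply: hn; rewrite inE vs orbT.
have ho := cone_of_ge0 hs so.
have o0 : dot n o = 0 by lra.
have := ih n hs o0 _ hx; dotE.
by have -> : dot n w = 0 by [lra]; rewrite mulr0 subr0.
Qed.

(** By the rank of the matrix of generators. *)
Lemma span_or_hyperplane (s : seq V) :
  (exists2 n, n <> 0 & forall x, cone_of s x -> dot n x = 0) \/
  (forall y, exists a : 'I_(size s) -> R, y = \sum_i a i *: s`_i).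
Proof.
pose W := \matrix_(i < size s) s`_i.
have [fr|nfr] := boolP (row_free W^T).
  right=> y; have full : row_full W.
    by move: fr; rewrite /row_free /row_full mxrank_tr.
  have /submxP[D ->] := submx_full y full; exists (fun i => D 0 i).
  by rewrite mulmx_sum_row; apply: eq_bigr => i _; rewrite rowK.
left; move: nfr; rewrite -kermx_eq0 => /rowV0Pn[n /sub_kermxP nW n0].
exists n; first exact/eqP.
have nw w : w \in s -> dot n w = 0.
  move=> /(nthP 0)[i ilt <-]; have /rowP/(_ (Ordinal ilt)) := nW.
  by rewrite !mxE => E; rewrite -[RHS]E; apply: eq_bigr => j _; rewrite !mxE.
have h1 w : w \in s -> 0 <= dot n w by move=> /nw ->.
have h2 w : w \in s -> 0 <= dot (- n) w by move=> /nw E; rewrite dotNl E oppr0.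
move=> x sx; have := cone_of_ge0 h1 sx; have := cone_of_ge0 h2 sx.
by rewrite dotNl; lra.
Qed.

(** By convexity, a tangent vector of [C] at [p], multiplied by a small factor,
leads from [p] to a point of [C] inside the ball. *)
Lemma reflection_tangent v C K p (r : R) : convex_cone C -> convex_cone K ->
  0 < r -> C p ->
  (forall x, C x -> enorm (x - p) < r -> K (p *+ 2 - x)) ->
  forall y, tangent p C y -> tangent p K (- y).
Proof.
move=> cC cK r0 Cp h y [t t0 Cy].
have [e0 e00 he] := small_scale y r0.
pose e := Num.min e0 (t + 1)^-1.
have t1 : 0 < t + 1 by lra.
have e_gt0 : 0 < e by rewrite lt_min e00 invr_gt0.
have et : e * t <= 1.
  apply: (@le_trans _ _ ((t + 1)^-1 * t)).
    by apply: ler_wpM2r => //; rewrite ge_min lexx orbT.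
  by rewrite mulrC ler_pdivrMr //; lra.
have ei : 0 <= e^-1 by rewrite invr_ge0 ltW.
exists e^-1 => //.
have -> : - y + e^-1 *: p = e^-1 *: (p *+ 2 - (p + e *: y)).
  rewrite mulr2n opprD addrACA subrr add0r.
  by rewrite scalerBr scalerA mulVf ?gt_eqF // scale1r addrC.
apply: (coneZ cK) => //; apply: h; last first.
  by rewrite addrC addKr; apply: he; rewrite ltW //= ge_min lexx.
have -> : p + e *: y = e *: (y + t *: p) + (1 - e * t) *: p.
  by rewrite scalerDr scalerA scalerBl scale1r addrA addrAC addrK addrC.
apply: (coneD cC); apply: (coneZ cC) => //; first exact: ltW.
lra.
Qed.

Variable F : set (set V).
Hypothesis HF : tight_fan F.

Section Vertex.
Variable v : V.
Hypothesis Hv : minimal_cone F [set v].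

Definition recenter c : set V := [set x | c (v + x)].

Lemma recenterE c x : c x = recenter c (x - v).
Proof. by rewrite /recenter /= addrC subrK. Qed.

Lemma recenter_inj c c' : recenter c = recenter c' -> c = c'.
Proof. by move=> E; rewrite predeqE => x; rewrite !(recenterE _ x) E. Qed.

Lemma fan_axioms : is_fan F.
Proof. by case: HF => -[]. Qed.

Lemma vertex_mem c : F c -> c v.
Proof. by case: Hv => _ /(_ c) h /h; apply. Qed.

(** The vertex is a face of [c], so some functional attains its maximum over [c]
there only. *)
Lemma vertex_exposed c : F c -> exists n, forall x, recenter c x ->
  0 <= dot n x /\ (dot n x = 0 -> x = 0).
Proof.
move=> Fc; have [_ _ _ hi] := fan_axioms.
have [Fv _] := Hv; have cv := vertex_mem Fc.
have [_ [u [b [hb E]]] _] := hi _ _ Fc Fv.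
have ub : dot u v = b.
  have : (c `&` [set v]) v by split.
  by rewrite E => -[].
exists (- u) => x cx; split.
  by have := hb _ cx; dotE; lra.
rewrite dotNl => /eqP; rewrite oppr_eq0 => /eqP ux.
have [_ /=] : (c `&` [set v]) (v + x) by rewrite E; split=> //=; dotE; lra.
by move=> h; apply: (addrI v); rewrite h addr0.
Qed.

(** The apex [p] in the definition of a polyhedral cone is the vertex: the
functional of [vertex_exposed] is nonnegative on the generators. *)
Lemma recenter_cone c : F c -> exists s : seq V, recenter c = cone_of s.
Proof.
move=> Fc; have [_ hp _ _] := fan_axioms; have cv := vertex_mem Fc.
have [n hn] := vertex_exposed Fc.
have [p [k [w cE]]] := hp _ Fc; exists [seq w i | i <- enum 'I_k].
suff pv : p = v.
  rewrite cone_of_combination predeqE => x; rewrite /recenter cE pv /=; split.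
    by move=> [a a0 /addrI ->]; exists a.
  by move=> [a a0 ->]; exists a.
have [a a0 ev] : exists2 a : 'I_k -> R, forall i, 0 <= a i & v = p + \sum_(i < k) a i *: w i.
  by move: cv; rewrite {1}cE.
have wn i : 0 <= dot n (w i).
  have : c (v + w i).
    rewrite cE; exists (fun j => a j + (if j == i then 1 else 0)).
      by move=> j; apply: addr_ge0 => //; case: ifP.
    under eq_bigr => j _ do rewrite scalerDl.
    rewrite big_split /= addrA -ev; congr (_ + _).
    by rewrite (bigD1 i) //= eqxx scale1r big1 ?addr0 // => j /negbTE ->; rewrite scale0r.
  by move=> /hn[].
have : recenter c (p - v).
  rewrite /recenter /= addrC subrK cE; exists (fun=> 0) => //.
  by rewrite big1 ?addr0 // => i _; rewrite scale0r.
move=> /hn[h1 h2]; apply/eqP; rewrite -subr_eq0; apply/eqP; apply: h2.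
apply/eqP; rewrite eq_le h1 andbT.
have -> : dot n (p - v) = - \sum_(i < k) a i * dot n (w i).
  rewrite ev opprD addrA subrr add0r dotNr; congr (- _).
  elim/big_rec2: _ => [|i y1 y2 _ <-]; first by rewrite dot0r.
  by dotE.
by rewrite oppr_le0; apply: sumr_ge0 => i _; apply: mulr_ge0.
Qed.

Lemma recenter_convex c : F c -> convex_cone (recenter c).
Proof.
move=> /recenter_cone[s ->]; split; [exact: cone_of0|exact: cone_ofD|exact: cone_ofZ].
Qed.

Lemma fan_separator c c' : F c -> F c' -> exists n, separator (recenter c) (recenter c') n.
Proof.
move=> Fc Fc'; have [_ _ _ hi] := fan_axioms.
have half c1 c2 : F c1 -> F c2 -> forall x y, recenter c1 x -> recenter c1 y ->
    recenter c2 (x + y) -> recenter c2 x.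
  move=> F1 F2 x y x1 y1 xy2.
  have [_ [u [b [hb E]]] _] := hi _ _ F1 F2.
  have ub : dot u v = b.
    have : (c1 `&` c2) v by split; exact: vertex_mem.
    by rewrite E => -[].
  have [_] : (c1 `&` [set z | dot u z = b]) (v + (x + y)).
    by rewrite -E; split=> //; exact: (coneD (recenter_convex F1) x1 y1).
  rewrite /=; dotE => uxy; have := hb _ x1; have := hb _ y1; dotE => h1 h2.
  suff [] : (c1 `&` c2) (v + x) by [].
  by rewrite E; split=> //=; dotE; lra.
have [s es] := recenter_cone Fc; have [s' es'] := recenter_cone Fc'.
rewrite es es'; apply: cone_of_separation; rewrite -es -es'; exact: half.
Qed.


Lemma affine_hull_const c n (b : R) : (forall x, c x -> dot n x = b) ->
  forall x, affine_hull c x -> dot n x = b.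
Proof.
move=> h x [k [a [y [hy sa ->]]]].
have -> : dot n (\sum_(i < k) a i *: y i) = \sum_(i < k) a i * b.
  elim/big_rec2: _ => [|i y1 y2 _ <-]; first by rewrite dot0r.
  by dotE; rewrite h.
by rewrite -mulr_suml sa mul1r.
Qed.

Lemma cell_full c : cell F c -> affine_hull c = setT.
Proof.
move=> [Fc [k]]; rewrite addn0 => -> [p [U [-> dU]]].
have -> : U = fullv.
  by apply/eqP; rewrite eqEdim subvf dimvf /dim /= dU mul1n.
by rewrite predeqE => x; split=> // _ /=; rewrite memvf.
Qed.

Lemma cell_spans c n : cell F c -> (forall x, recenter c x -> dot n x = 0) -> n = 0.
Proof.
move=> cc h; apply: dot_eq0.
have := @affine_hull_const c n (dot n v) _ (v + n); dotE.
rewrite cell_full // => H; have := H _ I.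
suff : forall x, c x -> dot n x = dot n v by move=> /[swap] /[apply]; lra.
by move=> x; rewrite recenterE => /h; dotE; lra.
Qed.

Lemma flat_or_cell c : F c -> (exists2 n, n <> 0 & forall x, recenter c x -> dot n x = 0) \/ cell F c.
Proof.
move=> Fc; have [s es] := recenter_cone Fc.
have [h|h] := span_or_hyperplane s; first by left; rewrite es.
right; split=> //; exists d; rewrite ?addn0 //.
exists 0, fullv; split; last by rewrite dimvf /dim /= mul1n.
rewrite predeqE => x; split=> /= _; first by rewrite memvf.
have [a ea] := h (x - v).
have cw i : c (v + s`_i).
  have [ilt|ige] := ltnP i (size s); last by rewrite nth_default // addr0; exact: vertex_mem.
  have : recenter c s`_i by rewrite es; apply: cone_of_mem; exact: mem_nth.
  by [].
exists (size s).+1, (fun i => oapp a (1 - \sum_i a i) (unlift ord0 i)),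
  (fun i => oapp (fun j : 'I_(size s) => v + s`_j) v (unlift ord0 i)).
split.
- by move=> i; case: unliftP => [j _|_] /=; [exact: cw|exact: vertex_mem].
- rewrite big_ord_recl unlift_none /= [X in _ + X](eq_bigr a) ?subrK // => i _.
  by rewrite liftK.
- rewrite big_ord_recl unlift_none /=.
  rewrite (eq_bigr (fun i => a i *: v + a i *: s`_i)); last first.
    by move=> i _; rewrite liftK /= scalerDr.
  rewrite big_split /= -scaler_suml addrA -scalerDl subrK scale1r -ea.
  by rewrite addrC subrK.
Qed.

(** ** The cells cover the space *)

(** To a normal of one hyperplane, add a large multiple of a vector that avoids
the other ones. *)
Lemma avoid_hyperplanes (Y : set (set V)) (n : set V -> V) : finite_set Y ->
  exists w, forall K, Y K -> n K <> 0 -> dot (n K) w <> 0.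
Proof.
move=> /finite_seqP[s ->].
suff [w h] : exists w, forall K, K \in s -> n K <> 0 -> dot (n K) w <> 0 by exists w.
elim: s => [|K0 s [w ih]]; first by exists 0.
have [n0|n0] := pselect (n K0 = 0).
  by exists w => K; rewrite inE => /predU1P[->//|]; exact: ih.
have [||t t0 ht] := @finite_eventually _ _ [set` K0 :: s]
    (fun K t => n K <> 0 -> dot (n K) (n K0 + t *: w) <> 0).
- by apply/finite_seqP; exists (K0 :: s).
- move=> K hK; have [E|E] := eqVneq (dot (n K) w) 0.
    exists 0 => t _ nK; dotE; rewrite E mulr0 addr0.
    move: hK; rewrite /= inE => /predU1P[->|Ks]; last by case: (ih _ Ks nK).
    by move/dot_eq0.
  exists (`|dot (n K) (n K0)| / `|dot (n K) w| + 1) => t ht _; dotE => E0.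
  have p : 0 < `|dot (n K) w| by rewrite normr_gt0.
  have q0 : 0 <= `|dot (n K) (n K0)| / `|dot (n K) w| by rewrite divr_ge0.
  have t0 : 0 <= t by lra.
  have e : `|dot (n K) (n K0)| = t * `|dot (n K) w|.
    have -> : dot (n K) (n K0) = - (t * dot (n K) w) by lra.
    by rewrite normrN normrM (ger0_norm t0).
  move: ht; rewrite e mulfK ?gt_eqF //; lra.
by exists (n K0 + t *: w) => K hK; exact: ht.
Qed.

(** Points near [x] in a generic direction lie in no lower-dimensional cone, and
in no cell that does not contain [x]. *)
Lemma cells_cover x : exists2 c, cell F c & recenter c x.
Proof.
have fF : finite_set F by case: fan_axioms.
have cov y : exists2 c, F c & recenter c y.
  have [[_ hc] _ _ _] := HF; have : (\bigcup_(c in F) c) (v + y) by rewrite hc.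
  by move=> [c Fc cy]; exists c.
have /choice[n hn] c : exists n, F c -> (n <> 0 /\ forall x, recenter c x -> dot n x = 0) \/ cell F c.
  have [Fc|nFc] := pselect (F c); last by exists 0.
  by have [[n n0 h]|h] := flat_or_cell Fc; [exists n; left|exists 0; right].
have [w hw] := avoid_hyperplanes n fF.
have [c0 F0 c0x] := cov x.
have [|t t0 ht] := @finite_eventually _ _ F
    (fun c t => 0 < t -> recenter c (x + t^-1 *: w) -> cell F c /\ recenter c x) fF.
  move=> c Fc; have [[n0 nc]|cc] := hn _ Fc.
    have nw := hw _ Fc n0.
    exists (`|dot (n c) x| + `|dot (n c) w| / `|dot (n c) x| + 1) => t ht t0 /nc; dotE => E.
    have [nx|nx] := eqVneq (dot (n c) x) 0.
      exfalso; apply: nw; move/eqP: E; rewrite nx add0r mulf_eq0 invr_eq0 gt_eqF //=.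
      by move/eqP.
    exfalso; have p : 0 < `|dot (n c) x| by rewrite normr_gt0.
    have e : `|dot (n c) w| = t * `|dot (n c) x|.
      have -> : dot (n c) w = - (t * dot (n c) x).
        have h : t * (dot (n c) x + t^-1 * dot (n c) w) = 0 by rewrite E mulr0.
        by move: h; rewrite mulrDr mulrA divff ?gt_eqF // mul1r; lra.
      by rewrite normrN normrM (gtr0_norm t0).
    move: ht; rewrite e mulfK ?gt_eqF //; lra.
  have [cx|ncx] := pselect (recenter c x); first by exists 0.
  have [m [m1 m2 m3 m4]] := fan_separator Fc F0.
  have mx : dot m x < 0.
    by rewrite lt_neqAle m2 // andbT; apply/eqP => /(m4 _ c0x).
  exists (`|dot m w| / - dot m x + 1) => t ht t0 /m1; dotE => h; exfalso.
  have mx' : 0 < - dot m x by lra.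
  have : `|dot m w| < t * - dot m x by rewrite -ltr_pdivrMr //; lra.
  have := ler_norm (dot m w).
  have : 0 <= t * (dot m x + t^-1 * dot m w) by rewrite mulr_ge0 // ltW.
  by rewrite mulrDr mulrA divff ?gt_eqF // mul1r; lra.
have [c Fc cy] := cov (x + t^-1 *: w).
by have [] := ht t c (lexx _) Fc t0 cy; exists c.
Qed.

(** A little beyond [p] on the line from a point of [f] through [p], the point is
still in [f]; scaling brings it back to the form required by [core]. *)
Lemma relint_core f p : F f -> relint f p -> core (recenter f) (p - v).
Proof.
move=> Ff [fp [r r0 hr]]; have cf := recenter_convex Ff.
split; first by rewrite -recenterE.
move=> x fx; have [e e0 he] := small_scale (p - (v + x)) r0.
have e1 : 0 < 1 + e by lra.
exists (e / (1 + e)); first by rewrite divr_gt0.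
have : f (p + e *: (p - (v + x))).
  apply: hr; split; first by rewrite /eball /= addrC addKr; apply: he; rewrite (ltW e0) lexx.
  exists 2, (fun i => if i == ord0 then 1 + e else - e),
    (fun i => if i == ord0 then p else v + x); split.
  - by move=> i; case: ifP.
  - by rewrite !big_ord_recl big_ord0 /=; ring.
  - rewrite !big_ord_recl big_ord0 /= addr0 scalerBr scalerDl scale1r scaleNr.
    by rewrite addrA.
rewrite recenterE => /(coneZ cf (t := (1 + e)^-1)).
have -> : (1 + e)^-1 *: (p + e *: (p - (v + x)) - v) = p - v - (e / (1 + e)) *: x.
  apply/rowP => i; rewrite !mxE; field; lra.
by apply; rewrite invr_ge0 ltW.
Qed.

Definition cells : set (set V) := [set recenter c | c in cell F].

Lemma cellsP C : cells C -> exists2 c, cell F c & C = recenter c.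
Proof. by move=> [c cc <-]; exists c. Qed.

Lemma recenter_neq c c' : recenter c <> recenter c' -> c <> c'.
Proof. by move=> h E; apply: h; rewrite E. Qed.

Lemma fan_inter c c' : F c -> F c' -> F (c `&` c').
Proof.
move=> Fc Fc'; have [_ _ hf hi] := fan_axioms.
by have [h1 h2 _] := hi _ _ Fc Fc'; exact: hf _ _ Fc h2 h1.
Qed.

Lemma reflection_recenter c c' p (r : R) :
  (forall x, c x -> eball p r x -> c' (reflection p x)) ->
  forall x, recenter c x -> enorm (x - (p - v)) < r -> recenter c' ((p - v) *+ 2 - x).
Proof.
move=> h x cx xr; have := h _ cx; rewrite /eball /reflection /recenter /=.
have -> : v + x - p = x - (p - v) by apply/rowP => i; rewrite !mxE; ring.
have -> : p *+ 2 - (v + x) = v + ((p - v) *+ 2 - x).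
  by apply/rowP => i; rewrite !mxE; ring.
by apply.
Qed.

Theorem tight_fan_cells : tight_cells cells.
Proof.
have fF : finite_set F by case: fan_axioms.
split.
- by apply: finite_image; apply: sub_finite_set fF => c [].
- by move=> C /cellsP[c [Fc _] ->]; exact: recenter_convex.
- by move=> C /cellsP[c [Fc _] ->]; exact: vertex_exposed.
- move=> C /cellsP[c cc ->]; have [Fc _] := cc.
  have [s es] := recenter_cone Fc; have [ o so ho] := cone_of_inner s.
  exists o; first by rewrite es.
  move=> n hn no; apply: (cell_spans cc) => x; rewrite es; apply: ho => //.
  by rewrite -es.
- by move=> x; have [c cc cx] := cells_cover x; exists (recenter c) => //; exists c.
- move=> C K /cellsP[c [Fc _] ->] /cellsP[c' [Fc' _] ->] _; exact: fan_separator.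
- move=> C K /cellsP[c cc ->] /cellsP[c' cc' ->] CK.
  have [_ _ _ /(_ _ _ cc cc' (recenter_neq CK))[_ [p [r [rp r0 E]]]]] := HF.
  have [Fc _] := cc; have [Fc' _] := cc'.
  have cp := relint_core (fan_inter Fc Fc') rp.
  exists (p - v); first exact: cp.
  apply: (reflection_tangent v (recenter_convex Fc) (recenter_convex Fc') r0).
    by case: cp => -[].
  apply: reflection_recenter => x cx xB.
  have : (c' `&` eball p r) (reflection p x) by rewrite -E; exists x.
  by case.
- move=> C K /cellsP[c cc ->] /cellsP[c' cc' ->] CK.
  have [_ _ _ /(_ _ _ cc cc' (recenter_neq CK))[[Ff [p [r [rp r0 E]]]] _]] := HF.
  exists (p - v); first exact: (relint_core Ff rp).
  move=> L /cellsP[e ce ->] ep; have [Fe _] := ce.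
  have [e' Fe' Ee'] : exists2 e', F e' & e' `&` eball p r = [set reflection p x | x in e `&` eball p r].
    have : fan_trace F (eball p r) [set reflection p x | x in e `&` eball p r].
      by rewrite -E; exists (e `&` eball p r) => //; exists e.
    by move=> [e' Fe' h]; exists e'.
  have refl2 x : reflection p (reflection p x) = x.
    by rewrite /reflection opprB addrC subrK.
  have reflB x : eball p r x -> eball p r (reflection p x).
    rewrite /eball /reflection /=.
    have -> : p *+ 2 - x - p = - (x - p) by rewrite mulr2n opprB addrAC addrK.
    by rewrite /enorm dotNl dotNr opprK.
  have h1 x : e x -> eball p r x -> e' (reflection p x).
    move=> ex xB; have : (e' `&` eball p r) (reflection p x) by rewrite Ee'; exists x.
    by case.
  have h2 x : e' x -> eball p r x -> e (reflection p x).
    move=> ex xB; have : (e' `&` eball p r) x by split.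
    by rewrite Ee' => -[z [ez _] <-]; rewrite refl2.
  have e'p : recenter e' (p - v).
    rewrite -recenterE; have := h1 p; rewrite /reflection mulr2n addrK; apply.
      by rewrite recenterE.
    by rewrite /eball /= subrr enorm0.
  have t1 := reflection_tangent v (recenter_convex Fe) (recenter_convex Fe') r0 ep
    (reflection_recenter h1).
  have t2 := reflection_tangent v (recenter_convex Fe') (recenter_convex Fe) r0 e'p
    (reflection_recenter h2).
  exists (recenter e'); split=> //.
    exists e' => //; have [[n n0 hn]|//] := flat_or_cell Fe'.
    case: n0; apply: (cell_spans ce) => x ex.
    have [t _ /hn] := t1 _ (tangent_mem (p - v) ex).
    by dotE; have := hn _ e'p; dotE => ->; rewrite mulr0 addr0; lra.
  by move=> y; split; [exact: t1|rewrite -{2}(opprK y); exact: t2].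
Qed.

End Vertex.
End Bridge.

(** * Angles *)

Section Angles.
Variable R : realType.

Lemma polar_angle (a b : R) : a ^+ 2 + b ^+ 2 = 1 ->
  exists t, [/\ 0 <= t < pi *+ 2, cos t = a & sin t = b].
Proof.
move=> h.
have a1 : -1 <= a <= 1.
  have a2 : a ^+ 2 <= 1 by have := sqr_ge0 b; lra.
  by rewrite -ler_norml -(expr_le1 (n := 2)) // -normrX ger0_norm // sqr_ge0.
have sa : sin (acos a) = `|b|.
  by rewrite sin_acos // -sqrtr_sqr; congr Num.sqrt; lra.
have pi0 := pi_gt0 R.
have [b0|b0] := leP 0 b.
  exists (acos a); rewrite acosK ?in_itv //= sa ger0_norm //; split=> //.
  by rewrite acos_ge0 //=; have := acos_lepi a1; rewrite mulr2n; lra.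
have a_lt : a < 1.
  rewrite lt_neqAle; have [_ ->] := andP a1; rewrite andbT; apply/eqP => E.
  have : b ^+ 2 = 0 by move: h; rewrite E; lra.
  by move/eqP; rewrite sqrf_eq0 => /eqP; lra.
have t0 : 0 < acos a by apply: acos_gt0; have [-> _] := andP a1.
have t1 := acos_lepi a1.
exists (pi *+ 2 - acos a); split.
- by rewrite mulr2n; lra.
- by rewrite addrC cosD2pi cosN acosK // in_itv.
- by rewrite addrC sinD2pi sinN sa ltr0_norm // opprK.
Qed.

Lemma half_turn (k l a b c : R) : a < b -> b < c -> c <= a + pi ->
  0 < k * cos a + l * sin a -> 0 < k * cos c + l * sin c ->
  0 < k * cos b + l * sin b.
Proof.
move=> ab bc ca fa fc.
have E : (k * cos a + l * sin a) * sin (c - b) + (k * cos c + l * sin c) * sin (b - a)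
    = (k * cos b + l * sin b) * sin (c - a).
  have hb := cos2Dsin2 b; rewrite !sinB.
  by ring.
have s1 : 0 < sin (c - b) by apply: sin_gt0_pi; lra.
have s2 : 0 < sin (b - a) by apply: sin_gt0_pi; lra.
have p : 0 < (k * cos b + l * sin b) * sin (c - a).
  by rewrite -E addr_gt0 // mulr_gt0.
have [e|ne] := eqVneq c (a + pi).
  by move: p; rewrite e addrAC subrr add0r sinpi mulr0 ltxx.
have s3 : 0 < sin (c - a).
  apply: sin_gt0_pi; rewrite subr_gt0 (lt_trans ab bc) /=.
  by rewrite ltrBlDl lt_neqAle ne.
by rewrite pmulr_lgt0 in p.
Qed.

(** A linear functional is positive on half of a circle only: its signs cannot
alternate twice around the circle. *)
Lemma no_alternation (k l t0 t1 t2 t3 : R) :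
  t0 < t1 -> t1 < t2 -> t2 < t3 -> t3 < t0 + pi *+ 2 ->
  0 < k * cos t0 + l * sin t0 -> k * cos t1 + l * sin t1 < 0 ->
  0 < k * cos t2 + l * sin t2 -> k * cos t3 + l * sin t3 < 0 -> False.
Proof.
move=> t01 t12 t23 t30 f0 f1 f2 f3.
have [h|h] := leP t2 (t0 + pi).
  by have := half_turn t01 t12 h f0 f2; lra.
have f0' : 0 < k * cos (t0 + pi *+ 2) + l * sin (t0 + pi *+ 2).
  by rewrite cosD2pi sinD2pi.
have h' : t0 + pi *+ 2 <= t2 + pi by rewrite mulr2n; lra.
by have := half_turn t23 t30 h' f2 f0'; lra.
Qed.

End Angles.

(** * Faces of codimension 2 *)

Section Coribs.
Variables (R : realType) (d : nat).
Local Notation V := 'rV[R]_d.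
Implicit Types (u v w x y z n m p q : V) (C K E D f c Q : set V).

Lemma exists_frame (q : V) : d = 2%N \/ d = 3%N -> (d = 2%N -> q = 0) ->
  (d = 3%N -> q <> 0) -> exists e1 e2, frame q e1 e2.
Proof.
move=> hd h2 h3; case: hd => E; subst d.
  by rewrite h2 //; exact: frame_plane.
by apply: frame_space; exact: h3.
Qed.

Variable F : set (set V).
Hypothesis HF : tight_fan F.
Hypothesis hd : d = 2%N \/ d = 3%N.
Variable v : V.
Hypothesis Hv : minimal_cone F [set v].
Local Notation X := (cells F v).
Let HX : tight_cells X := tight_fan_cells HF Hv.

Record corib_ray Q q : Prop := CoribRay {
  ray_dim2 : d = 2%N -> q = 0;
  ray_dim3 : d = 3%N -> q <> 0;
  ray_mem : Q (v + q);
  ray_relint : relint Q (v + q);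
  ray_span : forall x, recenter v Q x -> exists2 c, 0 <= c & x = c *: q }.


Lemma corib_has_ray Q : corib F Q -> exists q, corib_ray Q q.
Proof.
move=> [FQ [k kd [p [U [aff dU]]]]].
have Qv := vertex_mem Hv FQ; have cQ := recenter_convex HF Hv FQ.
have sub x : Q x -> affine_hull Q x.
  move=> Qx; exists 1%N, (fun=> 1), (fun=> x); split=> //.
    by rewrite big_ord_recl big_ord0 addr0.
  by rewrite big_ord_recl big_ord0 addr0 scale1r.
have vU : v - p \in U by have := sub _ Qv; rewrite aff.
have affv x : affine_hull Q x <-> x - v \in U.
  rewrite aff /=; split=> h.
    by have -> : x - v = (x - p) - (v - p) by [rewrite opprB addrA subrK]; rewrite memvB.
  by have -> : x - p = (x - v) + (v - p) by [rewrite addrA subrK]; rewrite memvD.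
have inU x : recenter v Q x -> x \in U.
  by move=> /sub/affv; rewrite addrC addKr.
case: hd => d2.
  have k0 : k = 0%N by apply: (@addIn 2); rewrite kd d2.
  have U0 : U = 0%VS by apply/eqP; rewrite -dimv_eq0 dU k0.
  exists 0; split.
  - by [].
  - by move=> E; have := etrans (esym d2) E.
  - by rewrite addr0.
  - rewrite addr0; split=> //; exists 1 => //; move=> x [_ /affv].
    by rewrite U0 memv0 subr_eq0 => /eqP ->.
  - by move=> x /inU; rewrite U0 memv0 => /eqP ->; exists 0; rewrite ?scaler0.
have k1 : k = 1%N by apply: (@addIn 2); rewrite kd d2.
have [q Qq q0] : exists2 q, recenter v Q q & q <> 0.
  apply: contrapT => no.
  have Qv' x : Q x -> x = v.
    move=> Qx; apply/eqP; rewrite -subr_eq0; apply/eqP; apply: contrapT => x0.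
    by apply: no; exists (x - v) => //; rewrite -recenterE.
  have U0 : U = 0%VS.
    apply/eqP; rewrite -subv0; apply/subvP => e eU.
    have /affv : v + e - v \in U by rewrite addrC addKr.
    move=> [n [a [y [hy sa E]]]].
    have : v + e = v.
      rewrite E (eq_bigr (fun i => a i *: v)); last by move=> i _; rewrite (Qv' _ (hy i)).
      by rewrite -scaler_suml sa scale1r.
    by move/eqP; rewrite -subr_eq0 addrC addKr memv0.
  by move: dU; rewrite U0 dimv0 k1.
have Uq : U = <[q]>%VS.
  apply/eqP; rewrite eq_sym eqEdim -memvE inU //= dU k1 dim_vline.
  by case: eqP.
have [u hu] := vertex_exposed HF Hv FQ.
have uq : 0 < dot u q.
  have [h1 h2] := hu _ Qq; rewrite lt_neqAle h1 andbT; apply/eqP => /esym/h2.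
  exact: q0.
have qn : 0 < enorm q by apply: enorm_gt0; apply/eqP.
exists q; split=> //.
- by move=> E; have := etrans (esym d2) E.
- split=> //; exists (enorm q) => // x [xB /affv].
  rewrite Uq => /vlineP[c ec]; rewrite (recenterE v) ec; apply: (coneZ cQ) => //.
  move: xB; rewrite /eball /=.
  have -> : x - (v + q) = (c - 1) *: q by rewrite opprD addrA ec scalerBl scale1r.
  rewrite enormZ -[X in _ < X]mul1r ltr_pM2r // ltr_norml; lra.
- move=> x Qx; have := inU _ Qx; rewrite Uq => /vlineP[c ec]; exists c => //.
  by have [] := hu _ Qx; rewrite ec dotZr pmulr_lge0.
Qed.

Section Ray.
Variables (Q : set V) (q : V).
Hypothesis FQ : F Q.
Hypothesis HQ : corib_ray Q q.

Lemma ray_frame : exists e1 e2, frame q e1 e2.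
Proof. exact: (exists_frame hd (ray_dim2 HQ) (ray_dim3 HQ)). Qed.

Lemma corib_sub c : F c -> recenter v c q <-> Q `<=` c.
Proof.
move=> Fc; split=> [cq x|]; last by apply; exact: ray_mem HQ.
rewrite (recenterE v Q) (recenterE v c) => /(ray_span HQ)[k k0 ->].
exact: (coneZ (recenter_convex HF Hv Fc)).
Qed.

(** The functional that exposes the face [Q] of the cell. *)
Lemma corib_exposed C : X C -> C q -> exists u, exposes C q u.
Proof.
move=> /cellsP[c [Fc _] ->] cq.
have QE : Q `&` c = Q by apply/setIidl/corib_sub.
have [_ _ _ hi] := fan_axioms HF.
have [_ _ [u [b [hb E]]]] := hi _ _ FQ Fc; rewrite QE in E.
have Qb x : Q x -> dot u x = b by rewrite E => -[].
have ub := Qb _ (vertex_mem Hv FQ); have uq := Qb _ (ray_mem HQ).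
exists (- u); split.
- by move: uq; dotE; lra.
- by move=> x /hb; dotE; lra.
- move=> x cx; dotE => h.
  have : Q (v + x) by rewrite E; split=> //=; dotE; lra.
  by move/(ray_span HQ)=> [k _ ->]; exists k.
Qed.

End Ray.

(** ** Interior points of a cell *)

(** The distance from [x] to a hyperplane that separates the cell from another one
is positive, and there are finitely many cells. *)
Lemma inner_relint c x : cell F c -> recenter v c x ->
  (forall n, (forall y, recenter v c y -> 0 <= dot n y) -> n <> 0 -> 0 < dot n x) ->
  relint c (v + x).
Proof.
move=> cc cx hx; split=> //.
have Xc : X (recenter v c) by exists c.
have [|t t0 ht] := @finite_eventually _ _ X (fun K t => 0 < t -> K <> recenter v c ->
    forall y, enorm (y - x) < t^-1 -> ~ K y) (tc_finite HX).
  move=> K XK; have [->|/eqP CK] := eqVneq K (recenter v c); first by exists 0.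
  have [n sn] := tc_sep HX Xc XK (nesym CK).
  have n0 := separator_neq0 Xc XK (nesym CK) sn.
  have [n1 n2 _ _] := sn; have nx := hx _ n1 n0.
  have nn := dot_gt0 (introN eqP n0).
  exists (enorm n / dot n x) => t ht t0 _ y hy Ky; have ny := n2 _ Ky.
  move: hy; rewrite enorm_ltP ?invr_gt0 //.
  set D := dot (y - x) (y - x) => hD.
  have sq : 0 <= dot ((y - x) + (dot n x / dot n n) *: n) ((y - x) + (dot n x / dot n n) *: n).
    exact: dot_ge0.
  have E : dot ((y - x) + (dot n x / dot n n) *: n) ((y - x) + (dot n x / dot n n) *: n)
      = D + 2 * (dot n x / dot n n) * (dot n y - dot n x) + dot n x ^+ 2 / dot n n.
    have gen a k : dot (a + k *: n) (a + k *: n) = dot a a + 2 * k * dot n a + k ^+ 2 * dot n n.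
      by dotE; rewrite (dotC a n); ring.
    by rewrite gen -/D (dotDr n y) dotNr; field; rewrite gt_eqF.
  have s0 : 0 <= dot n x / dot n n by rewrite divr_ge0 // ltW.
  have g1 : (dot n x / dot n n) * dot n y <= 0 by exact: mulr_ge0_le0.
  have g2 : dot n x ^+ 2 / dot n n = (dot n x / dot n n) * dot n x by ring.
  have g3 : (dot n x / dot n n) * dot n x <= D by move: sq; rewrite E g2; lra.
  have g4 : t^-1 ^+ 2 <= (dot n x / dot n n) * dot n x.
    rewrite -g2 exprVn -[X in _ <= X]invrK lef_pV2 ?posrE ?exprn_gt0 //; last first.
      by rewrite invr_gt0 divr_gt0 // exprn_gt0.
    rewrite invf_div -enorm_sqr -expr_div_n.
    have en : 0 <= enorm n / dot n x by rewrite divr_ge0 ?sqrtr_ge0 // ltW.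
    by rewrite ler_pXn2r ?nnegrE // ltW.
  by have := le_lt_trans (le_trans g4 g3) hD; rewrite ltxx.
exists t^-1; first by rewrite invr_gt0.
move=> y [yB _]; rewrite (recenterE v).
have [K XK Ky] := tc_cover HX (y - v).
have [<-//|/eqP KC] := eqVneq K (recenter v c).
case: (ht t K (lexx _) XK t0 KC (y - v)) => //.
by move: yB; rewrite /eball /= opprD addrA.
Qed.

Lemma relint_pos c x n : cell F c -> relint c x -> n <> 0 ->
  (forall y, recenter v c y -> 0 <= dot n y) -> 0 < dot n (x - v).
Proof.
move=> cc [cx [r r0 hr]] n0 hn.
have [e e0 he] := small_scale n r0.
have cy : c (x - e *: n).
  apply: hr; split; last by rewrite (cell_full cc).
  rewrite /eball /= addrC addKr -scaleN1r enormZ normrN1 mul1r; apply: he.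
  by rewrite (ltW e0) lexx.
have := hn (x - e *: n - v); rewrite -(recenterE v) => /(_ cy); dotE.
have := mulr_gt0 e0 (dot_gt0 (introN eqP n0)); lra.
Qed.

End Coribs.

(** * Cyclic orders and torsion *)

Section Torsion.
Variables (R : realType) (d : nat).
Local Notation V := 'rV[R]_d.
Implicit Types (u w x y z n m p q : V) (C K E D f c Q : set V).
Variable F : set (set V).
Hypothesis HF : tight_fan F.
Hypothesis hd : d = 2%N \/ d = 3%N.
Variable v : V.
Hypothesis Hv : minimal_cone F [set v].
Local Notation X := (cells F v).
Local Notation rc := (recenter v).
Let HX : tight_cells X := tight_fan_cells HF Hv.

Lemma ordS_neq k (i j1 j2 : 'I_k) : j1 <> j2 -> ordS i <> i.
Proof.
move=> j12 /(congr1 val) /=; have ik := ltn_ord i.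
have k1 : (1 < k)%N.
  rewrite ltnNge; apply/negP => k1; apply: j12; apply: val_inj.
  by case: j1 j2 => [a ha] [b hb] /=; case: k k1 ha hb {i ik} => [//|[|//]] _; case: a; case: b.
case: (ltngtP i.+1 k) => h.
- by rewrite modn_small // => /eqP; rewrite eqn_leq ltnn.
- by rewrite ltnNge ik in h.
- by rewrite h modnn => i0; move: k1; rewrite -h -i0.
Qed.

(** The walls are met in the order of the angles: with two opposite cells in
consecutive positions, one of the functionals of [quad] would change its sign
four times around the circle. *)
Lemma consecutive_common Q q k (C : 'I_k -> set V) i :
  F Q -> corib_ray v Q q -> cyclic_order F Q C ->
  C i <> C (ordS i) /\
  exists x, [/\ rc (C i) x, rc (C (ordS i)) x & ~ exists l, x = l *: q].
Proof.
move=> FQ HQ [Cinj Crange [p [e1 [e2 [rho [theta [rp _ _ inc ang]]]]]]].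
have [f1 [f2 fr]] := ray_frame hd HQ.
have inC j : cell F (C j) /\ Q `<=` C j.
  have : range C (C j) by exists j.
  by rewrite Crange.
have XC j : X (rc (C j)) by exists (C j) => //; case: (inC j).
have qC j : rc (C j) q by have [[Fc _] sub] := inC j; apply/(corib_sub HF Hv HQ).
have idx D : X D -> D q -> exists j, D = rc (C j).
  move=> /cellsP[c cc ->] cq.
  have : range C c by rewrite Crange; split=> //; apply/(corib_sub HF Hv HQ) => //; case: cc.
  by move=> [j _ <-]; exists j.
have [j1 [j2 j12]] : exists j1 j2 : 'I_k, j1 <> j2.
  have [C1 [C2 [_ [[X1 X2 _] [q1 q2 _] [n12 _ _]]]]] :=
    three_cells HX fr (corib_exposed HF Hv FQ HQ).
  have [j1 E1] := idx _ X1 q1; have [j2 E2] := idx _ X2 q2.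
  by exists j1, j2 => E; apply: n12; rewrite E1 E2 E.
have neq := ordS_neq (i := i) j12.
have CC : C i <> C (ordS i) by move=> /Cinj /esym.
split=> //; apply: contrapT => no.
have CK : rc (C i) <> rc (C (ordS i)) by move=> /recenter_inj.
have [|A [B [E [E' Q4]]]] := ray_quad HX fr (XC i) (XC (ordS i)) CK (qC _) (qC _).
  by move=> x x1 x2; apply: contrapT => nx; apply: no; exists x.
have [a Ea] := idx _ (quadX2 Q4) (quadq2 Q4).
have [b Eb] := idx _ (quadX4 Q4) (quadq4 Q4).
have A0 : A <> 0.
  move=> A0; apply: (quadn12 Q4); apply: (cell_sub HX (quadX1 Q4) (quadX2 Q4)) => x.
  by apply: (proj1 (quad12 Q4 _)); rewrite A0 dot0l.
have B0 : B <> 0.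
  move=> B0; apply: (quadn23 Q4); apply: (cell_sub HX (quadX2 Q4) (quadX3 Q4)) => x.
  by apply: (proj1 (quad23 Q4 _)); rewrite B0 dot0l.
have N0 n : n <> 0 -> - n <> 0 by move=> n0 /eqP; rewrite oppr_eq0 => /eqP.
have [c0 _ ep] : exists2 c0, 0 <= c0 & p - v = c0 *: q.
  by case: rp => Qp _; apply: (ray_span HQ); rewrite -recenterE.
have sg j n : (forall x, rc (C j) x -> 0 <= dot n x) -> n <> 0 -> dot n q = 0 ->
    0 < dot n e1 * cos (theta j) + dot n e2 * sin (theta j).
  move=> hn n0 nq; have [_ r0 rj] := ang j.
  have := relint_pos (inC j).1 rj n0 hn; rewrite -addrA addrC -addrA [- v + p]addrC ep.
  by dotE; rewrite nq mulr0 addr0 pmulr_rgt0 //; lra.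
have sgN j n : (forall x, rc (C j) x -> dot n x <= 0) -> n <> 0 -> dot n q = 0 ->
    dot n e1 * cos (theta j) + dot n e2 * sin (theta j) < 0.
  move=> hn n0 nq; have := sg j (- n); rewrite !dotNl nq oppr0 => h.
  have := h _ (N0 _ n0) erefl; rewrite !mulNr -opprD oppr_gt0; apply.
  by move=> x /hn; rewrite dotNl oppr_ge0.
have Aq := quadA Q4; have Bq := quadB Q4.
have Ai : 0 < dot A e1 * cos (theta i) + dot A e2 * sin (theta i).
  by apply: sg => // x /(quads1 Q4)[].
have Bi : 0 < dot B e1 * cos (theta i) + dot B e2 * sin (theta i).
  by apply: sg => // x /(quads1 Q4)[].
have As : dot A e1 * cos (theta (ordS i)) + dot A e2 * sin (theta (ordS i)) < 0.
  by apply: sgN => // x /(quads3 Q4)[].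
have Bs : dot B e1 * cos (theta (ordS i)) + dot B e2 * sin (theta (ordS i)) < 0.
  by apply: sgN => // x /(quads3 Q4)[].
have Aa : dot A e1 * cos (theta a) + dot A e2 * sin (theta a) < 0.
  by apply: sgN => // x; rewrite -Ea => /(quads2 Q4)[].
have Ba : 0 < dot B e1 * cos (theta a) + dot B e2 * sin (theta a).
  by apply: sg => // x; rewrite -Ea => /(quads2 Q4)[].
have Ab : 0 < dot A e1 * cos (theta b) + dot A e2 * sin (theta b).
  by apply: sg => // x; rewrite -Eb => /(quads4 Q4)[].
have Bb : dot B e1 * cos (theta b) + dot B e2 * sin (theta b) < 0.
  by apply: sgN => // x; rewrite -Eb => /(quads4 Q4)[].
have ai : a <> i by move=> e; move: Aa; rewrite e; lra.
have as_ : a <> ordS i by move=> e; move: Ba; rewrite e; lra.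
have bi : b <> i by move=> e; move: Bb; rewrite e; lra.
have bs : b <> ordS i by move=> e; move: Ab; rewrite e; lra.
have ab : a <> b by move=> e; move: Aa; rewrite e; lra.
(* Angles are measured from that of the cell [C i] on. *)
pose tau (j : 'I_k) := if (i <= j)%N then theta j else theta j + pi *+ 2.
have bnd j : 0 <= theta j < pi *+ 2 by have [] := ang j.
have tau0 : tau i = theta i by rewrite /tau leqnn.
have cost j : cos (tau j) = cos (theta j) by rewrite /tau; case: ifP => _ //; rewrite cosD2pi.
have sint j : sin (tau j) = sin (theta j) by rewrite /tau; case: ifP => _ //; rewrite sinD2pi.
have ltnj (j : 'I_k) : j <> i -> (i <= j)%N -> (i < j)%N.
  by move=> ji ij; rewrite ltn_neqAle ij andbT; apply/eqP => /val_inj/esym.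
have tau_lo j : j <> i -> tau i < tau j.
  move=> ji; rewrite tau0 /tau; case: ifP => [ij|_]; first by apply: inc; exact: ltnj.
  by have := bnd i; have := bnd j; lra.
have tau_hi j : j <> i -> tau j < tau i + pi *+ 2.
  move=> ji; rewrite tau0 /tau; case: ifP => ij; first by have := bnd i; have := bnd j; lra.
  by rewrite ltrD2r; apply: inc; rewrite ltnNge ij.
have tau_s j : j <> i -> j <> ordS i -> tau (ordS i) < tau j.
  move=> ji js; rewrite /tau.
  have [h|h] := ltnP i.+1 k.
    have es : val (ordS i) = i.+1 by rewrite /= modn_small.
    have -> : (i <= ordS i)%N by rewrite es.
    case: ifP => [ij|_]; last by have := bnd j; have := bnd (ordS i); lra.
    apply: inc; rewrite es ltn_neqAle (ltnj _ ji ij) andbT -es.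
    by apply/eqP => /val_inj/esym.
  have ek : i.+1 = k by apply/eqP; rewrite eqn_leq h andbT.
  have es : val (ordS i) = 0%N by rewrite /= ek modnn.
  have -> : (i <= ordS i)%N = false.
    rewrite es leqn0; apply/negbTE/eqP => i0; apply: neq; apply: val_inj.
    by rewrite es; exact: esym i0.
  have -> : (i <= j)%N = false.
    by apply/negbTE; apply/negP => ij; have := ltnj _ ji ij; rewrite ltnNge -ltnS ek ltn_ord.
  rewrite ltrD2r; apply: inc; rewrite es lt0n; apply/eqP => j0; apply: js.
  by apply: val_inj; rewrite es; exact: j0.
have tau_ab : tau a <> tau b.
  rewrite /tau; case: ifP => _; case: ifP => _ e.
  - by case: (ltngtP a b) => [/inc|/inc|/val_inj //]; rewrite e ltxx.
  - by have := bnd a; have := bnd b; lra.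
  - by have := bnd a; have := bnd b; lra.
  - by case: (ltngtP a b) => [/inc|/inc|/val_inj //]; rewrite (addIr _ e) ltxx.
case: (ltgtP (tau a) (tau b)) tau_ab => // h _.
  apply: (no_alternation (tau_lo _ neq) (tau_s _ ai as_) h (tau_hi _ bi) (k := dot B e1) (l := dot B e2));
  by rewrite cost sint.
apply: (no_alternation (tau_lo _ neq) (tau_s _ bi bs) h (tau_hi _ ai) (k := dot A e1) (l := dot A e2));
by rewrite cost sint.
Qed.

(** ** A cyclic order exists *)

(** An inner point of the cell, projected along [q], in polar coordinates. *)
Lemma cell_direction Q q e1 e2 c : F Q -> corib_ray v Q q -> frame q e1 e2 ->
  cell F c -> Q `<=` c -> exists rho theta, [/\ 0 <= theta < pi *+ 2, 0 < rho &
    relint c (v + q + rho *: (cos theta *: e1 + sin theta *: e2))].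
Proof.
move=> FQ HQ fr cc sub; have [Fc _] := cc.
have Xc : X (rc c) by exists c.
have cq : rc c q by apply/(corib_sub HF Hv HQ).
have cC := recenter_convex HF Hv Fc.
have [z [cz hz _]] := cell_inner HX Xc.
have [||g eg] := frame_mod (x := z - (dot e1 z *: e1 + dot e2 z *: e2)) fr.
- by dotE; rewrite (frame11 fr) (frame12 fr); ring.
- by dotE; rewrite (frame22 fr) (dotC e2 e1) (frame12 fr); ring.
have zE : z - g *: q = dot e1 z *: e1 + dot e2 z *: e2.
  by rewrite -eg opprB addrC subrK.
have n2 : 0 < dot e1 z ^+ 2 + dot e2 z ^+ 2.
  apply: (frame_nmod fr) => -[k ek].
  have [u hu] := corib_exposed HF Hv FQ HQ Xc cq; case: (hu) => uq u1 u2.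
  have [w [Xw wq wc _]] := third_cell HX fr Xc Xc hu hu.
  have [m sm] := tc_sep HX Xc Xw (nesym wc).
  have [m1 _ _ _] := sm; have mz := hz _ m1 (separator_neq0 Xc Xw (nesym wc) sm).
  by move: mz; rewrite ek dotZr (separator0 sm cq wq) mulr0 ltxx.
set r := Num.sqrt (dot e1 z ^+ 2 + dot e2 z ^+ 2).
have r0 : 0 < r by rewrite sqrtr_gt0.
have r2 : r ^+ 2 = dot e1 z ^+ 2 + dot e2 z ^+ 2 by rewrite sqr_sqrtr // ltW.
have [|t [t0 ct st]] := @polar_angle R (dot e1 z / r) (dot e2 z / r).
  by rewrite !expr_div_n -mulrDl -r2 divff // gt_eqF // exprn_gt0.
pose e := (1 + `|g|)^-1.
have g1 : 0 < 1 + `|g| by have := normr_ge0 g; lra.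
have e0 : 0 < e by rewrite invr_gt0.
exists (e * r), t; split=> //; first exact: mulr_gt0.
have -> : v + q + (e * r) *: (cos t *: e1 + sin t *: e2)
    = v + (e *: z + (1 - e * g) *: q).
  rewrite -addrA; congr (v + _).
  have -> : (e * r) *: (cos t *: e1 + sin t *: e2) = e *: (z - g *: q).
    rewrite zE ct st -scalerA scalerDr !scalerA.
    by rewrite ![r * _]mulrC !divfK // gt_eqF.
  by apply/rowP => i; rewrite !mxE; ring.
have eg1 : 0 <= 1 - e * g.
  have : e * g <= e * `|g| by rewrite ler_pM2l // ler_norm.
  have : e * (1 + `|g|) = 1 by rewrite mulVf // gt_eqF.
  lra.
apply: (inner_relint HF Hv cc).
  by apply: (coneD cC); apply: (coneZ cC) => //; exact: ltW.
move=> n hn n0; dotE; have := mulr_gt0 e0 (hz n hn n0).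
by have := mulr_ge0 eg1 (hn _ cq); lra.
Qed.

(** The cells are sorted by the angles of their chosen interior points. *)
Lemma cyclic_order_exists Q : corib F Q ->
  exists k (C : 'I_k -> set V), cyclic_order F Q C.
Proof.
move=> cQ; have [q HQ] := corib_has_ray HF hd Hv cQ; have [FQ _] := cQ.
have [e1 [e2 fr]] := ray_frame hd HQ.
have /choice[rt hrt] c : exists rt : R * R, cell F c -> Q `<=` c ->
    [/\ 0 <= rt.2 < pi *+ 2, 0 < rt.1 &
      relint c (v + q + rt.1 *: (cos rt.2 *: e1 + sin rt.2 *: e2))].
  have [[cc sub]|no] := pselect (cell F c /\ Q `<=` c).
    have [r [t h]] := cell_direction FQ HQ fr cc sub; by exists (r, t).
  by exists (0, 0) => cc sub; case: no.
have fS : finite_set [set c | cell F c /\ Q `<=` c].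
  have fF : finite_set F by case: (fan_axioms HF).
  by apply: sub_finite_set fF => c [[]].
have /finite_seqP[s0 hs0] := fS.
pose s := sort (fun c c' => (rt c).2 <= (rt c').2) (undup s0).
have us : uniq s by rewrite sort_uniq undup_uniq.
have sS c : c \in s <-> cell F c /\ Q `<=` c.
  rewrite mem_sort mem_undup; suff -> : (c \in s0) <-> [set` s0] c by rewrite -hs0.
  by [].
have inj c c' : c \in s -> c' \in s -> (rt c).2 = (rt c').2 -> c = c'.
  move=> /sS[cc sub] /sS[cc' sub'] E.
  have half c1 c2 : cell F c1 -> Q `<=` c1 -> cell F c2 -> Q `<=` c2 ->
      (rt c1).2 = (rt c2).2 -> (rt c1).1 <= (rt c2).1 -> c1 = c2.
    move=> h1 s1 h2 s2 E12 le12; apply: contrapT => n12.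
    have [_ r1 p1] := hrt _ h1 s1; have [_ r2 p2] := hrt _ h2 s2.
    have X1 : X (rc c1) by exists c1.
    have X2 : X (rc c2) by exists c2.
    have n12' : rc c1 <> rc c2 by move=> /recenter_inj.
    have [n sn] := tc_sep HX X1 X2 n12'; have n0 := separator_neq0 X1 X2 n12' sn.
    have [n1 m2 _ _] := sn.
    have := relint_pos h1 p1 n0 n1.
    set y := _ - v; suff : rc c2 y by move=> /m2; lra.
    have [F2 _] := h2; have cC := recenter_convex HF Hv F2.
    set z := cos (rt c1).2 *: e1 + sin (rt c1).2 *: e2 in y *.
    have z2 : rc c2 (q + (rt c2).1 *: z).
      by move: p2 => -[p2 _]; rewrite /recenter /= addrA /z E12.
    have -> : y = ((rt c1).1 / (rt c2).1) *: (q + (rt c2).1 *: z) + (1 - (rt c1).1 / (rt c2).1) *: q.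
      by apply/rowP => i; rewrite /y !mxE; field; rewrite gt_eqF.
    apply: (coneD cC); apply: (coneZ cC) => //.
    - by rewrite divr_ge0 // ltW.
    - by rewrite subr_ge0 ler_pdivrMr // mul1r.
    - exact/(corib_sub HF Hv HQ).
  have [le|le] := leP (rt c).1 (rt c').1; first exact: half.
  by apply: esym; apply: half => //; exact: ltW.
exists (size s), (fun i => nth set0 s i); split.
- by move=> i j /eqP; rewrite nth_uniq // => /eqP /val_inj.
- rewrite predeqE => c; split.
    by move=> [i _ <-]; apply/sS; exact: mem_nth.
  by move=> /sS /(nthP set0)[i ilt <-]; exists (Ordinal ilt).
exists (v + q), e1, e2, (fun i => (rt (nth set0 s i)).1), (fun i => (rt (nth set0 s i)).2).
have nrm e : dot e e = 1 -> enorm e = 1 by move=> E; rewrite /enorm E sqrtr1.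
split.
- exact: ray_relint HQ.
- by split; [exact: nrm (frame11 fr)|exact: nrm (frame22 fr)|exact: frame12 fr].
- move=> x y; rewrite (recenterE v Q x) (recenterE v Q y).
  move=> /(ray_span HQ)[a _ ea] /(ray_span HQ)[b _ eb].
  have -> : x - y = (a - b) *: q by rewrite scalerBl -ea -eb opprB addrA subrK.
  by rewrite !dotZr (frame1q fr) (frame2q fr) !mulr0.
- move=> i j ij.
  have le : (rt (nth set0 s i)).2 <= (rt (nth set0 s j)).2.
    apply: (sorted_leq_nth (leT := fun c c' => (rt c).2 <= (rt c').2)).
    + by move=> a b c; exact: le_trans.
    + by move=> a; exact: lexx.
    + by apply: sort_sorted => a b; exact: le_total.
    + exact: ltn_ord.
    + exact: ltn_ord.
    + exact: ltnW.
  rewrite lt_neqAle le andbT; apply/eqP => E.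
  have := inj _ _ (mem_nth _ (ltn_ord i)) (mem_nth _ (ltn_ord j)) E.
  by move/eqP; rewrite nth_uniq // => /eqP e; rewrite e ltnn in ij.
- by move=> i; have /sS[cc sub] := mem_nth set0 (ltn_ord i); exact: hrt.
Qed.

(** ** The scaling of a potential *)

Variable G : set V -> V.
Hypothesis Gle : forall C K, X C -> X K -> forall x, C x -> dot (G K) x <= dot (G C) x.
Hypothesis Gneq : forall C K, X C -> X K -> C <> K -> G C <> G K.

Definition jump c c' : V := G (rc c') - G (rc c).

Lemma jump_eq0 c c' x : cell F c -> cell F c' -> rc c x -> rc c' x -> dot (jump c c') x = 0.
Proof.
move=> cc cc' cx cx'; have Xc : X (rc c) by exists c.
have Xc' : X (rc c') by exists c'.
by have := Gle Xc Xc' cx; have := Gle Xc' Xc cx'; rewrite /jump; dotE; lra.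
Qed.

Lemma jump_ge0 c c' x : cell F c -> cell F c' -> rc c' x -> 0 <= dot (jump c c') x.
Proof.
move=> cc cc' cx; have Xc : X (rc c) by exists c.
have Xc' : X (rc c') by exists c'.
by have := Gle Xc' Xc cx; rewrite /jump; dotE; lra.
Qed.

Lemma jump_le0 c c' x : cell F c -> cell F c' -> rc c x -> dot (jump c c') x <= 0.
Proof.
move=> cc cc' cx; have Xc : X (rc c) by exists c.
have Xc' : X (rc c') by exists c'.
by have := Gle Xc Xc' cx; rewrite /jump; dotE; lra.
Qed.

Lemma jump_neq0 c c' : cell F c -> cell F c' -> c <> c' -> jump c c' <> 0.
Proof.
move=> cc cc' n /eqP; rewrite subr_eq0 => /eqP /esym; apply: Gneq.
- by exists c.
- by exists c'.
- by move=> /recenter_inj.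
Qed.

Lemma jump_normal c c' : cell F c -> cell F c' -> c <> c' ->
  unit_normal c c' ((enorm (jump c c'))^-1 *: jump c c').
Proof.
move=> cc cc' n; have m0 := enorm_gt0 (introN eqP (jump_neq0 cc cc' n)).
have i0 : 0 <= (enorm (jump c c'))^-1 by rewrite invr_ge0 ltW.
have z h : (c `&` c') h -> dot (jump c c') (h - v) = 0.
  by move=> [h1 h2]; apply: jump_eq0; rewrite // -recenterE.
split.
- by rewrite enormZ ger0_norm // mulVf // gt_eqF.
- move=> x y /z hx /z hy; rewrite dotZl.
  have -> : x - y = (x - v) - (y - v) by rewrite opprB addrA subrK.
  by rewrite dotDr dotNr hx hy subrr mulr0.
- move=> h x1 x2 /z hz; rewrite (recenterE v c x1) (recenterE v c' x2) => h1 h2.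
  have := jump_le0 cc cc' h1; have := jump_ge0 cc cc' h2; move: hz.
  rewrite !dotDr !dotNr !dotZl => g1 g2 g3.
  by apply/andP; split; apply: ler_wpM2l => //; lra.
Qed.

(** In the plane transverse to [q], a normal of the wall is determined up to a
factor, and its direction determines the sign. *)
Lemma jump_unique q e1 e2 x c c' n : frame q e1 e2 -> cell F c -> cell F c' -> c <> c' ->
  rc c q -> rc c' q -> rc c x -> rc c' x -> ~ (exists k, x = k *: q) ->
  unit_normal c c' n -> enorm (jump c c') *: n = jump c c'.
Proof.
move=> fr cc cc' ncc q1 q2 x1 x2 nx [n1 n2 n3].
have [Fc _] := cc; have [Fc' _] := cc'.
have vv : (c `&` c') v by split; exact: (vertex_mem Hv).
have z y : rc c y -> rc c' y -> dot n y = 0.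
  by move=> h1 h2; have := n2 (v + y) v (conj h1 h2) vv; rewrite addrC addKr.
have m0 := jump_neq0 cc cc' ncc.
have [a ea] := frame_line fr nx (z _ q1 q2) (z _ x1 x2).
have [b eb] := frame_line fr nx (jump_eq0 cc cc' q1 q2) (jump_eq0 cc cc' x1 x2).
have b0 : b != 0 by apply/eqP => b0; apply: m0; rewrite eb b0 scale0r.
set m := jump c c' in eb m0 *.
have nm : n = (a / b) *: m by rewrite eb scalerA divfK.
have Xc' : X (rc c') by exists c'.
have [ o [co ho _]] := cell_inner HX Xc'.
have mo : 0 < dot m o by apply: ho => // y; exact: jump_ge0.
have ab : 0 <= a / b.
  rewrite -(pmulr_lge0 _ mo) -dotZl -nm.
  have := n3 v v (v + o) vv; rewrite dotDr => /(_ (vertex_mem Hv Fc) co).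
  by move=> /andP[_]; lra.
have m1 := enorm_gt0 (introN eqP m0).
have : a / b * enorm m = 1 by rewrite -n1 nm enormZ ger0_norm.
by rewrite nm scalerA mulrC => ->; rewrite scale1r.
Qed.

(** At most two cells share a wall, so that its scaling factor is well defined. *)
Lemma jump_scaling : exists s : set V -> R, (forall H, 0 < s H) /\
  forall c c', cell F c -> cell F c' -> c <> c' -> abut (rc c) (rc c') ->
    s (c `&` c') = enorm (jump c c').
Proof.
suff /choice[s hs] : forall H, exists t, 0 < t /\ forall c c', cell F c -> cell F c' ->
    c <> c' -> abut (rc c) (rc c') -> c `&` c' = H -> t = enorm (jump c c').
  exists s; split=> [H|c c' cc cc' n ab]; first by case: (hs H).
  by have [_ h] := hs (c `&` c'); exact: h.
move=> H.
have [[c [c' [cc cc' n ab E]]]|no] := pselect (exists c c', [/\ cell F c, cell F c',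
    c <> c', abut (rc c) (rc c') & c `&` c' = H]); last first.
  by exists 1; split=> // c c' cc cc' n ab E; case: no; exists c, c'.
exists (enorm (jump c c')); split.
  by apply: enorm_gt0; apply/eqP; exact: jump_neq0.
move=> b b' cb cb' nb _ Eb.
have X1 : X (rc c) by exists c.
have X2 : X (rc c') by exists c'.
have n' : rc c <> rc c' by move=> /recenter_inj.
have [x [x1 x2 hx]] := abut_generic HX X1 X2 n' ab.
have Hx : (b `&` b') (v + x) by rewrite Eb -E; split.
have [bx b'x] := Hx.
have Xb : X (rc b) by exists b.
have Xb' : X (rc b') by exists b'.
have jN : jump c' c = (- 1) *: jump c c' by rewrite scaleN1r opprB.
case: (hx _ Xb bx) => /recenter_inj eb; case: (hx _ Xb' b'x) => /recenter_inj eb';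
  rewrite eb eb' // in nb *.
by rewrite jN enormZ normrN1 mul1r.
Qed.

Lemma potential_canonical_scaling : exists s, canonical_scaling F s.
Proof.
have [s [s0 hs]] := jump_scaling; exists s; split=> // Q cQ.
have [q HQ] := corib_has_ray HF hd Hv cQ; have [FQ _] := cQ.
have [e1 [e2 fr]] := ray_frame hd HQ.
have facts k (C : 'I_k -> set V) : cyclic_order F Q C -> forall i,
    [/\ unit_normal (C i) (C (ordS i))
          ((enorm (jump (C i) (C (ordS i))))^-1 *: jump (C i) (C (ordS i)))
      & forall n, unit_normal (C i) (C (ordS i)) n ->
          s (C i `&` C (ordS i)) *: n = jump (C i) (C (ordS i))].
  move=> hC i; have [nC [x [x1 x2 nx]]] := consecutive_common i FQ HQ hC.
  have [_ Cr _] := hC.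
  have inC j : cell F (C j) /\ rc (C j) q.
    have : range C (C j) by exists j.
    rewrite Cr => -[cc sub]; split=> //; have [Fc _] := cc.
    exact/(corib_sub HF Hv HQ).
  have [cc q1] := inC i; have [cc' q2] := inC (ordS i).
  split; first exact: jump_normal.
  move=> n hn; rewrite hs //; first exact: (jump_unique fr cc cc' nC q1 q2 x1 x2 nx hn).
  by exists q, e1, e2, x.
have telescope k (C : 'I_k -> set V) : \sum_(i < k) jump (C i) (C (ordS i)) = 0.
  rewrite /jump sumrB (reindex_inj (@ordS_inj k) (F := fun i => G (rc (C i)))) /=.
  exact: subrr.
rewrite predeqE => t; split.
  move=> [k [C [n [hC hn ->]]]] /=.
  rewrite -[RHS](telescope k C); apply: eq_bigr => i _.
  by have [_ h] := facts k C hC i; exact: h.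
move=> /= ->; have [k [C hC]] := cyclic_order_exists cQ.
exists k, C, (fun i => (enorm (jump (C i) (C (ordS i))))^-1 *: jump (C i) (C (ordS i))).
split=> //; first by move=> i; have [] := facts k C hC i.
rewrite -[LHS](telescope k C); apply: eq_bigr => i _.
by have [h1 h2] := facts k C hC i; rewrite h2.
Qed.

End Torsion.

Theorem mainTheorem6 (R : realType) (d : nat) (F : set (set 'rV[R]_d))
    (hd : d = 2%N \/ d = 3%N) (hF : tight_fan F) :
  exists s : set 'rV[R]_d -> R, canonical_scaling F s.
Proof.
have [_ [v Hv] _ _] := hF.
have HX := tight_fan_cells hF Hv.
(* Without coribs, every scaling is canonical. *)
have [[Q cQ]|no] := pselect (exists Q, corib F Q); last first.
  by exists (fun=> 1); split=> // Q cQ; case: no; exists Q.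
have [g [g0 gle gneq]] : has_potential (cells F v).
  have [q HQ] := corib_has_ray hF hd Hv cQ; have [FQ _] := cQ.
  case: (hd) => E.
    have h3 : d = 3%N -> (0 : 'rV[R]_d) <> 0 by move=> E'; have := etrans (esym E) E'.
    have [e1 [e2 fr]] := exists_frame hd (fun=> erefl) h3.
    exact: (potential2 HX fr).
  apply: (potential3 HX).
    move=> p p0; apply: (exists_frame hd) => // E'.
    by have := etrans (esym E) E'.
  exists q; first exact: (ray_dim3 HQ).
  exact: (corib_exposed hF Hv FQ HQ).
have /choice[G hG] C : exists a, cells F v C -> g C a.
  by have [/g0[a ga]|nX] := pselect (cells F v C); [exists a|exists 0].
apply: (potential_canonical_scaling hF hd Hv (G := G)).
  by move=> C K XC XK x Cx; apply: gle Cx; exact: hG.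
by move=> C K XC XK; apply: gneq => //; exact: hG.
Qed.
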